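(* For $w>-1$ let $j_w(z)=\sum_{n\ge0}\frac{(-1)^nz^n\Gamma(w+1)}{n!\,\Gamma(n+w+1)}$. (1) Let $P$ be a homogeneous polynomial of degree $k\ge1$ with complex coefficients, let $f(\tau)=P(x(\tau),y(\tau))=\sum_{n\ge0}c_f(n)e^{\pi i n\tau}$, and \[ g_f(z;\tau)=\sum_{n\geq 0}c_f(n)\,j_{2k-1}(\pi^2 nz)\,e^{\pi i n\tau}. \] Then $g_f(z;\tau)=e^{A(\tau)z}\sum_{n\geq 0}f_n(\tau)z^n$, where the functions $f_n(\tau)$ are modular with respect to $\Gamma(2)$ and are given by $f_n(\tau)=\pi^{2n}x(\tau)^{n+k}P_{n,f}(u(\tau))$, with polynomials $P_{n,f}$ determined by $P_{-1,f}(u)=0$, $P_{0,f}(u)=P(1,u)$ and \[ (n+1)(n+2k)P_{n+1,f}(u)+(u^2-u)P'_{n,f}(u)-(n+k)uP_{n,f}(u)+\frac{uP_{n-1,f}(u)}{4}=0\qquad(n\ge0). \] (2) Let $a\in\mathbb Z_{\ge0}$ and $b,c\ge0$ with $4b,4c\in\mathbb Z_{\geq 0}$, put $w=2(a+b+c)$ and assume $w>0$. Let $F(\tau)=y(\tau)^a(-x(\tau))^b(y(\tau)-x(\tau))^c=\sum_{n\ge0}c_F(n)e^{\pi i n\tau}$ and \[ g_F(z;\tau)=\sum_{n\geq 0}c_F(n)e^{\pi i n\tau}j_{w-1}(\pi^2 nz). \] Then $g_F(z;\tau)=e^{A(\tau)z}\sum_{n\geq 0}F_n(\tau)z^n$ with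 $F_n(\tau)=F(\tau)\pi^{2n}x(\tau)^n\varphi_n(u(\tau))$, where $\varphi_n(u)$ are polynomials with rational coefficients such that $\varphi_{-1}=0$, $\varphi_0=1$ and \[ (n+1)(n+w)\varphi_{n+1}(u)+(u^2-u)\varphi'_n(u)-(a+(n+b)u)\varphi_n(u)+\frac{u\varphi_{n-1}(u)}{4}=0\qquad(n\ge0). \]
   Context: $\mathbb H$ is the upper half-plane and $\tau\in\mathbb H$, $z\in\mathbb C$. $\theta(\tau)=\sum_{n\in\mathbb Z}e^{\pi i n^2\tau}$, $\theta_4(\tau)=\sum_{n\in\mathbb Z}(-1)^ne^{\pi i n^2\tau}$, $x(\tau)=-\theta_4(\tau)^4$, $y(\tau)=\big(\sum_{n\in\mathbb Z+\frac12}e^{\pi i n^2\tau}\big)^4$, $u=y/x$; one has $y-x=\theta^4$. In part (2) the fractional powers are understood as $(-x)^b=\theta_4^{4b}$ and $(y-x)^c=\theta^{4c}$. $t(\tau)=\frac{1}{2\pi i}\frac{\partial\log\theta}{\partial\tau}$, $A(\tau)=-4\pi^2t(\tau)$. $\Gamma(2)=\{\gamma\in SL(2,\mathbb Z):\gamma\equiv I\pmod 2\}$; a modular form of weight $k$ for $\Gamma(2)$ is a holomorphic $f$ on $\mathbb H$ with $f(\frac{a\tau+b}{c\tau+d})=(c\tau+d)^kf(\tau)$ for all matrices in $\Gamma(2)$ and at most polynomial growth in $y^{-1}$ of $|f(r+iy)|$ as $y\to0^+$ for each $r\in\mathbb Q$. *)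

(* Defs.v *)
From HB Require Import structures.
From mathcomp Require Import all_boot all_order all_algebra.
From mathcomp Require Import -(notations) mpoly.
From mathcomp Require Import all_classical all_reals all_analysis.
From mathcomp Require Export complex.

Set Implicit Arguments.
Unset Strict Implicit.
Unset Printing Implicit Defensive.
Import Order.TTheory GRing.Theory Num.Theory.
Import numFieldNormedType.Exports.
Local Open Scope classical_set_scope.
Local Open Scope ring_scope.
Local Open Scope complex_scope.

(* The norm topology of R[i], seen as a normed space over itself, so that
   [derive1] and [derivable] on R[i] are complex differentiation. *)
HB.instance Definition _ (R : realType) := NormedModule.copy R[i] R[i]^o.

Section Theta.
Variable R : realType.
Local Notation C := R[i].
Implicit Types (tau z : C).

Definition csum (a : nat -> C) : C := limn (series a).

(* Sum over all integers: [Negz n] is [- n.+1]. *)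
Definition zsum (a : int -> C) : C :=
  csum (fun n => a (Posz n)) + csum (fun n => a (Negz n)).

Definition cexp z : C :=
  (expR (complex.Re z))%:C * (cos (complex.Im z) +i* sin (complex.Im z)).

Definition inH tau : Prop := 0 < complex.Im tau.

(* exp (pi i s tau) *)
Definition epi (s : C) tau : C := cexp (pi%:C * 'i * s * tau).

Definition theta tau : C := zsum (fun n => epi (n%:~R ^+ 2) tau).

Definition theta4 tau : C :=
  zsum (fun n => (-1) ^ n * epi (n%:~R ^+ 2) tau).

(* The sum of exp (pi i n^2 tau) over n in Z + 1/2. *)
Definition theta_half tau : C :=
  zsum (fun n => epi ((n%:~R + 2^-1) ^+ 2) tau).

Definition xf tau : C := - theta4 tau ^+ 4.
Definition yf tau : C := theta_half tau ^+ 4.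
Definition uf tau : C := yf tau / xf tau.

(* The powers (-x)^b and (y-x)^c, for 4b and 4c natural numbers, taken through
   -x = theta4^4 and y - x = theta^4. *)
Definition powNx (b : rat) tau : C := theta4 tau ^+ Num.truncn (4 * b).
Definition powyBx (c : rat) tau : C := theta tau ^+ Num.truncn (4 * c).

(* d(log theta)/dtau is read as the logarithmic derivative theta'/theta. *)
Definition tf tau : C := (2 * pi%:C * 'i)^-1 * (derive1 theta tau / theta tau).

Definition Af tau : C := - (4 * pi%:C ^+ 2) * tf tau.

(* Euler's integral, used for s > 0 only. *)
Definition Gamma (s : R) : R :=
  \int[lebesgue_measure]_(t in `]0, +oo[) (t `^ (s - 1) * expR (- t)).

Definition jw (w : R) z : C :=
  csum (fun n => (-1) ^+ n * z ^+ n * (Gamma (w + 1))%:C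
                 / (n`!%:R * (Gamma (n%:R + w + 1))%:C)).

Definition is_expansion (f : C -> C) (c : nat -> C) : Prop :=
  forall tau, inH tau ->
    series (fun n => c n * epi n%:R tau) @ \oo --> f tau.

Definition g_term (c : nat -> C) (w : R) z tau : nat -> C :=
  fun n => c n * jw w (pi%:C ^+ 2 * n%:R * z) * epi n%:R tau.

Definition in_Gamma2 (g : 'M[int]_2) : Prop :=
  \det g = 1 /\ forall i j, (g i j = (1%:M : 'M[int]_2) i j %[mod 2])%Z.

Definition mobius (g : 'M[int]_2) tau : C :=
  ((g 0 0)%:~R * tau + (g 0 1)%:~R) / ((g 1 0)%:~R * tau + (g 1 1)%:~R).

Definition modular_form_Gamma2 (k : nat) (f : C -> C) : Prop :=
  [/\ forall tau, inH tau -> derivable f tau 1,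
      forall g tau, in_Gamma2 g -> inH tau ->
        f (mobius g tau) = ((g 1 0)%:~R * tau + (g 1 1)%:~R) ^+ k * f tau
    & forall r : rat, exists (N : nat) (M : R),
        \forall y \near (0 : R)^'+,
          `|f (ratr r +i* y)| <= (M * y ^- N)%:C].

End Theta.

(* The term of index n - 1, where the term of index -1 is 0. *)
Definition prev_poly (K : fieldType) (P : nat -> {poly K}) (n : nat) : {poly K} :=
  if n is m.+1 then P m else 0.

(* Main.v *)
(* Write D for (1 / pi i) d/dtau and p = D theta / theta, so A = - 2 pi^2 p.
   Coefficientwise, g = sum_m b_m pi^(2m) D^m(f) z^m where b_m are the Bessel
   coefficients, so the recurrence for g exp(- A z) follows from
   D x = x (4 p - y), D y = y (4 p - x), D p = 2 p^2 - x y / 8. These equations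
   come from the duplication formulas of the theta functions: both sides are
   compared at tau and 2 tau, and the iterates 2^k tau tend to i oo, where the
   q-expansions decide.

   Modularity rests on x(- 1 / tau) = tau^2 y(tau). On the imaginary axis,
   theta^2 and theta_4^2 at 2^n s form an arithmetic-geometric iteration of
   limit 1, and so do (after division by 2^n s) theta^2 and theta_2^2 at
   1 / (2^n s), the limit being found by comparing theta with a Gaussian
   integral. The limit of the iteration is an increasing function of the ratio
   of its starting values, which forces the two ratios to agree. The identity
   spreads from the axis to the half-plane because both sides solve the same
   system of differential equations. *)

Require Import Defs.
From HB Require Import structures.
From mathcomp Require Import all_boot all_order all_algebra.
From mathcomp Require Import -(notations) mpoly.
From mathcomp Require Import all_classical all_reals all_analysis.
From mathcomp Require Import ring lra zify.
Set Implicit Arguments.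
Unset Strict Implicit.
Unset Printing Implicit Defensive.
Import Order.TTheory GRing.Theory Num.Theory.
Import numFieldNormedType.Exports.
Local Open Scope classical_set_scope.
Local Open Scope ring_scope.
Local Open Scope complex_scope.

(** The obstacle is [p], which is not modular. The derivative of a form of weight [m] contains
    [2 m p] times the form; the factor exp (A z) is the one that cancels this term, and since
    [A^2 + pi^2 D A] is free of [p^2], the recurrence for the quotient involves [x] and [y] alone.
    Its solutions [x^(n+k) P_n(u)] have [P_n] of degree at most [n + k], so they are homogeneous
    polynomials in [x] and [y], and both modularity and growth become questions about these two
    functions.

    The differential system has three unknowns, whereas the comparison of means gives the inversion
    of [x] and [y] only. The missing initial value, that of [p] at i, is read off the derivative of
    [x] along the axis.

    Sums are taken over finite subsets of an arbitrary index type, because one family has to be read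
    over Z, over Z^2 split by parity, by rows, by columns and by exponent of q. *)

Section ComplexModulus.
Variable R : realType.
Local Notation C := R[i].
Implicit Types z w : C.

(** The norm of [R[i]] takes its values in [R[i]], which is only partially ordered; a modulus in [R]
    is open to [lra] and [nra]. *)
Definition cabs z : R := complex.Re `|z|.

Lemma cabsE z : (cabs z)%:C = `|z|.
Proof. by rewrite /cabs RRe_real ?normr_real. Qed.

Lemma cabs_ge0 z : 0 <= cabs z.
Proof. by rewrite -lecR cabsE normr_ge0. Qed.

Lemma cabsM z w : cabs (z * w) = cabs z * cabs w.
Proof. by apply: complexI; rewrite rmorphM /= !cabsE normrM. Qed.

Lemma cabsD z w : cabs (z + w) <= cabs z + cabs w.
Proof. by rewrite -lecR rmorphD /= !cabsE ler_normD. Qed.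

Lemma cabsN z : cabs (- z) = cabs z.
Proof. by rewrite /cabs normrN. Qed.

Lemma cabsC z w : cabs (z - w) = cabs (w - z).
Proof. by rewrite /cabs distrC. Qed.

Lemma cabsB z w : cabs (z - w) <= cabs z + cabs w.
Proof. by rewrite -(cabsN w) cabsD. Qed.

Lemma cabs_triangle w z t : cabs (z - t) <= cabs (z - w) + cabs (w - t).
Proof. by rewrite -[z - t](subrKA w) cabsD. Qed.

Lemma cabs0 : cabs 0 = 0.
Proof. by rewrite /cabs normr0. Qed.

Lemma cabs1 : cabs 1 = 1.
Proof. by rewrite /cabs normr1. Qed.

Lemma cabs_eq0 z : (cabs z == 0) = (z == 0).
Proof. by rewrite -(inj_eq (@complexI R)) cabsE normr_eq0. Qed.

Lemma cabs_gt0 z : (0 < cabs z) = (z != 0).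
Proof. by rewrite lt_def cabs_ge0 cabs_eq0 andbT. Qed.

Lemma cabsX z n : cabs (z ^+ n) = cabs z ^+ n.
Proof. by elim: n => [|n IH]; rewrite ?cabs1// !exprS cabsM IH. Qed.

Lemma cabsV z : cabs z^-1 = (cabs z)^-1.
Proof. by apply: complexI; rewrite fmorphV /= !cabsE normfV. Qed.

Lemma cabs_real (x : R) : cabs x%:C = `|x|.
Proof.
apply: complexI; rewrite cabsE normc_def /=.
by rewrite expr0n /= addr0 sqrtr_sqr.
Qed.

Lemma cabs_nat n : cabs n%:R = n%:R.
Proof. by rewrite -(rmorph_nat (real_complex R)) /= cabs_real ger0_norm. Qed.

Lemma cabs_def z : cabs z = Num.sqrt (complex.Re z ^+ 2 + complex.Im z ^+ 2).
Proof. by rewrite /cabs normc_def. Qed.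

Lemma cabs_Re z : `|complex.Re z| <= cabs z.
Proof. by rewrite -lecR cabsE normc_ge_Re. Qed.

Lemma cabs_Im z : `|complex.Im z| <= cabs z.
Proof.
rewrite cabs_def -sqrtr_sqr ler_wsqrtr// lerDr.
by rewrite sqr_ge0.
Qed.

Lemma cabs_ReIm z : cabs z <= `|complex.Re z| + `|complex.Im z|.
Proof.
rewrite cabs_def -[leRHS]ger0_norm ?addr_ge0// -sqrtr_sqr ler_wsqrtr//.
rewrite sqrrD !real_normK ?num_real//; have := normr_ge0 (complex.Re z).
have := normr_ge0 (complex.Im z).
nra.
Qed.

Lemma cabs_sum (I : Type) (s : seq I) (P : pred I) (F : I -> C) :
  cabs (\sum_(i <- s | P i) F i) <= \sum_(i <- s | P i) cabs (F i).
Proof.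
elim/big_rec2: _ => [|i y1 y2 _ H]; first by rewrite cabs0.
by apply: le_trans (cabsD _ _) _; rewrite lerD2l.
Qed.

Lemma cabs_eps_eq0 z : (forall e : R, 0 < e -> cabs z < e) -> z = 0.
Proof.
move=> H; apply/eqP; rewrite -cabs_eq0; apply/negPn/negP => /negP H0.
have : 0 < cabs z by rewrite cabs_gt0 -cabs_eq0; apply/negP.
by move=> /H; rewrite ltxx.
Qed.

Lemma cvgCP (u : nat -> C) (l : C) : (u @ \oo --> l) <->
  (forall e : R, 0 < e ->
     exists N, forall n, (N <= n)%N -> cabs (u n - l) < e).
Proof.
split.
  move=> /cvgrPdist_lt H e e0.
  have e0' : (0 : C) < e%:C by rewrite ltcR.
  have [N _ HN] := H _ e0'.
  exists N => n Nn.
  by have := HN n Nn; rewrite distrC -cabsE ltcR.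
move=> H; apply/cvgrPdist_lt => e e0.
have er : e = (complex.Re e)%:C by rewrite RRe_real// gtr0_real.
have [|N HN] := H (complex.Re e); first by rewrite -ltcR -er.
exists N => // n /= Nn; rewrite distrC -cabsE er ltcR; exact: HN.
Qed.

Lemma limnC (u : nat -> C) (l : C) : u @ \oo --> l -> limn u = l.
Proof. by move=> H; apply: (cvg_lim _ H); exact: norm_hausdorff. Qed.

End ComplexModulus.

(** * Absolutely convergent families *)

Section Summation.
Variable R : realType.
Local Notation C := R[i].

Lemma big_subset (I : eqType) (T : nmodType) (f : I -> T) (s t : seq I) :
  uniq s -> uniq t -> {subset s <= t} ->
  \sum_(i <- t | i \in s) f i = \sum_(i <- s) f i.
Proof.
move=> us ut st; rewrite -big_filter; apply: perm_big; apply: uniq_perm => //.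
  exact: filter_uniq.
by move=> i; rewrite mem_filter; case: (boolP (i \in s)) => //= /st.
Qed.

Lemma ler_sum_subset (I : eqType) (f : I -> R) (s t : seq I) :
  uniq s -> uniq t -> {subset s <= t} -> (forall i, 0 <= f i) ->
  \sum_(i <- s) f i <= \sum_(i <- t) f i.
Proof.
move=> us ut st f0; rewrite [leRHS](bigID (mem s)) /= big_subset// lerDl.
by apply: sumr_ge0.
Qed.

(** A bound on all finite subsums, with no enumeration of the index type. It is a component of
    [has_sum], so that every sum may be reindexed or regrouped. *)
Definition absum (I : eqType) (a : I -> C) :=
  exists M : R, forall s : seq I, uniq s -> \sum_(i <- s) cabs (a i) <= M.

Definition has_sum (I : eqType) (a : I -> C) (l : C) :=
  absum a /\ forall e : R, 0 < e ->
    exists2 s0 : seq I, uniq s0 & forall s, uniq s -> {subset s0 <= s} ->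
      cabs (\sum_(i <- s) a i - l) < e.

Lemma has_sum_absum (I : eqType) (a : I -> C) l : has_sum a l -> absum a.
Proof. by case. Qed.

Lemma uniq_join (I : eqType) (s0 s1 : seq I) :
  exists2 s, uniq s & {subset s0 <= s} /\ {subset s1 <= s}.
Proof.
exists (undup (s0 ++ s1)); first exact: undup_uniq.
by split => x xs; rewrite mem_undup mem_cat xs ?orbT.
Qed.

Lemma has_sum_unique (I : eqType) (a : I -> C) l l' :
  has_sum a l -> has_sum a l' -> l = l'.
Proof.
move=> [_ H] [_ H']; apply/eqP; rewrite -subr_eq0; apply/eqP.
apply: cabs_eps_eq0 => e e0.
have [s0 _ {}H] := H (e / 2) (divr_gt0 e0 (ltr0Sn _ _)).
have [s1 _ {}H'] := H' (e / 2) (divr_gt0 e0 (ltr0Sn _ _)).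
have [s us [h0 h1]] := uniq_join s0 s1.
have := cabs_triangle (\sum_(i <- s) a i) l l'.
have := H s us h0; rewrite (cabsC l (\sum_(i <- s) a i)); have := H' s us h1.
lra.
Qed.

Lemma absum_le (I : eqType) (a b : I -> C) :
  (forall i, cabs (a i) <= cabs (b i)) -> absum b -> absum a.
Proof.
move=> ab [M HM]; exists M => s us.
by apply: le_trans (HM s us); apply: ler_sum => i _.
Qed.

Lemma has_sum_ext (I : eqType) (a b : I -> C) l :
  a =1 b -> has_sum a l -> has_sum b l.
Proof. by move=> /funext->. Qed.

Lemma absumD (I : eqType) (a b : I -> C) :
  absum a -> absum b -> absum (fun i => a i + b i).
Proof.
move=> [M HM] [N HN]; exists (M + N) => s us.
apply: le_trans (lerD (HM s us) (HN s us)).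
by rewrite -big_split /=; apply: ler_sum => i _; exact: cabsD.
Qed.

Lemma absumZ (I : eqType) (a : I -> C) c :
  absum a -> absum (fun i => c * a i).
Proof.
move=> [M HM]; exists (cabs c * M) => s us.
under eq_bigr do rewrite cabsM.
by rewrite -mulr_sumr ler_wpM2l ?cabs_ge0 ?HM.
Qed.

Lemma has_sumD (I : eqType) (a b : I -> C) l m :
  has_sum a l -> has_sum b m -> has_sum (fun i => a i + b i) (l + m).
Proof.
move=> [A H] [B H']; split; first exact: absumD.
move=> e e0.
have [s0 _ {}H] := H (e / 2) (divr_gt0 e0 (ltr0Sn _ _)).
have [s1 _ {}H'] := H' (e / 2) (divr_gt0 e0 (ltr0Sn _ _)).
have [s us [h0 h1]] := uniq_join s0 s1.
exists s => // t ut st.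
rewrite big_split /= opprD addrACA.
apply: le_lt_trans (cabsD _ _) _.
have := H t ut (fun x h => st _ (h0 x h)).
have := H' t ut (fun x h => st _ (h1 x h)).
lra.
Qed.

Lemma has_sumZ (I : eqType) (a : I -> C) c l :
  has_sum a l -> has_sum (fun i => c * a i) (c * l).
Proof.
move=> [A H]; split; first exact: absumZ.
move=> e e0.
have c1 : 0 < cabs c + 1 by rewrite ltr_wpDl ?cabs_ge0.
have [s0 u0 {}H] := H (e / (cabs c + 1)) (divr_gt0 e0 c1).
exists s0 => // t ut st.
rewrite -mulr_sumr -mulrBr cabsM.
have := H t ut st; rewrite ltr_pdivlMr// => Ht.
apply: le_lt_trans Ht.
rewrite mulrC ler_wpM2l ?cabs_ge0//; lra.
Qed.

Lemma has_sumN (I : eqType) (a : I -> C) l :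
  has_sum a l -> has_sum (fun i => - a i) (- l).
Proof.
move=> /(has_sumZ (-1)); rewrite mulN1r; apply: has_sum_ext => i.
by rewrite mulN1r.
Qed.

Lemma has_sumB (I : eqType) (a b : I -> C) l m :
  has_sum a l -> has_sum b m -> has_sum (fun i => a i - b i) (l - m).
Proof. by move=> A /has_sumN; apply: has_sumD. Qed.

Lemma has_sum_finsupp (I : eqType) (a : I -> C) (s0 : seq I) : uniq s0 ->
  (forall i, i \notin s0 -> a i = 0) -> has_sum a (\sum_(i <- s0) a i).
Proof.
move=> u0 H.
have E (T : nmodType) (f : I -> T) s : uniq s -> {subset s0 <= s} ->
    (forall i, i \notin s0 -> f i = 0) ->
    \sum_(i <- s) f i = \sum_(i <- s0) f i.
  move=> us ss f0; rewrite (bigID (mem s0)) /= [X in _ + X]big1 ?addr0.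
    exact: big_subset.
  by move=> i; exact: f0.
split.
  exists (\sum_(i <- s0) cabs (a i)) => s us.
  have [t ut [h0 h1]] := uniq_join s s0.
  rewrite -(E _ (fun i => cabs (a i)) t ut h1); last first.
    by move=> i /H ->; rewrite cabs0.
  by apply: ler_sum_subset => // i; exact: cabs_ge0.
move=> e e0; exists s0 => // s us ss.
by rewrite (E _ a s us ss H) subrr cabs0.
Qed.

Lemma has_sum_sup (I : eqType) (a : I -> R) :
  (forall i, 0 <= a i) -> absum (fun i => (a i)%:C) ->
  exists l : R, has_sum (fun i => (a i)%:C) l%:C.
Proof.
move=> a0 A.
have [M HM] := A.
pose S := [set x : R | exists2 s : seq I, uniq s & x = \sum_(i <- s) a i].
have S0 : S !=set0 by exists 0, [::]; rewrite ?big_nil.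
have SM : ubound S M.
  move=> _ [s us ->]; have := HM s us.
  by under eq_bigr do rewrite cabs_real ger0_norm//.
have hS : has_sup S by split => //; exists M.
exists (sup S); split => // e e0.
have [_ [s us ->] Hs] := sup_adherent e0 hS.
exists s => // t ut st.
rewrite -rmorph_sum -rmorphB /= cabs_real.
have le1 : \sum_(i <- t) a i <= sup S.
  by apply: (sup_upper_bound hS); exists t.
have le2 : \sum_(i <- s) a i <= \sum_(i <- t) a i by exact: ler_sum_subset.
rewrite distrC ger0_norm; lra.
Qed.

Lemma has_sum_ex (I : eqType) (a : I -> C) : absum a -> exists l, has_sum a l.
Proof.
move=> A.
(* A real family is the difference of the nonnegative families [|f| + f] and [|f|], whose sums are
   suprema; this is applied to [Re] and [Im]. *)
have part (f : C -> R) : (forall z, `|f z| <= cabs z) ->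
    exists l, has_sum (fun i => (f (a i))%:C) l.
  move=> fz.
  have [||l1 h1] := @has_sum_sup I (fun i => (`|f (a i)| + f (a i))).
  - by move=> i; have := ler_norm (- f (a i)); rewrite normrN; lra.
  - apply: absum_le (absumD A A) => i; rewrite -mulr2n -mulr_natl cabsM cabs_nat.
    rewrite cabs_real; apply: le_trans (ler_normD _ _) _.
    by rewrite normr_id; have := fz (a i); lra.
  have [||l2 h2] := @has_sum_sup I (fun i => `|f (a i)|).
  - by move=> i.
  - by apply: absum_le A => i; rewrite cabs_real normr_id.
  exists (l1%:C - l2%:C); apply: has_sum_ext (has_sumB h1 h2) => i.
  by rewrite rmorphD /= addrAC subrr add0r.
have [l1 h1] := part _ (@cabs_Re R).
have [l2 h2] := part _ (@cabs_Im R).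
exists (l1 + 'i * l2).
apply: has_sum_ext (has_sumD h1 (has_sumZ 'i h2)) => i.
by rewrite [RHS]complexE.
Qed.

Lemma has_sum_le (I : eqType) (a : I -> C) l (M : R) :
  has_sum a l -> (forall s, uniq s -> \sum_(i <- s) cabs (a i) <= M) ->
  cabs l <= M.
Proof.
move=> [_ H] HM; rewrite leNgt; apply/negP => ML.
have [|s us {}H] := H (cabs l - M); first lra.
have := H s us (fun _ => id); rewrite cabsC.
have := cabsB (l - \sum_(i <- s) a i) (- \sum_(i <- s) a i).
rewrite opprK subrK cabsN.
have := le_trans (cabs_sum s xpredT a) (HM s us).
lra.
Qed.

Lemma absum_inj (I J : eqType) (h : J -> I) (a : I -> C) :
  injective h -> absum a -> absum (a \o h).
Proof.
move=> hi [M HM]; exists M => s us.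
have := HM (map h s); rewrite map_inj_uniq// => /(_ us).
by rewrite big_map.
Qed.

Lemma has_sum_inj (I J : eqType) (h : J -> I) (a : I -> C) l :
  injective h -> (forall i, a i != 0 -> exists j, i = h j) ->
  has_sum (a \o h) l <-> has_sum a l.
Proof.
move=> hi ha.
(* The inverse of [h] on its range as a partial function; [pmap g] carries finite lists of indices
   back along [h]. *)
pose g i : option J :=
  if pselect (exists j, i = h j) is left P then Some (sval (cid P)) else None.
have gP i j : g i = Some j -> i = h j.
  by rewrite /g; case: pselect => // P [<-]; case: (cid P).
have gN i : g i = None -> a i = 0.
  rewrite /g; case: pselect => // P _; apply/eqP/negPn/negP => /ha //.
have gh j : g (h j) = Some j.
  case E : (g (h j)) => [j'|]; first by rewrite (hi _ _ (gP _ _ E)).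
  move: E; rewrite /g; case: pselect => // -[]; by exists j.
have E (T : nmodType) (f : I -> T) (s : seq I) :
    (forall i, a i = 0 -> f i = 0) ->
    \sum_(i <- s) f i = \sum_(j <- pmap g s) f (h j).
  move=> f0; elim: s => [|i s IH]; first by rewrite !big_nil.
  rewrite big_cons /=; case G : (g i) => [j|] /=.
    by rewrite big_cons IH -(gP _ _ G).
  by rewrite IH f0 ?add0r// gN.
have mg s j : (j \in pmap g s) = (h j \in s).
  rewrite mem_pmap; apply/mapP/idP => [[i is_ /esym/gP <-]//|hs].
  by exists (h j).
have ug s : uniq s -> uniq (pmap g s).
  elim: s => //= i s IH /andP[is_ us]; case G : (g i) => [j|] /=; last exact: IH.
  by rewrite IH// andbT mg -(gP _ _ G).
split.
- move=> [[M HM] H]; split.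
    exists M => s us; rewrite (E _ (fun i => cabs (a i))).
      exact: HM (ug _ us).
    by move=> i ->; rewrite cabs0.
  move=> e e0; have [s0 u0 {}H] := H e e0.
  exists (map h s0); first by rewrite map_inj_uniq.
  move=> s us ss; rewrite (E _ a)//; apply: H; first exact: ug.
  by move=> j js; rewrite mg ss// map_f.
- move=> [A H]; split; first exact: absum_inj.
  move=> e e0; have [s0 u0 {}H] := H e e0.
  exists (pmap g s0); first exact: ug.
  move=> s us ss.
  have [t ut [h0 h1]] : exists2 t, uniq t & {subset s0 <= t} /\
      forall i, (i \in t) = (i \in s0) || (i \in map h s).
    exists (undup (s0 ++ map h s)); first exact: undup_uniq.
    by split => i; rewrite mem_undup mem_cat ?h0// => ->.
  suff -> : \sum_(j <- s) (a \o h) j = \sum_(i <- t) a i by apply: H.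
  rewrite (E _ a)//; apply: perm_big; apply: uniq_perm => //; first exact: ug.
  move=> j; rewrite mg h1 mem_map// -mg.
  by case: (boolP (j \in pmap g s0)) => //= /ss.
Qed.

Lemma has_sum_bij (I J : eqType) (h : J -> I) (a : I -> C) l :
  bijective h -> has_sum (a \o h) l <-> has_sum a l.
Proof.
move=> [h' hK h'K]; apply: has_sum_inj; first exact: can_inj hK.
by move=> i _; exists (h' i).
Qed.

(** Regrouping along the fibres of [f]: iterated sums, Cauchy products and the collection of equal
    exponents of q are instances. *)
Lemma has_sum_fiber (I J : eqType) (f : I -> J) (a : I -> C) (r : J -> C) l :
  has_sum a l ->
  (forall j, has_sum (fun i => if f i == j then a i else 0) (r j)) ->
  has_sum r l.
Proof.
move=> [[M HM] H] Hr.
(* One finite list approximates the sums over all the fibres above [t] at once; the tolerance is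
   shared equally among them. *)
have approx (e : R) (t : seq J) (s1 : seq I) : 0 < e -> uniq t ->
    exists2 s, uniq s & {subset s1 <= s} /\ \sum_(j <- t)
      cabs (\sum_(i <- s) (if f i == j then a i else 0) - r j) <= e.
  move=> e0 ut.
  have [s us [hs1 Hs]] : exists2 s, uniq s & {subset s1 <= s} /\
      forall j, j \in t ->
      cabs (\sum_(i <- s) (if f i == j then a i else 0) - r j)
        < e / (size t).+1%:R.
    have : forall t' : seq J, exists2 s0, uniq s0 & forall s, uniq s ->
        {subset s0 <= s} -> forall j, j \in t' ->
        cabs (\sum_(i <- s) (if f i == j then a i else 0) - r j)
          < e / (size t).+1%:R.
      elim=> [|j t' [s0 us0 IH]]; first by exists [::].
      have [_ /(_ (e / (size t).+1%:R))] := Hr j.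
      rewrite divr_gt0// => /(_ isT) [s2 us2 Hj].
      have [s us [h0 h2]] := uniq_join s0 s2.
      exists s => // s' us' ss' j'; rewrite inE => /orP[/eqP->|jt'].
        by apply: Hj => // x /h2 /ss'.
      by apply: IH => // x /h0 /ss'.
    move=> /(_ t) [s0 us0 Hs0].
    have [s us [h0 h1]] := uniq_join s0 s1.
    by exists s => //; split => //; exact: Hs0.
  exists s => //; split => //.
  apply: (@le_trans _ _ (\sum_(j <- t) e / (size t).+1%:R)).
    by rewrite big_seq [leRHS]big_seq; apply: ler_sum => j jt; apply: ltW; exact: Hs.
  rewrite big_const_seq count_predT iter_addr_0 -mulrnAr -[_ *+ _]mulr_natr.
  rewrite ler_piMr ?(ltW e0)// mulrC ler_pdivrMr// mul1r ler_nat; exact: leqnSn.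
have swap (T : nmodType) (F : I -> T) (s : seq I) (t : seq J) : uniq t ->
    \sum_(j <- t) \sum_(i <- s) (if f i == j then F i else 0) =
    \sum_(i <- s | f i \in t) F i.
  move=> ut; rewrite exchange_big /= [RHS]big_mkcond /=; apply: eq_bigr => i _.
  rewrite -big_mkcond /= -big_filter.
  have -> : [seq j <- t | f i == j] = if f i \in t then [:: f i] else [::].
    case: ifP => [fit|/negbT fit]; last first.
      apply/eqP; rewrite -(negbK (_ == _)) -has_filter; apply/hasPn => j jt.
      by apply: contra fit => /eqP->.
    apply: perm_small_eq => //; apply: uniq_perm => //; first exact: filter_uniq.
    by move=> j; rewrite mem_filter inE eq_sym; case: eqP => //= ->; rewrite fit.
  by case: ifP; rewrite ?big_seq1 ?big_nil.
split.
  exists M => t ut; apply/ler_addgt0Pr => e e0.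
  have [s us [_ Hs]] := approx e t [::] e0 ut.
  apply: (@le_trans _ _ (\sum_(j <- t) (cabs (\sum_(i <- s) (if f i == j then a i else 0)) +
     cabs (\sum_(i <- s) (if f i == j then a i else 0) - r j)))).
    apply: ler_sum => j _.
    have := cabsB (\sum_(i <- s) (if f i == j then a i else 0))
      (\sum_(i <- s) (if f i == j then a i else 0) - r j).
    by rewrite opprB addrC subrK.
  rewrite big_split /= lerD//.
  apply: (@le_trans _ _ (\sum_(j <- t) \sum_(i <- s)
    (if f i == j then cabs (a i) else 0))).
    apply: ler_sum => j _; apply: le_trans (cabs_sum _ _ _) _.
    by apply: ler_sum => i _; case: ifP; rewrite ?cabs0.
  rewrite swap//; apply: le_trans (HM s us).
  rewrite [leRHS](bigID (fun i => f i \in t)) /= lerDl.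
  by apply: sumr_ge0 => i _; exact: cabs_ge0.
move=> e e0.
have e20 : 0 < e / 2 by rewrite divr_gt0.
have [s0 us0 {}H] := H (e / 2) e20.
exists (undup (map f s0)); first exact: undup_uniq.
move=> t ut st.
have [s us [hs Hs]] := approx (e / 3) t s0 (divr_gt0 e0 (ltr0Sn _ _)) ut.
have /H : uniq [seq i <- s | f i \in t] by exact: filter_uniq.
have sub : {subset s0 <= [seq i <- s | f i \in t]}.
  by move=> i i0; rewrite mem_filter hs// st// mem_undup map_f.
move=> /(_ sub); rewrite big_filter -swap// => Hl.
apply: le_lt_trans (cabs_triangle
   (\sum_(j <- t) \sum_(i <- s) (if f i == j then a i else 0)) _ _) _.
rewrite cabsC -sumrB.
have := le_trans (cabs_sum t xpredT _) Hs.
lra.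
Qed.

(** A finite set of pairs is enclosed in the rectangle spanned by its two projections, which is
    summed row by row. *)
Lemma absum_prod (I J : eqType) (a : I * J -> C) (rho : I -> R) (M : R) :
  (forall i s, uniq s -> \sum_(j <- s) cabs (a (i, j)) <= rho i) ->
  (forall s, uniq s -> \sum_(i <- s) rho i <= M) -> absum a.
Proof.
move=> Hr HM; exists M => s us.
pose t1 := undup (map fst s); pose t2 := undup (map snd s).
have u1 : uniq t1 by exact: undup_uniq.
have u2 : uniq t2 by exact: undup_uniq.
apply: (@le_trans _ _ (\sum_(p <- [seq (i, j) | i <- t1, j <- t2]) cabs (a p))).
  apply: ler_sum_subset => // [|p ps|p]; last exact: cabs_ge0.
    by apply: allpairs_uniq => // -[? ?] [? ?].
  apply/allpairsP; exists p; rewrite !mem_undup !map_f//; split => //.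
  by case: p {ps}.
rewrite big_allpairs; apply: le_trans (HM t1 u1).
by apply: ler_sum => i _; exact: Hr.
Qed.

Lemma has_sum_fubini (I J : eqType) (a : I * J -> C) (r : I -> C) l :
  has_sum a l -> (forall i, has_sum (fun j => a (i, j)) (r i)) -> has_sum r l.
Proof.
move=> Ha Hr; apply: (has_sum_fiber (f := fst) Ha) => i.
apply/(@has_sum_inj _ _ (fun j => (i, j))); first by move=> j j' [].
  by move=> [i' j] /=; case: ifP => [/eqP-> _|]; [exists j|rewrite eqxx].
by apply: has_sum_ext (Hr i) => j /=; rewrite eqxx.
Qed.

Lemma has_sum_prod (I J : eqType) (a : I -> C) (b : J -> C) l m :
  has_sum a l -> has_sum b m ->
  has_sum (fun p : I * J => a p.1 * b p.2) (l * m).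
Proof.
move=> Ha Hb; have [[M HM] _] := Ha; have [[N HN] _] := Hb.
have /has_sum_ex[t Ht] : absum (fun p : I * J => a p.1 * b p.2).
  apply: (@absum_prod _ _ _ (fun i => cabs (a i) * N) (M * N)).
    move=> i s us /=; under eq_bigr do rewrite cabsM.
    by rewrite -mulr_sumr ler_wpM2l ?cabs_ge0 ?HN.
  move=> s us; rewrite -mulr_suml ler_wpM2r ?HM//.
  by have := HN [::] isT; rewrite big_nil.
suff : has_sum (fun i => a i * m) t.
  have := has_sumZ m Ha; rewrite mulrC => /(has_sum_ext (fun i => mulrC m (a i))).
  by move=> /has_sum_unique h /h ->.
by apply: (has_sum_fubini Ht) => i; have := has_sumZ (a i) Hb.
Qed.

Lemma has_sum_series (a : nat -> C) l : has_sum a l -> series a @ \oo --> l.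
Proof.
move=> [_ H]; apply/cvgCP => e e0; have [s0 us0 {}H] := H e e0.
exists (\max_(i <- s0) i).+1 => n Nn; rewrite /series /= H ?iota_uniq//.
move=> i is0; rewrite mem_index_iota /=; apply: leq_trans Nn.
by rewrite ltnS; apply: (leq_bigmax_seq (F := id)).
Qed.

Lemma has_sum_csum (a : nat -> C) l : has_sum a l -> csum a = l.
Proof. by move=> /has_sum_series /limnC. Qed.

Lemma has_sum_int (a : int -> C) lp ln :
  has_sum (a \o Posz) lp -> has_sum (a \o Negz) ln -> has_sum a (lp + ln).
Proof.
move=> Hp Hn.
pose ap n := if n is Posz _ then a n else 0.
pose an n := if n is Negz _ then a n else 0.
have Hp' : has_sum ap lp.
  apply/(has_sum_inj (h := Posz)); [by move=> m n []| |exact: Hp].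
  by move=> [n _|n]; [exists n|rewrite eqxx].
have Hn' : has_sum an ln.
  apply/(has_sum_inj (h := Negz)); [by move=> m n []| |exact: Hn].
  by move=> [n|n _]; [rewrite eqxx|exists n].
by apply: has_sum_ext (has_sumD Hp' Hn') => -[n|n]; rewrite /= ?addr0 ?add0r.
Qed.

Lemma has_sum_zsum (a : int -> C) l : has_sum a l -> zsum a = l.
Proof.
move=> H; have A := has_sum_absum H.
have iP : injective Posz by move=> m n [].
have iN : injective Negz by move=> m n [].
have [lp Hp] := has_sum_ex (absum_inj iP A).
have [ln Hn] := has_sum_ex (absum_inj iN A).
rewrite /zsum (has_sum_csum Hp) (has_sum_csum Hn).
exact: has_sum_unique (has_sum_int Hp Hn) H.
Qed.

Lemma zsum_has_sum (a : int -> C) : absum a -> has_sum a (zsum a).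
Proof. by move=> /has_sum_ex[l H]; rewrite (has_sum_zsum H). Qed.

Lemma csum_has_sum (a : nat -> C) : absum a -> has_sum a (csum a).
Proof. by move=> /has_sum_ex[l H]; rewrite (has_sum_csum H). Qed.

End Summation.

(** * Complex derivatives and the exponential *)

Section ComplexDerivative.
Variable R : realType.
Local Notation C := R[i].
Implicit Types (f g : C -> C) (z w : C).

Definition ccont f z := forall e : R, 0 < e ->
  exists2 d : R, 0 < d & forall w, cabs (w - z) < d -> cabs (f w - f z) < e.

(* Caratheodory's form of differentiability. *)
Definition cderiv f z (d : C) := exists phi : C -> C,
  [/\ forall w, f w = f z + phi w * (w - z), ccont phi z & phi z = d].

Lemma ccont_cst (c : C) z : ccont (fun _ => c) z.
Proof. by move=> e e0; exists 1 => // w _; rewrite subrr cabs0. Qed.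

Lemma ccont_id z : ccont (fun w => w) z.
Proof. by move=> e e0; exists e. Qed.

Lemma ccont_ext f g z : (forall w, f w = g w) -> ccont f z -> ccont g z.
Proof. by move=> /funext->. Qed.

Lemma ccontD f g z : ccont f z -> ccont g z -> ccont (fun w => f w + g w) z.
Proof.
move=> F G e e0.
have e2 : 0 < e / 2 by rewrite divr_gt0.
have [d d0 {}F] := F _ e2; have [d' d'0 {}G] := G _ e2.
exists (Num.min d d'); first by rewrite lt_min d0.
move=> w; rewrite lt_min => /andP[/F ? /G ?].
rewrite opprD addrACA; apply: le_lt_trans (cabsD _ _) _; lra.
Qed.

Lemma ccontM f g z : ccont f z -> ccont g z -> ccont (fun w => f w * g w) z.
Proof.
move=> F G e e0.
pose K := cabs (f z) + cabs (g z) + 1.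
have K1 : 1 <= K by rewrite lerDr addr_ge0 ?cabs_ge0.
have K0 : 0 < K by lra.
have eK : 0 < Num.min 1 (e / (2 * K)).
  by rewrite lt_min ltr01 divr_gt0// mulr_gt0.
have [d d0 {}F] := F _ eK; have [d' d'0 {}G] := G _ eK.
exists (Num.min d d'); first by rewrite lt_min d0.
move=> w; rewrite lt_min => /andP[/F + /G].
rewrite !lt_min => /andP[F1 F2] /andP[G1 G2].
have -> : f w * g w - f z * g z =
  (f w - f z) * (g w - g z) + (f z * (g w - g z) + g z * (f w - f z)) by ring.
apply: le_lt_trans (cabsD _ _) _; rewrite cabsM.
apply: (@le_lt_trans _ _ (cabs (f w - f z) * cabs (g w - g z) +
  (cabs (f z) * cabs (g w - g z) + cabs (g z) * cabs (f w - f z)))).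
  by rewrite lerD2l -!cabsM; exact: cabsD.
move: F2 G2; rewrite !ltr_pdivlMr ?mulr_gt0//.
have := cabs_ge0 (f w - f z); have := cabs_ge0 (g w - g z).
have := cabs_ge0 (f z); have := cabs_ge0 (g z).
move: (cabs (f w - f z)) (cabs (g w - g z)) F1 G1 => a b F1 G1.
rewrite /K; move: (cabs (f z)) (cabs (g z)) => p q; nra.
Qed.

Lemma ccont_comp f g z : ccont f z -> ccont g (f z) -> ccont (fun w => g (f w)) z.
Proof.
move=> F G e e0; have [d d0 {}G] := G _ e0; have [d' d'0 {}F] := F _ d0.
by exists d' => // w /F /G.
Qed.

Lemma ccont_inv z : z != 0 -> ccont (fun w => w^-1) z.
Proof.
move=> z0 e e0; have a0 : 0 < cabs z by rewrite cabs_gt0.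
exists (Num.min (cabs z / 2) (e * cabs z ^+ 2 / 2)).
  by rewrite lt_min !divr_gt0// mulr_gt0// exprn_gt0.
move=> w; rewrite lt_min => /andP[H1 H2].
have H3 : cabs z / 2 < cabs w.
  by have := cabs_triangle 0 z w; rewrite subr0 sub0r cabsN;
     have := cabsD (z - w) w; rewrite subrK cabsC; lra.
have w0 : w != 0 by rewrite -cabs_gt0; lra.
have -> : w^-1 - z^-1 = - (w - z) / (w * z) by field; rewrite z0 w0.
rewrite cabsM cabsV cabsN cabsM ltr_pdivrMr; last by rewrite mulr_gt0//; lra.
apply: lt_le_trans H2 _; rewrite expr2 -!mulrA ler_wpM2l ?(ltW e0)//.
rewrite [leRHS]mulrC ler_wpM2l ?cabs_ge0//; lra.
Qed.

Lemma cderiv_eq f z d d' : cderiv f z d -> d = d' -> cderiv f z d'.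
Proof. by move=> + <-. Qed.

Lemma cderiv_cont f z d : cderiv f z d -> ccont f z.
Proof.
move=> [phi [E P _]]; apply: ccont_ext (fun w => esym (E w)) _.
apply: ccontD (ccont_cst _ _) (ccontM P _).
exact: ccontD (ccont_id z) (ccont_cst _ _).
Qed.

Lemma cderiv_cst (c : C) z : cderiv (fun _ => c) z 0.
Proof.
exists (fun _ => 0); split => //; last exact: ccont_cst.
by move=> w; rewrite mul0r addr0.
Qed.

Lemma cderiv_id z : cderiv (fun w => w) z 1.
Proof.
exists (fun _ => 1); split => //; last exact: ccont_cst.
by move=> w; rewrite mul1r addrC subrK.
Qed.

Lemma cderivD f g z a b : cderiv f z a -> cderiv g z b ->
  cderiv (fun w => f w + g w) z (a + b).
Proof.
move=> [p [E P <-]] [q [F Q <-]]; exists (fun w => p w + q w).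
split => //; last exact: ccontD.
by move=> w; rewrite {1}E {1}F; ring.
Qed.

Lemma cderivM f g z a b : cderiv f z a -> cderiv g z b ->
  cderiv (fun w => f w * g w) z (a * g z + f z * b).
Proof.
move=> fa gb; have cg := cderiv_cont gb.
move: fa gb => [p [E P <-]] [q [F Q <-]].
exists (fun w => p w * g w + f z * q w); split => //.
  by move=> w; have := E w; have := F w; move: (f w) (g w) => _ _ -> ->; ring.
apply: ccontD; first exact: ccontM.
by apply: ccontM => //; exact: ccont_cst.
Qed.

Lemma cderivZ f z (c a : C) : cderiv f z a -> cderiv (fun w => c * f w) z (c * a).
Proof.
by move=> /(cderivM (cderiv_cst c z)) /cderiv_eq; apply; rewrite mul0r add0r.
Qed.

Lemma cderivN f z a : cderiv f z a -> cderiv (fun w => - f w) z (- a).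
Proof.
move=> /(cderivZ (-1)); rewrite mulN1r.
by rewrite (_ : (fun w => -1 * f w) = (fun w => - f w))//; apply/funext => w; rewrite mulN1r.
Qed.

Lemma cderiv_comp f g z a b : cderiv f z a -> cderiv g (f z) b ->
  cderiv (fun w => g (f w)) z (b * a).
Proof.
move=> fa [q [F Q <-]]; have cf := cderiv_cont fa; case: fa => p [E P <-].
exists (fun w => q (f w) * p w); split => //.
  by move=> w; rewrite {1}(F (f w)); congr (_ + _); rewrite -mulrA; congr (_ * _); rewrite {1}E addrC addKr.
apply: ccontM => //; exact: ccont_comp cf Q.
Qed.

Lemma cderivX f z a n : cderiv f z a ->
  cderiv (fun w => f w ^+ n) z (n%:R * f z ^+ n.-1 * a).
Proof.
move=> fa; elim: n => [|n IH].
  by rewrite !mul0r; exact: cderiv_cst.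
have := cderivM fa IH; rewrite (_ : (fun w => f w * f w ^+ n) = (fun w => f w ^+ n.+1)).
  move=> /cderiv_eq; apply; case: n {IH} => [|n] /=; first by rewrite !mul0r mulr0 addr0 expr0 !mul1r mulr1.
  by rewrite -[n.+2]addn1 natrD !exprS; ring.
by apply/funext => w; rewrite exprS.
Qed.

Lemma cderiv_near f g z a (r : R) : 0 < r ->
  (forall w, cabs (w - z) < r -> f w = g w) -> cderiv f z a -> cderiv g z a.
Proof.
move=> r0 fg [p [E P pz]].
have fgz : f z = g z by apply: fg; rewrite subrr cabs0.
exists (fun w => if cabs (w - z) < r then p w else (g w - g z) / (w - z)); split.
- move=> w; case: ifP => [H|/negbT H]; first by rewrite -fg// E fgz.
  rewrite divfK ?subrKC//; apply: contraNneq H => ->; by rewrite cabs0.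
- move=> e e0; have [d d0 H] := P e e0.
  exists (Num.min d r); first by rewrite lt_min d0.
  move=> w; rewrite lt_min => /andP[wd wr].
  by rewrite wr subrr cabs0 r0; exact: H.
- by rewrite subrr cabs0 r0.
Qed.

(** The quadratic remainder is the form in which termwise differentiation of a q-series delivers a
    derivative. *)
Lemma cderiv_bound f z a (K r : R) : 0 < r ->
  (forall h, cabs h < r -> cabs (f (z + h) - f z - a * h) <= K * cabs h ^+ 2) ->
  cderiv f z a.
Proof.
move=> r0 H.
exists (fun w => if w == z then a else (f w - f z) / (w - z)); split.
- move=> w; case: eqP => [->|/eqP wz]; first by rewrite subrr mulr0 addr0.
  by rewrite divfK ?subr_eq0// addrC subrK.
- move=> e e0; rewrite eqxx.
  have K0 : 0 < `|K| + 1 by rewrite ltr_wpDl.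
  exists (Num.min r (e / (`|K| + 1))); first by rewrite lt_min r0 divr_gt0.
  move=> w; rewrite lt_min => /andP[wr]; rewrite ltr_pdivlMr// => we.
  case: eqP => [_|/eqP wz]; first by rewrite subrr cabs0.
  have wz' : w - z != 0 by rewrite subr_eq0.
  have -> : (f w - f z) / (w - z) - a = (f w - f z - a * (w - z)) / (w - z).
    by field.
  rewrite cabsM cabsV ltr_pdivrMr ?cabs_gt0//.
  have := H _ wr; rewrite subrKC => /le_lt_trans; apply.
  rewrite expr2 mulrA ltr_pM2r ?cabs_gt0//; apply: le_lt_trans we.
  rewrite mulrC ler_wpM2l ?cabs_ge0//; have := ler_norm K; lra.
- by rewrite eqxx.
Qed.

Lemma cderivV f z a : f z != 0 -> cderiv f z a ->
  cderiv (fun w => (f w)^-1) z (- a / f z ^+ 2).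
Proof.
move=> f0 fa; set y := f z in f0 *.
have y0 : 0 < cabs y by rewrite cabs_gt0.
suff H : cderiv (fun w => w^-1) y (- (y ^+ 2)^-1).
  by apply: cderiv_eq (cderiv_comp fa H) _; rewrite !mulNr mulrC.
apply: (@cderiv_bound _ _ _ (2 / cabs y ^+ 3) (cabs y / 2)); first by rewrite divr_gt0.
move=> h hy.
have H3 : cabs y / 2 < cabs (y + h).
  by have := cabsB (y + h) h; rewrite addrK; lra.
have w0 : y + h != 0 by rewrite -cabs_gt0; lra.
have -> : (y + h)^-1 - y^-1 - - (y ^+ 2)^-1 * h = h ^+ 2 / (y ^+ 2 * (y + h)).
  by field; rewrite f0 w0.
rewrite cabsM cabsV cabsM !cabsX mulrC ler_wpM2r ?exprn_ge0 ?cabs_ge0//.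
have y20 : 0 < cabs y ^+ 2 by rewrite exprn_gt0.
rewrite -[X in _ <= X]invrK lef_pV2 ?posrE ?mulr_gt0 ?invr_gt0 ?divr_gt0 ?exprn_gt0//; last first.
  by apply: lt_trans H3; rewrite divr_gt0.
rewrite invf_div exprSr -mulrA ler_wpM2l ?(ltW y20)//; exact: ltW.
Qed.

(** The passage from Caratheodory derivatives to the [derivable] and [derive1] of the statement. *)
Lemma cderiv_is_derive f z a : cderiv f z a -> is_derive (z : C) (1 : C) f a.
Proof.
move=> [p [E P pz]].
have cvgp : (h^-1 *: ((f \o shift z) (h *: (1 : C)) - f z)) @[h --> (0 : C)^'] --> a.
  apply/cvgrPdist_lt => e e0.
  have er : e = (complex.Re e)%:C by rewrite RRe_real// gtr0_real.
  have [|d d0 H] := P (complex.Re e); first by rewrite -ltcR -er.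
  have d0' : (0 : C) < d%:C by rewrite ltcR.
  exists d%:C => //= h; rewrite /= sub0r normrN => hd hn0.
  rewrite E [f z + _]addrC addrK /GRing.scale /= mulr1 addrK mulrC mulfK//.
  rewrite distrC -pz -cabsE er ltcR; apply: H.
  by rewrite addrK -ltcR cabsE.
split; first by apply/cvg_ex; exists a.
by apply: (cvg_lim _ cvgp); exact: norm_hausdorff.
Qed.

Lemma cderiv_derive1 f z a : cderiv f z a -> derive1 f z = a.
Proof. by move=> /cderiv_is_derive H; rewrite derive1E; apply: derive_val. Qed.

Lemma cderiv_unique f z a b : cderiv f z a -> cderiv f z b -> a = b.
Proof. by move=> /cderiv_derive1 <- /cderiv_derive1. Qed.

(** On a line the real part is a function of a real variable, to which the mean value and extreme
    value theorems apply. *)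
Lemma cderiv_Re_line f (z v : C) (s : R) (d : C) : cderiv f (z + s%:C * v) d ->
  is_derive (s : R) (1 : R) (fun t : R => complex.Re (f (z + t%:C * v)))
    (complex.Re (v * d)).
Proof.
move=> [p [E P pz]].
have cvgp : (h^-1 *: (((fun t : R => complex.Re (f (z + t%:C * v))) \o shift s) (h *: (1 : R))
    - complex.Re (f (z + s%:C * v)))) @[h --> (0 : R)^'] --> complex.Re (v * d).
  apply/cvgrPdist_lt => e e0.
  have v1 : 0 < cabs v + 1 by rewrite ltr_wpDl ?cabs_ge0.
  have [d' d'0 H] := P (e / (cabs v + 1)) (divr_gt0 e0 v1).
  exists (d' / (cabs v + 1)); first by rewrite /= divr_gt0.
  move=> h /=; rewrite sub0r normrN ltr_pdivlMr// => hd hn0.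
  rewrite /GRing.scale /= mulr1 E.
  have -> : z + (h + s)%:C * v - (z + s%:C * v) = h%:C * v.
    by rewrite rmorphD /=; ring.
  rewrite raddfD /= [complex.Re (f _) + _]addrC addrK.
  have Re_real (x : R) (y : C) : complex.Re (x%:C * y) = x * complex.Re y.
    by case: y => a b /=; rewrite mul0r subr0.
  rewrite mulrCA Re_real mulrA mulVf// mul1r distrC -raddfB /=.
  apply: le_lt_trans (cabs_Re _) _.
  rewrite mulrC -mulrBr cabsM.
  have cv := cabs_ge0 v.
  have /H : cabs (z + (h + s)%:C * v - (z + s%:C * v)) < d'.
    have -> : z + (h + s)%:C * v - (z + s%:C * v) = h%:C * v.
      by rewrite rmorphD /=; ring.
    rewrite cabsM cabs_real; apply: le_lt_trans hd.
    by rewrite ler_wpM2l//; lra.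
  rewrite pz ltr_pdivlMr// => He; apply: le_lt_trans He.
  rewrite mulrC ler_wpM2l ?cabs_ge0//; lra.
split; first by apply/cvg_ex; exists (complex.Re (v * d)).
by apply: (cvg_lim _ cvgp); exact: norm_hausdorff.
Qed.

End ComplexDerivative.

Section ComplexExponential.
Variable R : realType.
Local Notation C := R[i].
Implicit Types z w : C.

Lemma cexpD z w : cexp (z + w) = cexp z * cexp w.
Proof.
case: z => a b; case: w => c d; rewrite /cexp /= expRD cosD sinD.
by apply/eqP; rewrite eq_complex /=; apply/andP; split; apply/eqP; ring.
Qed.

Lemma cexp0 : cexp (0 : C) = 1.
Proof. by rewrite /cexp /= expR0 cos0 sin0 mul1r. Qed.

Lemma cexp_neq0 z : cexp z != 0.
Proof.
apply/eqP => H; have := cexpD z (- z); rewrite subrr cexp0 H mul0r => /eqP.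
by rewrite oner_eq0.
Qed.

Lemma cexpMn z n : cexp (n%:R * z) = cexp z ^+ n.
Proof.
elim: n => [|n IH]; first by rewrite mul0r cexp0.
by rewrite -natr1 mulrDl mul1r cexpD IH exprSr.
Qed.

Lemma cexp_real (x : R) : cexp x%:C = (expR x)%:C.
Proof. by rewrite /cexp /= cos0 sin0 mulr1. Qed.

Lemma cabs_cexp z : cabs (cexp z) = expR (complex.Re z).
Proof.
rewrite /cexp cabsM cabs_real ger0_norm ?expR_ge0// cabs_def /=.
by rewrite cos2Dsin2 sqrtr1 mulr1.
Qed.

Lemma has_sum_real (u : nat -> R) (l : R) : absum (fun n => (u n)%:C) ->
  series u @ \oo --> l -> has_sum (fun n => (u n)%:C) l%:C.
Proof.
move=> /has_sum_ex[l' H] ul; suff -> : l%:C = l' by [].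
have /limnC <- := has_sum_series H; apply/esym/limnC/cvgCP => e e0.
move/cvgrPdist_lt: ul => /(_ e e0)[N _ HN]; exists N => n Nn.
by have := HN n Nn; rewrite /series /= -rmorph_sum /= -rmorphB /= cabs_real distrC.
Qed.

Lemma exp_term_bound (x : R) : 0 <= x ->
  forall s, uniq s -> \sum_(n <- s) cabs ((x ^+ n / n`!%:R)%:C) <= expR x.
Proof.
move=> x0 s us; pose N := (\max_(i <- s) i).+1.
apply: (@le_trans _ _ (\sum_(n <- iota 0 N) cabs ((x ^+ n / n`!%:R)%:C))).
  apply: ler_sum_subset => // [|i is_|i]; last exact: cabs_ge0.
    exact: iota_uniq.
  by rewrite mem_iota ltnS; apply: (leq_bigmax_seq (F := id)).
have -> : \sum_(n <- iota 0 N) cabs ((x ^+ n / n`!%:R)%:C) = series (exp_coeff x) N.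
  rewrite /series /= /index_iota subn0; apply: eq_bigr => n _.
  by rewrite cabs_real ger0_norm// divr_ge0// exprn_ge0.
apply: (nondecreasing_cvgn_le _ (is_cvg_series_exp_coeff x)).
apply/nondecreasing_seqP => m.
by rewrite /series /= big_nat_recr//= lerDl exp_coeff_ge0.
Qed.

Lemma absum_exp z : absum (fun n => z ^+ n / n`!%:R).
Proof.
exists (expR (cabs z)) => s us; apply: le_trans (exp_term_bound (cabs_ge0 z) us).
apply: ler_sum => n _; rewrite cabsM cabsX cabsV cabs_nat cabs_real.
by rewrite ger0_norm// divr_ge0// exprn_ge0// cabs_ge0.
Qed.

Lemma has_sum_expR (x : R) : has_sum (fun n => x%:C ^+ n / n`!%:R) (expR x)%:C.
Proof.
have E : (fun n => x%:C ^+ n / n`!%:R) = (fun n => (exp_coeff x n)%:C).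
  by apply/funext => n; rewrite /exp_coeff rmorphM rmorphXn fmorphV rmorph_nat.
rewrite E; apply: has_sum_real; first by rewrite -E; exact: absum_exp.
exact: is_cvg_series_exp_coeff.
Qed.

Lemma has_sum_cis (y : R) :
  has_sum (fun n => ('i * y%:C) ^+ n / n`!%:R) (cos y +i* sin y).
Proof.
have iX n : ('i : C) ^+ n =
    ((~~ odd n)%:R * (-1) ^+ n./2)%:C + 'i * ((odd n)%:R * (-1) ^+ n.-1./2)%:C.
  rewrite -{1}(odd_double_half n) exprD -mul2n exprM sqr_i.
  case: (boolP (odd n)) => [on|on] /=.
    have -> : n.-1./2 = n./2 by case: n on => //= n /negbTE; rewrite uphalf_half => ->.
    by rewrite mul0r mul1r add0r expr1 rmorphXn rmorphN1.
  by rewrite mul0r mulr0 addr0 expr0 !mul1r rmorphXn rmorphN1.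
have bnd (f : nat -> R) : (forall n, `|f n| <= 1) ->
    absum (fun n => (f n / n`!%:R * y ^+ n)%:C).
  move=> f1; apply: absum_le (absum_exp y%:C) => n.
  have -> : (f n / n`!%:R * y ^+ n)%:C = (f n)%:C * (y%:C ^+ n / n`!%:R).
    by rewrite !rmorphM /= fmorphV rmorph_nat rmorphXn /=; ring.
  by rewrite cabsM cabs_real ler_piMl ?cabs_ge0.
have c1 n : `|(~~ odd n)%:R * (-1) ^+ n./2 : R| <= 1.
  by rewrite normrM normrX normrN1 expr1n mulr1 ger0_norm//; case: odd.
have s1 n : `|(odd n)%:R * (-1) ^+ n.-1./2 : R| <= 1.
  by rewrite normrM normrX normrN1 expr1n mulr1 ger0_norm//; case: odd.
have Hc : has_sum (fun n => (cos_coeff y n)%:C) (cos y)%:C.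
  apply: has_sum_real; last by rewrite cos.unlock; exact: is_cvg_series_cos_coeff.
  by rewrite cos_coeffE; exact: bnd.
have Hs : has_sum (fun n => (sin_coeff y n)%:C) (sin y)%:C.
  apply: has_sum_real; last by rewrite sin.unlock; exact: is_cvg_series_sin_coeff.
  by rewrite sin_coeffE; exact: bnd.
rewrite [cos y +i* sin y]complexE /=.
apply: has_sum_ext (has_sumD Hc (has_sumZ 'i Hs)) => n.
rewrite cos_coeffE sin_coeffE exprMn iX.
have cM (c : R) : (c / n`!%:R * y ^+ n)%:C = c%:C * (y%:C ^+ n / n`!%:R).
  by rewrite !rmorphM /= fmorphV rmorph_nat rmorphXn /=; ring.
by rewrite !cM; ring.
Qed.

Lemma has_sum_cauchy (a b : nat -> C) l m : has_sum a l -> has_sum b m ->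
  has_sum (fun n => \sum_(i < n.+1) a i * b (n - i)%N) (l * m).
Proof.
move=> Ha Hb.
apply: (has_sum_fiber (f := fun p : nat * nat => (p.1 + p.2)%N) (has_sum_prod Ha Hb)) => n.
pose s := [seq (i, (n - i)%N) | i <- iota 0 n.+1].
have -> : \sum_(i < n.+1) a i * b (n - i)%N =
    \sum_(p <- s) (if (p.1 + p.2 == n)%N then a p.1 * b p.2 else 0).
  rewrite big_map -(big_mkord xpredT (fun i => a i * b (n - i)%N)) /index_iota subn0.
  rewrite big_seq [RHS]big_seq; apply: eq_bigr => i; rewrite mem_iota add0n ltnS => /= le_in.
  by rewrite subnKC// eqxx.
apply: has_sum_finsupp; first by rewrite map_inj_uniq ?iota_uniq// => i j [].
move=> -[i j] /= H; case: eqP => // ijn; case/negP: H.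
apply/mapP; exists i; first by rewrite mem_iota add0n ltnS -ijn leq_addr.
by rewrite -ijn addKn.
Qed.

Lemma exp_cauchy z w n :
  \sum_(i < n.+1) z ^+ i / i`!%:R * (w ^+ (n - i) / (n - i)`!%:R)
  = (z + w) ^+ n / n`!%:R.
Proof.
rewrite addrC exprDn mulr_suml; apply: eq_bigr => i _.
have ni : (i <= n)%N by rewrite -ltnS.
have f0 k : (k`!%:R : C) != 0 by rewrite pnatr_eq0 -lt0n fact_gt0.
rewrite -(bin_fact ni) !natrM -mulr_natl; field; rewrite !f0 /=.
by rewrite pnatr_eq0 -lt0n bin_gt0 ni.
Qed.

(** The Cauchy product of the series of [exp (Re z)] and [exp (i Im z)], collapsed by the binomial
    formula [exp_cauchy]. *)
Lemma has_sum_cexp z : has_sum (fun n => z ^+ n / n`!%:R) (cexp z).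
Proof.
rewrite /cexp; have := has_sum_cauchy (has_sum_expR (complex.Re z)) (has_sum_cis (complex.Im z)).
by apply: has_sum_ext => n; rewrite exp_cauchy -complexE.
Qed.

Lemma has_sum_shift (a : nat -> C) l k : has_sum a l ->
  has_sum (fun n => a (n + k)%N) (l - \sum_(i < k) a i).
Proof.
move=> H.
have Hf : has_sum (fun n => if (n < k)%N then a n else 0) (\sum_(i < k) a i).
  rewrite -(big_mkord xpredT) /index_iota subn0.
  have -> : \sum_(i <- iota 0 k) a i = \sum_(i <- iota 0 k) (if (i < k)%N then a i else 0).
    by rewrite big_seq [RHS]big_seq; apply: eq_bigr => i; rewrite mem_iota add0n /= => ->.
  apply: has_sum_finsupp; first exact: iota_uniq.
  by move=> i; rewrite mem_iota add0n /= => /negbTE->.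
have := has_sumB H Hf => Hb.
have := has_sum_inj (h := fun n => (n + k)%N) (a := fun i => a i - (if (i < k)%N then a i else 0)).
move=> /(_ (l - \sum_(i < k) a i) (@addIn k)) [|_ /(_ Hb)].
  move=> i; case: ltnP => [_|ki _]; first by rewrite subrr eqxx.
  by exists (i - k)%N; rewrite subnK.
apply: has_sum_ext => n /=; by rewrite ltnNge leq_addl /= subr0.
Qed.

(** Since [(n + 2)!] is at least [n!], the tail from index 2 is dominated by [cabs z ^+ 2] times the
    exponential series. *)
Lemma cexp_quadratic z : cabs (cexp z - 1 - z) <= cabs z ^+ 2 * expR (cabs z).
Proof.
have := has_sum_shift 2 (has_sum_cexp z).
rewrite !big_ord_recl big_ord0 /= expr0 expr1 fact0 divr1 /= divr1 addr0 opprD addrA.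
move=> /has_sum_le; apply => s us.
apply: (@le_trans _ _ (\sum_(n <- s) cabs z ^+ 2 * cabs ((cabs z ^+ n / n`!%:R)%:C))).
  apply: ler_sum => n _; rewrite cabsM cabsX cabsV cabs_nat cabs_real.
  rewrite ger0_norm ?divr_ge0 ?exprn_ge0 ?cabs_ge0// addnC exprD -mulrA.
  rewrite !ler_wpM2l ?exprn_ge0 ?cabs_ge0// lef_pV2 ?posrE ?ltr0n ?fact_gt0//.
  by rewrite ler_nat leq_fact// leq_addl.
rewrite -mulr_sumr ler_wpM2l ?exprn_ge0 ?cabs_ge0//.
by apply: exp_term_bound us; exact: cabs_ge0.
Qed.

End ComplexExponential.

(** * Expansions in powers of q *)

Section QSeries.
Variable R : realType.
Local Notation C := R[i].
Implicit Types (tau z : C) (c d : nat -> C) (f g : C -> C).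

Lemma epiD (s t tau : C) : epi (s + t) tau = epi s tau * epi t tau.
Proof. by rewrite /epi mulrDr mulrDl cexpD. Qed.

Lemma epiDr (s tau h : C) : epi s (tau + h) = epi s tau * epi s h.
Proof. by rewrite /epi mulrDr cexpD. Qed.

Lemma epi0 tau : epi 0 tau = 1.
Proof. by rewrite /epi mulr0 mul0r cexp0. Qed.

Lemma epi_nat n tau : epi n%:R tau = epi 1 tau ^+ n.
Proof. by rewrite /epi -cexpMn; congr cexp; ring. Qed.

Lemma epi_scale (a s tau : C) : epi s (a * tau) = epi (s * a) tau.
Proof. by rewrite /epi; congr cexp; ring. Qed.

Lemma epi_neq0 (s tau : C) : epi s tau != 0.
Proof. exact: cexp_neq0. Qed.

(** The modulus of the nome [exp (pi i tau)]. *)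
Definition qabs tau : R := expR (- (pi * complex.Im tau)).

Lemma qabs_gt0 tau : 0 < qabs tau.
Proof. exact: expR_gt0. Qed.

Lemma qabs_lt1 tau : inH tau -> qabs tau < 1.
Proof. by move=> h; rewrite /qabs -expR0 ltr_expR oppr_lt0 mulr_gt0// pi_gt0. Qed.

Lemma cabs_epi_real (x : R) tau :
  cabs (epi x%:C tau) = expR (- (pi * x * complex.Im tau)).
Proof.
rewrite /epi cabs_cexp; congr expR; case: tau => a b /=; ring.
Qed.

Lemma cabs_epi1 tau : cabs (epi 1 tau) = qabs tau.
Proof. by have := cabs_epi_real 1 tau; rewrite rmorph1 mulr1. Qed.

Lemma cabs_epi_nat n tau : cabs (epi n%:R tau) = qabs tau ^+ n.
Proof. by rewrite epi_nat cabsX cabs_epi1. Qed.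

Lemma geometric_bound (r : R) (s : seq nat) : 0 <= r < 1 -> uniq s ->
  \sum_(n <- s) r ^+ n <= (1 - r)^-1.
Proof.
move=> /andP[r0 r1] us; pose N := (\max_(i <- s) i).+1.
apply: (@le_trans _ _ (\sum_(n <- iota 0 N) r ^+ n)).
  apply: ler_sum_subset => // [|i is_|i]; last exact: exprn_ge0.
    exact: iota_uniq.
  by rewrite mem_iota ltnS; apply: (leq_bigmax_seq (F := id)).
have : \sum_(n <- iota 0 N) r ^+ n = (1 - r ^+ N) / (1 - r).
  apply: (@mulIf _ (1 - r)); first by rewrite gt_eqF// subr_gt0.
  rewrite divfK; last by rewrite gt_eqF// subr_gt0.
  have -> : iota 0 N = index_iota 0 N by rewrite /index_iota subn0.
  elim: N => [|n IH]; first by rewrite big_geq// mul0r expr0 subrr.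
  by rewrite big_nat_recr//= mulrDl IH exprS; ring.
move=> ->; rewrite ler_pdivrMr ?subr_gt0// mulVf ?gt_eqF ?subr_gt0//.
by rewrite gerBl exprn_ge0.
Qed.

(** Radius of convergence at least 1. Bounded terms at every radius are easier to carry through
    products and through multiplication by [n] than summability, and imply it by comparison with a
    slightly larger radius. *)
Definition subexp c := forall r : R, 0 < r < 1 ->
  exists M : R, forall n, cabs (c n) * r ^+ n <= M.

Lemma between1 (r : R) : 0 <= r < 1 -> exists2 t : R, r < t & 0 < t < 1.
Proof. by move=> ?; exists ((1 + r) / 2); lra. Qed.

Lemma subexp_sum c (r : R) : subexp c -> 0 <= r < 1 ->
  exists M : R, forall s, uniq s -> \sum_(n <- s) cabs (c n) * r ^+ n <= M.
Proof.
move=> C r01; have [t rt t01] := between1 r01.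
have [M HM] := C t t01.
have t0 : 0 < t by case/andP: t01.
have M0 : 0 <= M by apply: le_trans (HM 0%N); rewrite mulr1 cabs_ge0.
have rt01 : 0 <= r / t < 1.
  by rewrite ltr_pdivrMr// mul1r rt andbT divr_ge0//; [case/andP: r01|exact: ltW].
exists (M * (1 - r / t)^-1) => s us.
apply: le_trans (ler_wpM2l M0 (geometric_bound rt01 us)).
rewrite mulr_sumr; apply: ler_sum => n _.
have -> : r ^+ n = t ^+ n * (r / t) ^+ n.
  by rewrite -exprMn mulrC divfK// gt_eqF.
by rewrite mulrA ler_wpM2r ?exprn_ge0//; case/andP: rt01.
Qed.

Lemma subexp_absum c tau : subexp c -> inH tau ->
  absum (fun n => c n * epi n%:R tau).
Proof.
move=> C h; have [|M HM] := @subexp_sum c (qabs tau) C.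
  by rewrite (ltW (qabs_gt0 _)) qabs_lt1.
exists M => s us; apply: le_trans (HM s us).
by apply: ler_sum => n _; rewrite cabsM cabs_epi_nat.
Qed.

(** The [n] powers [1, r, ..., r^(n-1)] are all at least [r^n]. *)
Lemma mulrn_exp_bound (r : R) n : 0 <= r < 1 -> n%:R * r ^+ n <= (1 - r)^-1.
Proof.
move=> r01; apply: le_trans (geometric_bound r01 (iota_uniq 0 n)).
have -> : n%:R * r ^+ n = \sum_(i <- iota 0 n) r ^+ n.
  by rewrite big_const_seq count_predT size_iota iter_addr_0 mulr_natl.
rewrite big_seq [leRHS]big_seq; apply: ler_sum => i; rewrite mem_iota /= => h.
by case/andP: r01 => r0 r1; rewrite ler_wiXn2l ?(ltW r1)// ltnW.
Qed.

Lemma subexpMn c : subexp c -> subexp (fun n => n%:R * c n).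
Proof.
move=> C r r01; have /andP[r0 r1] := r01.
have [|t rt /andP[t0 t1]] := @between1 r; first by rewrite (ltW r0).
have [|M HM] := C t; first by rewrite t0.
have M0 : 0 <= M by apply: le_trans (HM 0%N); rewrite mulr1 cabs_ge0.
exists (M * (1 - r / t)^-1) => n.
have rt01 : 0 <= r / t < 1.
  by rewrite ltr_pdivrMr// mul1r rt andbT divr_ge0//; exact: ltW.
have -> : cabs (n%:R * c n) * r ^+ n = cabs (c n) * t ^+ n * (n%:R * (r / t) ^+ n).
  rewrite cabsM cabs_nat expr_div_n; field.
  by rewrite expf_eq0 (gt_eqF t0) andbF.
apply: ler_pM; rewrite ?mulr_ge0 ?cabs_ge0 ?exprn_ge0 ?(ltW t0)//.
- by case/andP: rt01.
- exact: mulrn_exp_bound.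
Qed.

Lemma subexp_le c d (K : R) : (forall n, cabs (c n) <= K * cabs (d n)) ->
  subexp d -> subexp c.
Proof.
move=> H D r r01; have [M HM] := D r r01; have /andP[r0 r1] := r01.
exists (`|K| * M) => n; apply: (@le_trans _ _ (`|K| * (cabs (d n) * r ^+ n))).
  rewrite mulrA ler_wpM2r ?exprn_ge0 ?(ltW r0)//.
  by apply: le_trans (H n) _; rewrite ler_wpM2r ?cabs_ge0// ler_norm.
by rewrite ler_wpM2l.
Qed.

Lemma subexp_nat : subexp (fun n => n%:R).
Proof.
move=> r /andP[r0 r1]; exists (1 - r)^-1 => n; rewrite cabs_nat.
by apply: mulrn_exp_bound; rewrite (ltW r0).
Qed.

Lemma subexp1 : subexp (fun _ => 1).
Proof.
move=> r /andP[r0 r1]; exists 1 => n; rewrite cabs1 mul1r.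
by rewrite exprn_ile1// ltW.
Qed.

Lemma subexpD c d : subexp c -> subexp d -> subexp (fun n => c n + d n).
Proof.
move=> A B r r01; have [M HM] := A r r01; have [N HN] := B r r01.
exists (M + N) => n; apply: le_trans (lerD (HM n) (HN n)).
rewrite -mulrDl ler_wpM2r ?cabsD// exprn_ge0//.
by case/andP: r01 => /ltW.
Qed.

Lemma subexpZ c (a : C) : subexp c -> subexp (fun n => a * c n).
Proof. by apply: (@subexp_le _ _ (cabs a)) => n; rewrite cabsM. Qed.

Lemma subexp_cauchy c d : subexp c -> subexp d ->
  subexp (fun n => \sum_(i < n.+1) c i * d (n - i)%N).
Proof.
move=> A B r r01; have /andP[r0 r1] := r01.
have [|M HM] := @subexp_sum c r A; first by rewrite (ltW r0).
have [N HN] := B r r01.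
have N0 : 0 <= N by apply: le_trans (HN 0%N); rewrite mulr1 cabs_ge0.
exists (M * N) => n.
apply: (@le_trans _ _ (\sum_(i < n.+1) (cabs (c i) * r ^+ i) * N)); last first.
  rewrite -mulr_suml ler_wpM2r//.
  rewrite -(big_mkord xpredT (fun i => cabs (c i) * r ^+ i)).
  by apply: HM; exact: iota_uniq.
apply: (@le_trans _ _ ((\sum_(i < n.+1) cabs (c i * d (n - i)%N)) * r ^+ n)).
  by rewrite ler_wpM2r ?exprn_ge0 ?(ltW r0)// cabs_sum.
rewrite mulr_suml; apply: ler_sum => i _.
have ni : (i <= n)%N by rewrite -ltnS.
have -> : r ^+ n = r ^+ i * r ^+ (n - i) by rewrite -exprD subnKC.
rewrite cabsM mulrACA ler_wpM2l ?HN//.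
by rewrite mulr_ge0 ?cabs_ge0 ?exprn_ge0 ?(ltW r0).
Qed.

Definition qexp f c := subexp c /\ forall tau, inH tau ->
  has_sum (fun n => c n * epi n%:R tau) (f tau).

Definition qsum c tau : C := csum (fun n => c n * epi n%:R tau).

Lemma qexp_qsum c : subexp c -> qexp (qsum c) c.
Proof. by move=> C; split => // tau h; apply/csum_has_sum/subexp_absum. Qed.

Lemma qexp_qsumE f c tau : qexp f c -> inH tau -> f tau = qsum c tau.
Proof. by move=> [_ H] /H /has_sum_csum. Qed.

Lemma qexp_eq f g c : (forall tau, inH tau -> f tau = g tau) -> qexp f c -> qexp g c.
Proof. by move=> fg [C H]; split => // tau h; rewrite -fg//; exact: H. Qed.

Lemma qexp_is_expansion f c : qexp f c -> is_expansion f c.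
Proof. by move=> [_ H] tau h; apply: has_sum_series; exact: H. Qed.

(** Every radius in ]0, 1[ is the modulus of the nome at a point of the imaginary axis, and
    convergence there bounds the terms. The ordered convergence of [is_expansion] is thereby
    upgraded to absolute summability. *)
Lemma is_expansion_qexp f c : is_expansion f c -> qexp f c.
Proof.
move=> E; have C : subexp c.
  move=> r /andP[r0 r1].
  pose y : R := - ln r / pi.
  have y0 : 0 < y by rewrite divr_gt0 ?pi_gt0// oppr_gt0 ln_lt0// r0.
  have qr : qabs (0 +i* y) = r.
    by rewrite /qabs /= /y mulrC divfK ?gt_eqF ?pi_gt0// opprK lnK.
  have /(E (0 +i* y)) H : inH (0 +i* y : C) by [].
  have /cvgCP/(_ 1 ltr01)[N HN] := H.
  set u := series _ in HN.
  (* Two consecutive partial sums lie within 1 of the limit, so their difference, a single term, is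
     at most 2. *)
  have big n : (N <= n)%N -> cabs (c n) * r ^+ n <= 2.
    move=> Nn; have := HN n Nn; have := HN n.+1 (leqW Nn).
    have -> : cabs (c n) * r ^+ n = cabs (u n.+1 - u n).
      by rewrite /u /series /= big_nat_recr//= [_ + c n * _]addrC addrK cabsM cabs_epi_nat qr.
    have := cabs_triangle (f (0 +i* y)) (u n.+1) (u n).
    rewrite (cabsC (f _) (u n)); lra.
  exists (2 + \sum_(i < N) cabs (c i) * r ^+ i) => n.
  have P0 : forall i, 0 <= cabs (c i) * r ^+ i.
    by move=> i; rewrite mulr_ge0 ?cabs_ge0 ?exprn_ge0 ?(ltW r0).
  case: (ltnP n N) => [nN|/big H2]; last by rewrite ler_wpDr// sumr_ge0.
  rewrite ler_wpDl// (bigD1 (Ordinal nN)) //= lerDl sumr_ge0//.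
split => // tau h; suff -> : f tau = qsum c tau by case: (qexp_qsum C) => _; exact.
have /limnC <- := E tau h; rewrite /qsum /csum //.
Qed.

Lemma qexp_cst (a : C) : qexp (fun _ => a) (fun n => if n == 0%N then a else 0).
Proof.
split.
  apply: (@subexp_le _ (fun _ => 1) (cabs a)) subexp1 => n.
  by rewrite cabs1 mulr1; case: ifP => // _; rewrite cabs0 cabs_ge0.
move=> tau h; have := @has_sum_finsupp _ _ (fun n => (if n == 0%N then a else 0) * epi n%:R tau) [:: 0%N] isT.
rewrite big_seq1 /= epi0 mulr1; apply => n; rewrite inE => /negbTE->.
by rewrite mul0r.
Qed.

Lemma qexpD f g c d : qexp f c -> qexp g d ->
  qexp (fun t => f t + g t) (fun n => c n + d n).
Proof.
move=> [C F] [D G]; split; first exact: subexpD.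
move=> tau h; apply: has_sum_ext (has_sumD (F _ h) (G _ h)) => n.
by rewrite mulrDl.
Qed.

Lemma qexpZ (a : C) f c : qexp f c -> qexp (fun t => a * f t) (fun n => a * c n).
Proof.
move=> [C F]; split; first exact: subexpZ.
by move=> tau h; apply: has_sum_ext (has_sumZ a (F _ h)) => n; rewrite mulrA.
Qed.

Lemma qexpM f g c d : qexp f c -> qexp g d ->
  qexp (fun t => f t * g t) (fun n => \sum_(i < n.+1) c i * d (n - i)%N).
Proof.
move=> [C F] [D G]; split; first exact: subexp_cauchy.
move=> tau h; apply: has_sum_ext (has_sum_cauchy (F _ h) (G _ h)) => n.
rewrite mulr_suml; apply: eq_bigr => i _.
have ni : (i <= n)%N by rewrite -ltnS.
have -> : epi n%:R tau = epi i%:R tau * epi (n - i)%:R tau by rewrite -epiD -natrD subnKC.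
by ring.
Qed.

Lemma qexpX f c n : qexp f c -> exists d, qexp (fun t => f t ^+ n) d.
Proof.
move=> F; elim: n => [|n [d IH]]; first by eexists; exact: (qexp_cst 1).
eexists; apply: qexp_eq (qexpM F IH) => tau _; by rewrite exprS.
Qed.

Lemma qexp_sum (I : Type) (s : seq I) (F : I -> C -> C) :
  (forall i, exists c, qexp (F i) c) ->
  exists c, qexp (fun t => \sum_(i <- s) F i t) c.
Proof.
move=> H; elim: s => [|i s [d IH]].
  by eexists; apply: qexp_eq (qexp_cst 0) => tau _; rewrite big_nil.
have [c Hc] := H i.
by eexists; apply: qexp_eq (qexpD Hc IH) => tau _; rewrite big_cons.
Qed.

Lemma cabsi : cabs ('i : C) = 1.
Proof. by rewrite cabs_def /= expr0n expr1n add0r sqrtr1. Qed.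

(** The remainder of the term of index [n] carries [n^2] and a factor [exp (n pi |w|)]. For [|w|]
    below half the height of [tau] this factor uses up at most half of the decay of the nome, and
    the bound is the convergent series at half the height, with coefficients [n^2 c_n]. *)
Lemma qsum_deriv c tau : subexp c -> inH tau ->
  cderiv (qsum c) tau (pi%:C * 'i * qsum (fun n => n%:R * c n) tau).
Proof.
move=> C h.
pose y := complex.Im tau.
pose r : R := expR (- (pi * (y / 2))).
have pi0 : 0 < pi :> R := pi_gt0 R.
have r01 : 0 <= r < 1.
  by rewrite expR_ge0 -expR0 ltr_expR oppr_lt0 mulr_gt0// divr_gt0.
have [M HM] := subexp_sum (subexpMn (subexpMn C)) r01.
apply: (@cderiv_bound _ _ _ _ (pi ^+ 2 * M) (y / 2)); first by rewrite divr_gt0.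
move=> w hw.
have hw' : inH (tau + w).
  have : `|complex.Im w| < y / 2 by apply: le_lt_trans (cabs_Im w) hw.
  rewrite ltr_norml => /andP[w1 _].
  rewrite /inH raddfD /= -/y.
  have y0 : 0 < y by []. lra.
have [_ /(_ _ h) F] := qexp_qsum C.
have [_ /(_ _ hw') G] := qexp_qsum C.
have [_ /(_ _ h) F'] := qexp_qsum (subexpMn C).
have H := has_sumB (has_sumB G F) (has_sumZ (pi%:C * 'i * w) F').
have -> : qsum c (tau + w) - qsum c tau - pi%:C * 'i * qsum (fun n => n%:R * c n) tau * w
  = qsum c (tau + w) - qsum c tau - pi%:C * 'i * w * qsum (fun n => n%:R * c n) tau.
  by ring.
apply: (has_sum_le H) => s us.
have -> : pi ^+ 2 * M * cabs w ^+ 2 = (pi * cabs w) ^+ 2 * M by ring.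
apply: le_trans (ler_wpM2l (sqr_ge0 _) (HM s us)).
rewrite mulr_sumr; apply: ler_sum => n _.
pose v := pi%:C * 'i * n%:R * w.
have -> : c n * epi n%:R (tau + w) - c n * epi n%:R tau -
   pi%:C * 'i * w * (n%:R * c n * epi n%:R tau) =
   c n * epi n%:R tau * (cexp v - 1 - v).
  by rewrite epiDr /v /epi; ring.
have cv : cabs v = n%:R * (pi * cabs w).
  rewrite /v !cabsM cabs_real ger0_norm ?(ltW pi0)// cabs_nat.
  rewrite cabsi.
  by ring.
rewrite cabsM; apply: le_trans (ler_wpM2l (cabs_ge0 _) (cexp_quadratic v)) _.
rewrite [cabs (c n * _)]cabsM [cabs (_ * (_ * c n))]cabsM [cabs (_ * c n)]cabsM.
have -> : cabs (c n) * cabs (epi n%:R tau) * (cabs v ^+ 2 * expR (cabs v)) =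
  (n%:R * pi * cabs w) ^+ 2 * cabs (c n) * (cabs (epi n%:R tau) * expR (cabs v)).
  by rewrite cv; ring.
rewrite !cabs_nat.
have -> : (pi * cabs w) ^+ 2 * (n%:R * (n%:R * cabs (c n)) * r ^+ n) =
  (n%:R * pi * cabs w) ^+ 2 * cabs (c n) * r ^+ n by ring.
apply: ler_wpM2l; first by rewrite mulr_ge0 ?sqr_ge0 ?cabs_ge0.
rewrite cabs_epi_nat /qabs -expRM_natl -expRD /r -expRM_natl ler_expR cv.
rewrite -/y.
have -> : n%:R * - (pi * y) + n%:R * (pi * cabs w) = - (n%:R * pi) * (y - cabs w) by ring.
have -> : n%:R * - (pi * (y / 2)) = - (n%:R * pi) * (y / 2) by ring.
rewrite ler_wnM2l//; first by rewrite oppr_le0 mulr_ge0 ?(ltW pi0).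
by lra.
Qed.

Definition qD c := fun n : nat => n%:R * c n.

(* D = (pi i)^-1 d/dtau, acting as q d/dq on expansions *)
Definition hasD f g := forall tau, inH tau -> cderiv f tau (pi%:C * 'i * g tau).

Lemma inH_nbhs tau : inH tau -> exists2 r : R, 0 < r &
  forall w, cabs (w - tau) < r -> inH w.
Proof.
move=> h; exists (complex.Im tau) => // w hw.
have := le_lt_trans (cabs_Im _) hw; rewrite raddfB /= ltr_norml => /andP[+ _].
by rewrite /inH; lra.
Qed.

Lemma cderiv_eqH f g tau a : inH tau -> (forall t, inH t -> f t = g t) ->
  cderiv f tau a -> cderiv g tau a.
Proof.
move=> h fg; have [r r0 H] := inH_nbhs h; apply: (cderiv_near r0) => w /H.
exact: fg.
Qed.

Lemma qexp_hasD f c : qexp f c -> hasD f (qsum (qD c)).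
Proof.
move=> F tau h; have [C _] := F.
apply: cderiv_eqH h _ (qsum_deriv C h) => t ht.
by rewrite (qexp_qsumE F).
Qed.

Lemma hasD_eq f f' g g' : (forall t, inH t -> f t = f' t) ->
  (forall t, inH t -> g t = g' t) -> hasD f g -> hasD f' g'.
Proof.
by move=> E E' H tau h; rewrite -E'//; apply: cderiv_eqH h E (H _ h).
Qed.

Lemma pii_neq0 : (pi%:C * 'i : C) != 0.
Proof.
rewrite -cabs_gt0 cabsM cabsi mulr1 cabs_real normr_gt0.
by rewrite gt_eqF// pi_gt0.
Qed.

Lemma hasD_unique f f' g g' : (forall t, inH t -> f t = f' t) ->
  hasD f g -> hasD f' g' -> forall tau, inH tau -> g tau = g' tau.
Proof.
move=> E A B tau h; apply: (mulfI pii_neq0).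
exact: cderiv_unique (cderiv_eqH h E (A _ h)) (B _ h).
Qed.

Lemma hasD_cst a : hasD (fun _ => a) (fun _ => 0).
Proof. by move=> tau h; apply: cderiv_eq (cderiv_cst _ _) _; rewrite mulr0. Qed.

Lemma hasDD f g f' g' : hasD f f' -> hasD g g' ->
  hasD (fun t => f t + g t) (fun t => f' t + g' t).
Proof.
move=> F G tau h; apply: cderiv_eq (cderivD (F _ h) (G _ h)) _; ring.
Qed.

Lemma hasDZ a f f' : hasD f f' -> hasD (fun t => a * f t) (fun t => a * f' t).
Proof. by move=> F tau h; apply: cderiv_eq (cderivZ a (F _ h)) _; ring. Qed.

Lemma hasDM f g f' g' : hasD f f' -> hasD g g' ->
  hasD (fun t => f t * g t) (fun t => f' t * g t + f t * g' t).
Proof.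
move=> F G tau h; apply: cderiv_eq (cderivM (F _ h) (G _ h)) _; ring.
Qed.

Lemma hasDV f f' : (forall t, inH t -> f t != 0) -> hasD f f' ->
  hasD (fun t => (f t)^-1) (fun t => - f' t / f t ^+ 2).
Proof.
move=> f0 F tau h; apply: cderiv_eq (cderivV (f0 _ h) (F _ h)) _.
by field; exact: f0.
Qed.

Lemma hasDX f f' n : hasD f f' ->
  hasD (fun t => f t ^+ n) (fun t => n%:R * f t ^+ n.-1 * f' t).
Proof. by move=> F tau h; apply: cderiv_eq (cderivX n (F _ h)) _; ring. Qed.

Lemma hasD_sum (I : Type) (s : seq I) (F F' : I -> C -> C) :
  (forall i, hasD (F i) (F' i)) ->
  hasD (fun t => \sum_(i <- s) F i t) (fun t => \sum_(i <- s) F' i t).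
Proof.
move=> H; elim: s => [|i s IH].
  by apply: hasD_eq (hasD_cst 0) => t _; rewrite big_nil.
by apply: hasD_eq (hasDD (H i) IH) => t _; rewrite big_cons.
Qed.

Lemma inH2 tau : inH tau -> inH (2 * tau).
Proof. by rewrite /inH mulr_natl raddfMn /= => h; rewrite mulrn_wgt0. Qed.

Lemma hasD2 f f' : hasD f f' -> hasD (fun t => f (2 * t)) (fun t => 2 * f' (2 * t)).
Proof.
move=> F tau h.
have := cderiv_comp (cderivZ 2 (cderiv_id tau)) (F _ (inH2 h)).
by move=> /cderiv_eq; apply; ring.
Qed.

(** After [q^k] is pulled out, the tail is dominated by its value at height 1, whence a bound
    uniform in the real part. *)
Lemma qexp_taylor f c k : qexp f c -> exists M : R, forall tau,
  1 <= complex.Im tau ->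
  cabs (f tau - \sum_(i < k) c i * epi i%:R tau) <= M * qabs tau ^+ k.
Proof.
move=> [C F].
pose r : R := expR (- pi).
have r01 : 0 < r < 1.
  by rewrite expR_gt0 -expR0 ltr_expR oppr_lt0 pi_gt0.
have Ck : subexp (fun n => c (n + k)%N).
  move=> t t01; have [M HM] := C t t01; have /andP[t0 t1] := t01.
  exists (M / t ^+ k) => n; rewrite ler_pdivlMr ?exprn_gt0// -mulrA -exprD.
  exact: HM.
have [|M HM] := @subexp_sum _ r Ck; first by case/andP: r01 => /ltW ->.
exists M => tau t1.
have h : inH tau by apply: lt_le_trans t1.
have q0 : 0 <= qabs tau := ltW (qabs_gt0 tau).
have qr : qabs tau <= r.
  by rewrite /qabs ler_expR lerN2 ler_peMr// ltW// pi_gt0.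
apply: (has_sum_le (has_sum_shift k (F _ h))) => s us.
rewrite [leRHS]mulrC; apply: le_trans (ler_wpM2l (exprn_ge0 k q0) (HM s us)).
rewrite mulr_sumr; apply: ler_sum => n _.
rewrite cabsM cabs_epi_nat exprD; move: (qabs tau) q0 qr => q q0 qr.
have -> : cabs (c (n + k)%N) * (q ^+ n * q ^+ k) = q ^+ k * (cabs (c (n + k)%N) * q ^+ n).
  by ring.
apply: ler_wpM2l; first exact: exprn_ge0.
by apply: ler_wpM2l; [exact: cabs_ge0 | apply: lerXn2r => //; rewrite nnegrE; exact: le_trans qr].
Qed.

(** Coefficients of modulus at most 1 and fibres of linearly growing size give collected
    coefficients of linear growth, in particular subexponential ones. *)
Lemma qexp_fiber (I : eqType) (b : I -> C) (s : I -> nat) (fib : nat -> seq I)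
    (F : C -> C) (K : R) :
  (forall i, cabs (b i) <= 1) -> (forall m, uniq (fib m)) ->
  (forall m i, (i \in fib m) = (s i == m)) ->
  (forall m, (size (fib m))%:R <= K * m.+1%:R) ->
  (forall tau, inH tau -> has_sum (fun i => b i * epi (s i)%:R tau) (F tau)) ->
  qexp F (fun m => \sum_(i <- fib m) b i).
Proof.
move=> b1 uf mf sf H; split.
  apply: (@subexp_le _ (fun m => m%:R + 1) K) (subexpD subexp_nat subexp1) => m.
  rewrite natr1 cabs_nat; apply: le_trans (sf m); apply: le_trans (cabs_sum _ _ _) _.
  apply: (@le_trans _ _ (\sum_(i <- fib m) 1)); first exact: ler_sum.
  by rewrite big_const_seq count_predT iter_addr_0.
move=> tau h; apply: (has_sum_fiber (f := s) (H _ h)) => m.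
have -> : (\sum_(i <- fib m) b i) * epi m%:R tau =
  \sum_(i <- fib m) (if s i == m then b i * epi (s i)%:R tau else 0).
  rewrite mulr_suml big_seq [RHS]big_seq; apply: eq_bigr => i; rewrite mf.
  by move=> /[dup] /eqP -> ->.
by apply: has_sum_finsupp => // i; rewrite mf => /negbTE->.
Qed.

End QSeries.

(** * Theta functions *)

Section ThetaDoubling.
Variable R : realType.
Local Notation C := R[i].
Implicit Types (tau : C).

Lemma absum_int (a : int -> C) :
  absum (fun n => a (Posz n)) -> absum (fun n => a (Negz n)) -> absum a.
Proof.
move=> /has_sum_ex[lp Hp] /has_sum_ex[ln Hn].
exact: has_sum_absum (has_sum_int Hp Hn).
Qed.

Lemma absum_sparse tau (a : nat -> C) (s : nat -> nat) : inH tau ->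
  (forall n, cabs (a n) <= 1) -> (forall n, n <= s n)%N ->
  absum (fun n => a n * epi (s n)%:R tau).
Proof.
move=> h a1 sn; apply: absum_le (subexp_absum (@subexp1 R) h) => n.
rewrite mul1r cabsM !cabs_epi_nat -[leRHS]mul1r.
apply: ler_pM => //; first exact: cabs_ge0.
  by rewrite exprn_ge0// ltW// qabs_gt0.
apply: ler_wiXn2l => //; first exact/ltW/qabs_gt0.
exact/ltW/qabs_lt1.
Qed.

(** The natural number [n (n + 1)]: at [Negz k], which is [- k - 1], it is again [k (k + 1)]. *)
Definition pronic (n : int) : nat :=
  match n with Posz k | Negz k => (k * k.+1)%N end.

Lemma intr_sqr (n : int) : (n%:~R : C) ^+ 2 = (`|n| ^ 2)%N%:R.
Proof. by case: n => n; rewrite ?NegzE ?mulrNz ?sqrrN ?abszN /= -natrX. Qed.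

Lemma intr_half_sqr (n : int) :
  ((n%:~R : C) + 2^-1) ^+ 2 = (pronic n)%:R + 4^-1.
Proof.
case: n => n; rewrite ?NegzE ?mulrNz -!pmulrn /= natrM -natr1; by field.
Qed.

(** [theta_half] without its factor [q^(1/4)]: the part with integral exponents, which has a
    q-expansion. *)
Definition psi tau : C := zsum (fun n => epi (pronic n)%:R tau).

Lemma cabs_sign (n : int) : cabs ((-1 : C) ^ n) = 1.
Proof.
have H k : cabs ((-1 : C) ^+ k) = 1 by rewrite cabsX cabsN cabs1 expr1n.
by case: n => n; [exact: H | rewrite NegzE -exprnN cabsV H invr1].
Qed.

Lemma absum_square tau (a : int -> C) : inH tau -> (forall n, cabs (a n) <= 1) ->
  absum (fun n => a n * epi (`|n| ^ 2)%N%:R tau).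
Proof.
move=> h a1; apply: absum_int.
  by apply: (@absum_sparse _ (fun n => a (Posz n)) (fun n => `|Posz n| ^ 2)%N) => // n /=; nia.
by apply: (@absum_sparse _ (fun n => a (Negz n)) (fun n => `|Negz n| ^ 2)%N) => // n /=; nia.
Qed.

Lemma absum_pronic tau (a : int -> C) : inH tau -> (forall n, cabs (a n) <= 1) ->
  absum (fun n => a n * epi (pronic n)%:R tau).
Proof.
move=> h a1; apply: absum_int.
  by apply: (@absum_sparse _ (fun n => a (Posz n)) (fun n => n * n.+1)%N) => // n /=; nia.
by apply: (@absum_sparse _ (fun n => a (Negz n)) (fun n => n * n.+1)%N) => // n /=; nia.
Qed.

Lemma has_sum_theta tau : inH tau ->
  has_sum (fun n : int => epi (n%:~R ^+ 2) tau) (theta tau).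
Proof.
move=> h; apply: zsum_has_sum.
apply: absum_le (@absum_square tau (fun=> 1) h _) => n; last by rewrite cabs1.
by rewrite intr_sqr mul1r.
Qed.

Lemma has_sum_theta4 tau : inH tau ->
  has_sum (fun n : int => (-1) ^ n * epi (n%:~R ^+ 2) tau) (theta4 tau).
Proof.
move=> h; apply: zsum_has_sum.
apply: absum_le (@absum_square tau (fun n => (-1) ^ n) h _) => n.
  by rewrite intr_sqr.
by rewrite cabs_sign.
Qed.

Lemma has_sum_theta_half tau : inH tau ->
  has_sum (fun n : int => epi ((n%:~R + 2^-1) ^+ 2) tau) (theta_half tau).
Proof.
move=> h; apply: zsum_has_sum.
apply: absum_le (absumZ (epi 4^-1 tau) (@absum_pronic tau (fun=> 1) h _)) => n.
  by rewrite intr_half_sqr mul1r epiD mulrC.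
by rewrite cabs1.
Qed.

Lemma has_sum_psi tau : inH tau ->
  has_sum (fun n : int => epi (pronic n)%:R tau) (psi tau).
Proof.
move=> h; apply: zsum_has_sum.
apply: absum_le (@absum_pronic tau (fun=> 1) h _) => n; last by rewrite cabs1.
by rewrite mul1r.
Qed.

Lemma theta_half_psi tau : inH tau -> theta_half tau = epi 4^-1 tau * psi tau.
Proof.
move=> h; apply: has_sum_unique (has_sum_theta_half h) _.
apply: has_sum_ext (has_sumZ _ (has_sum_psi h)) => n.
by rewrite intr_half_sqr epiD mulrC.
Qed.

(* Z^2 is split into the images of (a, b) |-> (a + b, a - b) and
   (a, b) |-> (a + b + 1, a - b), according to the parity of the sum. *)
Lemma has_sum_parity (F : int * int -> C) l l1 l2 : has_sum F l ->
  has_sum (fun p => F (p.1 + p.2, p.1 - p.2)) l1 ->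
  has_sum (fun p => F (p.1 + p.2 + 1, p.1 - p.2)) l2 -> l = l1 + l2.
Proof.
move=> H H1 H2; apply: has_sum_unique H _.
pose ev (p : int * int) := ((p.1 + p.2) %% 2)%Z == 0.
have E1 : has_sum (fun p => if ev p then F p else 0) l1.
  apply/(has_sum_inj (h := fun p : int * int => (p.1 + p.2, p.1 - p.2))).
  - by move=> [a b] [a' b'] /= [? ?]; congr (_, _); lia.
  - move=> [m n]; rewrite /ev /=; case: ifP => [e _|_]; last by rewrite eqxx.
    exists (((m + n) %/ 2)%Z, ((m - n) %/ 2)%Z) => /=.
    by congr (_, _); lia.
  - apply: has_sum_ext H1 => -[a b] /=; rewrite /ev /= ifT//; lia.
have E2 : has_sum (fun p => if ev p then 0 else F p) l2.
  apply/(has_sum_inj (h := fun p : int * int => (p.1 + p.2 + 1, p.1 - p.2))).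
  - by move=> [a b] [a' b'] /= [? ?]; congr (_, _); lia.
  - move=> [m n]; rewrite /ev /=; case: ifP => [_|e _]; first by rewrite eqxx.
    exists (((m + n) %/ 2)%Z, ((m - n) %/ 2)%Z) => /=.
    by congr (_, _); lia.
  - apply: has_sum_ext H2 => -[a b] /=; rewrite /ev /= ifF//; lia.
apply: has_sum_ext (has_sumD E1 E2) => p; by case: ifP; rewrite ?addr0 ?add0r.
Qed.

Lemma signzD (m n : int) : (-1 : C) ^ (m + n) = (-1) ^ m * (-1) ^ n.
Proof. by rewrite expfzDr// oppr_eq0 oner_eq0. Qed.

Lemma signz_sqr (n : int) : (-1 : C) ^ n * (-1) ^ n = 1.
Proof. by rewrite -expfzMl mulrNN mulr1 exp1rz. Qed.

Lemma signzN (n : int) : (-1 : C) ^ (- n) = (-1) ^ n.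
Proof.
have s0 : (-1 : C) ^ n != 0 by rewrite expfz_neq0// oppr_eq0 oner_eq0.
by apply: (mulIf s0); rewrite signz_sqr -signzD addNr expr0z.
Qed.

Lemma signz_pair (a b : int) : (-1 : C) ^ (a + b) * (-1) ^ (a - b) = 1.
Proof. by rewrite !signzD signzN mulrACA !signz_sqr mulr1. Qed.

(** The hypothesis is met through [(a + b)^2 + (a - b)^2 = 2 (a^2 + b^2)] and its half-integral
    variants, the factor 2 being absorbed by [2 tau]. *)
Lemma epi_mul2 (s t u v tau : C) : u + v = (s + t) * 2 ->
  epi s (2 * tau) * epi t (2 * tau) = epi u tau * epi v tau.
Proof.
move=> E; rewrite (epi_scale 2 s) (epi_scale 2 t) -(epiD u v) E.
by rewrite mulrDl epiD.
Qed.

Lemma epi_mul2w (k l m s t u v tau : C) : u + v = (s + t) * 2 -> k * l = m ->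
  k * epi s (2 * tau) * (l * epi t (2 * tau)) = epi u tau * (m * epi v tau).
Proof.
move=> /(@epi_mul2 s t u v tau) E <-.
move: (epi s _) (epi t _) (epi u _) (epi v _) E => es et eu ev E.
by rewrite mulrACA E; ring.
Qed.

Lemma theta_sqr tau : inH tau ->
  theta tau ^+ 2 = theta (2 * tau) ^+ 2 + theta_half (2 * tau) ^+ 2.
Proof.
move=> h; have h2 := inH2 h.
apply: has_sum_parity (has_sum_prod (has_sum_theta h) (has_sum_theta h)) _ _.
- apply: has_sum_ext (has_sum_prod (has_sum_theta h2) (has_sum_theta h2)) => -[a b] /=.
  by apply: epi_mul2; ring.
- apply: has_sum_ext (has_sum_prod (has_sum_theta_half h2) (has_sum_theta_half h2)) => -[a b] /=.
  by apply: epi_mul2; field.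
Qed.

Lemma theta4_sqr tau : inH tau ->
  theta4 tau ^+ 2 = theta (2 * tau) ^+ 2 - theta_half (2 * tau) ^+ 2.
Proof.
move=> h; have h2 := inH2 h.
apply: has_sum_parity (has_sum_prod (has_sum_theta4 h) (has_sum_theta4 h)) _ _.
- apply: has_sum_ext (has_sum_prod (has_sum_theta h2) (has_sum_theta h2)) => -[a b] /=.
  rewrite [RHS]mulrACA signz_pair mul1r.
  by apply: epi_mul2; ring.
- apply: has_sum_ext (has_sumN (has_sum_prod (has_sum_theta_half h2) (has_sum_theta_half h2))) => -[a b] /=.
  rewrite [RHS]mulrACA (signzD (a + b) 1) expr1z mulrN1 !mulNr signz_pair mul1r.
  by congr (- _); apply: epi_mul2; field.
Qed.

Lemma theta_theta4 tau : inH tau ->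
  theta tau * theta4 tau = theta4 (2 * tau) ^+ 2.
Proof.
move=> h; have h2 := inH2 h.
have A : absum (fun n : int => (-1) ^ n * epi ((n%:~R + 2^-1) ^+ 2) (2 * tau)).
  have [A _] := has_sum_theta_half h2; apply: absum_le A => n.
  by rewrite cabsM cabs_sign mul1r.
have [S HS] := has_sum_ex A.
(* The odd part vanishes: [n -> - n - 1] fixes [(n + 1/2)^2] and reverses the sign. *)
have S0 : S = 0.
  have bijh : bijective (fun n : int => - n - 1) by exists (fun n => - n - 1) => n; lia.
  have HS' := (has_sum_bij _ _ bijh).2 HS.
  have : has_sum ((fun n : int => (-1) ^ n * epi ((n%:~R + 2^-1) ^+ 2) (2 * tau)) \o (fun n : int => - n - 1)) (- S).
    apply: has_sum_ext (has_sumN HS) => n /=.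
    rewrite signzD !signzN expr1z mulrN1 mulNr.
    have -> // : ((n%:~R : C) + 2^-1) ^+ 2 = ((- n - 1)%:~R + 2^-1) ^+ 2 by field.
  move=> /(has_sum_unique HS') /eqP; rewrite -addr_eq0 -mulr2n mulrn_eq0 /=.
  by move=> /eqP.
suff -> : theta tau * theta4 tau = theta4 (2 * tau) ^+ 2 + S * S.
  by rewrite S0 mulr0 addr0.
apply: has_sum_parity (has_sum_prod (has_sum_theta h) (has_sum_theta4 h)) _ _.
- apply: has_sum_ext (has_sum_prod (has_sum_theta4 h2) (has_sum_theta4 h2)) => -[a b] /=.
  by apply: epi_mul2w; [ring | rewrite signzD signzN].
- apply: has_sum_ext (has_sum_prod HS HS) => -[a b] /=.
  by apply: epi_mul2w; [field | rewrite signzD signzN].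
Qed.

Lemma theta_half_sqr tau : inH tau ->
  theta_half tau ^+ 2 = 2 * (theta_half (2 * tau) * theta (2 * tau)).
Proof.
move=> h; have h2 := inH2 h; rewrite mulr_natl mulr2n.
apply: has_sum_parity (has_sum_prod (has_sum_theta_half h) (has_sum_theta_half h)) _ _.
- apply: has_sum_ext (has_sum_prod (has_sum_theta_half h2) (has_sum_theta h2)) => -[a b] /=.
  by apply: epi_mul2; field.
(* In the odd class the squares are [(a + 1)^2] and [(b + 1/2)^2]; the shift of [a] restores
   [theta]. *)
- have bijh : bijective (fun n : int => n + 1) by exists (fun n => n - 1) => n; lia.
  have Ht := (has_sum_bij _ _ bijh).2 (has_sum_theta h2).
  rewrite mulrC.
  apply: has_sum_ext (has_sum_prod Ht (has_sum_theta_half h2)) => -[a b] /=.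
  by apply: epi_mul2; field.
Qed.

(** With [T] and [H] for [theta] and [theta_half] at [2 tau], this is [(T^2 + H^2)^2 = (T^2 - H^2)^2
    + 4 T^2 H^2]. *)
Lemma theta_jacobi tau : inH tau ->
  theta tau ^+ 4 = theta4 tau ^+ 4 + theta_half tau ^+ 4.
Proof.
move=> h.
have sq4 (x : C) : x ^+ 4 = (x ^+ 2) ^+ 2 by rewrite -exprM.
rewrite !sq4 (theta_sqr h) (theta4_sqr h) (theta_half_sqr h).
by ring.
Qed.

Let ints (m : nat) : seq int := map Posz (iota 0 m.+1) ++ map Negz (iota 0 m.+1).

Let uniq_ints m : uniq (ints m).
Proof.
rewrite cat_uniq !map_inj_uniq ?iota_uniq//; [|by move=> ? ? []..].
by rewrite andbT; apply/hasPn => x /mapP[n _ ->]; apply/negP => /mapP[].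
Qed.

Let mem_ints m (n : int) : (match n with Posz k | Negz k => k end <= m)%N -> n \in ints m.
Proof.
rewrite mem_cat; case: n => n nm; apply/orP; [left|right];
  by apply: map_f; rewrite mem_iota add0n ltnS.
Qed.

(** Exponents at least as large as the index confine the fibre of [m] to [ints m], which has
    [2 (m + 1)] elements. *)
Lemma qexp_int (b : int -> C) (s : int -> nat) (F : C -> C) :
  (forall n, cabs (b n) <= 1) ->
  (forall n : int, match n with Posz k | Negz k => k end <= s n)%N ->
  (forall tau, inH tau -> has_sum (fun n => b n * epi (s n)%:R tau) (F tau)) ->
  qexp F (fun m => \sum_(n <- ints m | s n == m) b n).
Proof.
move=> b1 sn H.
have E : (fun m => \sum_(n <- ints m | s n == m) b n) =
    (fun m => \sum_(n <- [seq n <- ints m | s n == m]) b n).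
  by apply/funext => m; rewrite big_filter.
rewrite E; apply: (@qexp_fiber _ _ b s _ F 2) => // [m|m n|m].
- exact: filter_uniq (uniq_ints m).
- rewrite mem_filter; case: eqP => //= snm; apply: mem_ints.
  by rewrite -snm.
- rewrite size_filter; apply: (@le_trans _ _ (size (ints m))%:R).
    by rewrite ler_nat count_size.
  by rewrite size_cat !size_map size_iota -natrM ler_nat; lia.
Qed.

(** The constant and linear coefficients are the data at i oo that identify the limits of the
    doubling arguments. *)
Lemma qexp_theta : exists2 c, qexp (@theta R) c & c 0%N = 1 /\ c 1%N = 2.
Proof.
eexists.
  apply: (@qexp_int (fun=> 1) (fun n => `|n| ^ 2)%N) => [n|[n|n]|tau h] /=.
  - by rewrite cabs1.
  - by nia.
  - by nia.
  - apply: has_sum_ext (has_sum_theta h) => n; by rewrite intr_sqr mul1r.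
rewrite /ints /= !big_cons !big_nil /=; split; by rewrite ?addr0.
Qed.

Lemma qexp_theta4 : exists2 c, qexp (@theta4 R) c & c 0%N = 1 /\ c 1%N = -2.
Proof.
eexists.
  apply: (@qexp_int (fun n => (-1) ^ n) (fun n => `|n| ^ 2)%N) => [n|[n|n]|tau h] /=.
  - by rewrite cabs_sign.
  - by nia.
  - by nia.
  - apply: has_sum_ext (has_sum_theta4 h) => n; by rewrite intr_sqr.
rewrite /ints /= !big_cons !big_nil /=; split; rewrite ?addr0 ?expr0z//.
by rewrite NegzE signzN expr1z; ring.
Qed.

Lemma qexp_psi : exists2 c, qexp psi c & c 0%N = 2.
Proof.
eexists.
  apply: (@qexp_int (fun=> 1) pronic) => [n|[n|n]|tau h] /=.
  - by rewrite cabs1.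
  - by nia.
  - by nia.
  - apply: has_sum_ext (has_sum_psi h) => n; by rewrite mul1r.
by rewrite /ints /= !big_cons !big_nil /= addr0.
Qed.

End ThetaDoubling.

(** * The differential equations of x, y and p, by doubling *)

Section ThetaODE.
Variable R : realType.
Local Notation C := R[i].
Implicit Types (tau t : C) (f g : C -> C).

Definition Dop f tau : C := (pi%:C * 'i)^-1 * derive1 f tau.

Lemma hasD_Dop f g tau : hasD f g -> inH tau -> Dop f tau = g tau.
Proof.
by move=> H h; rewrite /Dop (cderiv_derive1 (H _ h)) mulKf// pii_neq0.
Qed.

Lemma hasD_Dop_hasD f g : hasD f g -> hasD f (Dop f).
Proof. by move=> H; apply: hasD_eq (H) => // t h; rewrite (hasD_Dop H). Qed.

Lemma qexp_Dop f c : qexp f c -> qexp (Dop f) (qD c) /\ hasD f (Dop f).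
Proof.
move=> F; have H := qexp_hasD F; split; last exact: hasD_Dop_hasD H.
apply: qexp_eq (qexp_qsum _) => [t h|]; first by rewrite (hasD_Dop H).
by apply: subexpMn; case: F.
Qed.

Definition limI f (l : C) := forall e : R, 0 < e ->
  exists Y : R, forall tau, Y <= complex.Im tau -> cabs (f tau - l) < e.

Lemma limI_cst (a : C) : limI (fun _ => a) a.
Proof. by move=> e e0; exists 0 => t _; rewrite subrr cabs0. Qed.

Lemma limI_eq f g l : (forall t, f t = g t) -> limI f l -> limI g l.
Proof. by move=> /funext->. Qed.

Lemma limI_eqH f g l : (forall t, inH t -> f t = g t) -> limI f l -> limI g l.
Proof.
move=> fg F e e0; have [Y H] := F e e0.
exists (Num.max Y 1) => t; rewrite ge_max => /andP[tY t1].
by rewrite -fg ?H//; exact: lt_le_trans t1.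
Qed.

Lemma limID f g l m : limI f l -> limI g m -> limI (fun t => f t + g t) (l + m).
Proof.
move=> F G e e0; have e2 : 0 < e / 2 by rewrite divr_gt0.
have [Y H] := F _ e2; have [Y' H'] := G _ e2.
exists (Num.max Y Y') => t; rewrite ge_max => /andP[/H ? /H' ?].
rewrite opprD addrACA; apply: le_lt_trans (cabsD _ _) _; lra.
Qed.

Lemma limIM f g l m : limI f l -> limI g m -> limI (fun t => f t * g t) (l * m).
Proof.
move=> F G e e0.
pose K := cabs l + cabs m + 1.
have K1 : 1 <= K by rewrite lerDr addr_ge0 ?cabs_ge0.
have eK : 0 < Num.min 1 (e / (2 * K)).
  by rewrite lt_min ltr01 divr_gt0// mulr_gt0//; lra.
have [Y {}F] := F _ eK; have [Y' {}G] := G _ eK.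
exists (Num.max Y Y') => w; rewrite ge_max => /andP[/F + /G].
rewrite !lt_min => /andP[F1 F2] /andP[G1 G2].
have -> : f w * g w - l * m =
  (f w - l) * (g w - m) + (l * (g w - m) + m * (f w - l)) by ring.
apply: le_lt_trans (cabsD _ _) _; rewrite cabsM.
apply: (@le_lt_trans _ _ (cabs (f w - l) * cabs (g w - m) +
  (cabs l * cabs (g w - m) + cabs m * cabs (f w - l)))).
  by rewrite lerD2l -!cabsM; exact: cabsD.
move: F2 G2; rewrite !ltr_pdivlMr ?mulr_gt0//; [|lra..].
have := cabs_ge0 (f w - l); have := cabs_ge0 (g w - m).
have := cabs_ge0 l; have := cabs_ge0 m.
move: (cabs (f w - l)) (cabs (g w - m)) F1 G1 => a b F1 G1.
rewrite /K; move: (cabs l) (cabs m) => p q; nra.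
Qed.

Lemma limIB f g l m : limI f l -> limI g m -> limI (fun t => f t - g t) (l - m).
Proof.
move=> F /(limIM (limI_cst (-1))) G; rewrite -mulN1r.
by apply: limI_eq (limID F G) => t; rewrite mulN1r.
Qed.

Lemma limIX f l n : limI f l -> limI (fun t => f t ^+ n) (l ^+ n).
Proof.
move=> F; elim: n => [|n IH]; first exact: limI_cst.
by rewrite exprS; apply: limI_eq (limIM F IH) => t; rewrite exprS.
Qed.

Lemma limIV f l : l != 0 -> limI f l -> limI (fun t => (f t)^-1) l^-1.
Proof.
move=> l0 F e e0; have [d d0 H] := ccont_inv l0 e0.
by have [Y {}F] := F _ d0; exists Y => t /F /H.
Qed.

Lemma limI_neq0 f l : l != 0 -> limI f l ->
  exists Y : R, forall tau, Y <= complex.Im tau -> f tau != 0.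
Proof.
rewrite -cabs_gt0 => l0 /(_ _ l0)[Y H]; exists Y => t /H.
by apply: contraTneq => ->; rewrite sub0r cabsN ltxx.
Qed.

Lemma qabs_small (e : R) : 0 < e ->
  exists2 Y : R, 1 <= Y & forall tau, Y <= complex.Im tau -> qabs tau < e.
Proof.
move=> e0; have pi0 := pi_gt0 R; exists (Num.max 1 (1 - ln e / pi)); first by rewrite le_max lexx.
move=> t; rewrite ge_max => /andP[_ tY].
rewrite /qabs -[ltRHS]lnK// ltr_expR ltrNl -ltr_pdivrMl//.
by apply: lt_le_trans tY; rewrite mulrN mulrC; lra.
Qed.

Lemma limI_taylor f (l : C) (M : R) :
  (forall t, 1 <= complex.Im t -> cabs (f t - l) <= M * qabs t) -> limI f l.
Proof.
move=> H e e0; have M1 : 0 < `|M| + 1 by rewrite ltr_wpDl.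
have [Y Y1 HY] := qabs_small (divr_gt0 e0 M1).
exists Y => t tY; apply: le_lt_trans (H _ (le_trans Y1 tY)) _.
have := HY t tY; rewrite ltr_pdivlMr// => h; apply: le_lt_trans h.
rewrite mulrC; apply: ler_wpM2l; first exact/ltW/qabs_gt0.
by have := ler_norm M; lra.
Qed.

Lemma qexp_lim0 f c : qexp f c -> limI f (c 0%N).
Proof.
move=> /(@qexp_taylor _ _ _ 1)[M H]; apply: (@limI_taylor _ _ M) => t t1.
by have := H t t1; rewrite big_ord1 epi0 mulr1 expr1.
Qed.

Lemma qexp_lim1 f c : qexp f c -> c 0%N = 0 ->
  limI (fun t => f t / epi 1 t) (c 1%N).
Proof.
move=> /(@qexp_taylor _ _ _ 2)[M H] c0; apply: (@limI_taylor _ _ M) => t t1.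
have := H t t1; rewrite big_ord_recl big_ord1 /= c0 mul0r add0r.
have -> : f t / epi 1 t - c 1%N = (f t - c 1%N * epi 1 t) / epi 1 t.
  by field; exact: epi_neq0.
rewrite cabsM cabsV cabs_epi1 ler_pdivrMr ?qabs_gt0//.
by rewrite expr2 mulrA.
Qed.

Lemma inH_pow2 tau k : inH tau -> inH (2 ^+ k * tau).
Proof. by move=> h; elim: k => [|k IH]; rewrite ?mul1r// exprS -mulrA; exact: inH2. Qed.

Lemma Im_pow2 tau k : complex.Im (2 ^+ k * tau) = 2 ^+ k * complex.Im tau.
Proof. by rewrite -!natrX !mulr_natl raddfMn. Qed.

Lemma pow2_large (Y : R) tau : inH tau ->
  exists k0, forall k, (k0 <= k)%N -> Y <= complex.Im (2 ^+ k * tau).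
Proof.
move=> h; have y0 : 0 < complex.Im tau := h.
pose n := (Num.truncn (`|Y| / complex.Im tau)).+1.
exists n => k nk; rewrite Im_pow2 -ler_pdivrMr//.
apply: (@le_trans _ _ (`|Y| / complex.Im tau)).
  by rewrite ler_wpM2r ?ler_norm// invr_ge0 ltW.
apply: (@le_trans _ _ n%:R); first by rewrite ltW// truncnS_gt.
by rewrite -natrX ler_nat (leq_trans nk)// ltnW// ltn_expl.
Qed.

(** Applied with [P] the vanishing of a theta function or product: a zero would be carried up to
    heights where the constant term of the expansion excludes it. *)
Lemma double_ind (P : C -> Prop) (Y : R) :
  (forall tau, inH tau -> P tau -> P (2 * tau)) ->
  (forall tau, inH tau -> Y <= complex.Im tau -> ~ P tau) ->
  forall tau, inH tau -> ~ P tau.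
Proof.
move=> step large tau h Pt.
have Pk k : P (2 ^+ k * tau).
  elim: k => [|k IH]; first by rewrite mul1r.
  by rewrite exprS -mulrA; apply: step => //; exact: inH_pow2.
have [k /(_ k (leqnn k)) H] := pow2_large Y h.
exact: (large _ (inH_pow2 k h) H (Pk k)).
Qed.

Lemma double_invariant f l : (forall tau, inH tau -> f tau = f (2 * tau)) ->
  limI f l -> forall tau, inH tau -> f tau = l.
Proof.
move=> step lim tau h.
have fk k : f tau = f (2 ^+ k * tau).
  elim: k => [|k IH]; first by rewrite mul1r.
  by rewrite exprS -mulrA -step//; exact: inH_pow2.
apply/eqP; rewrite -subr_eq0; apply/eqP/cabs_eps_eq0 => e e0.
have [Y HY] := lim e e0; have [k /(_ k (leqnn k)) H] := pow2_large Y h.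
by rewrite (fk k); exact: HY.
Qed.

Lemma theta_neq0_both tau : inH tau -> theta tau * theta4 tau != 0.
Proof.
move=> h; apply/eqP; move: tau h.
have [c3 Q3 [c30 _]] := qexp_theta R; have [c4 Q4 [c40 _]] := qexp_theta4 R.
have [|Y HY] := limI_neq0 _ (limIM (qexp_lim0 Q3) (qexp_lim0 Q4)).
  by rewrite c30 c40 mulr1 oner_eq0.
apply: (@double_ind _ Y) => [tau h|tau h /HY /eqP//].
rewrite theta_theta4// => /eqP; rewrite expf_eq0 /= => /eqP->.
by rewrite mulr0.
Qed.

Lemma theta_neq0 tau : inH tau -> theta tau != 0.
Proof. by move=> /theta_neq0_both; rewrite mulf_eq0 negb_or => /andP[]. Qed.

Lemma theta4_neq0 tau : inH tau -> theta4 tau != 0.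
Proof. by move=> /theta_neq0_both; rewrite mulf_eq0 negb_or => /andP[]. Qed.

Lemma theta_half_neq0 tau : inH tau -> theta_half tau != 0.
Proof.
move=> h; apply/eqP; move: tau h.
have [c Q c0] := qexp_psi R.
have [|Y HY] := limI_neq0 _ (qexp_lim0 Q).
  by rewrite c0 pnatr_eq0.
apply: (@double_ind _ Y) => [tau h H|tau h /HY].
  have := theta_half_sqr h; rewrite H expr0n /= => /esym/eqP.
  rewrite !mulf_eq0 pnatr_eq0 /= (negbTE (theta_neq0 (inH2 h))) orbF.
  by move/eqP.
move=> /negP psi0 /eqP; rewrite theta_half_psi// mulf_eq0.
by rewrite (negbTE (epi_neq0 _ _)).
Qed.

Lemma hasD_theta : hasD (@theta R) (Dop (@theta R)).
Proof. by have [c /qexp_Dop[]] := qexp_theta R. Qed.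

Lemma hasD_theta4 : hasD (@theta4 R) (Dop (@theta4 R)).
Proof. by have [c /qexp_Dop[]] := qexp_theta4 R. Qed.

Lemma Dtheta_mean tau : inH tau ->
  theta tau * Dop (@theta R) tau + theta4 tau * Dop (@theta4 R) tau =
  4 * theta (2 * tau) * Dop (@theta R) (2 * tau).
Proof.
move=> h; have H3 := hasD_theta; have H4 := hasD_theta4.
have E t : inH t -> theta t ^+ 2 + theta4 t ^+ 2 = 2 * theta (2 * t) ^+ 2.
  by move=> ht; rewrite theta_sqr// theta4_sqr//; ring.
have := hasD_unique E (hasDD (hasDX 2 H3) (hasDX 2 H4)) (hasDZ 2 (hasDX 2 (hasD2 H3))) h.
rewrite !expr1 => H; apply: (@mulfI _ 2); first by rewrite pnatr_eq0.
move: H; move: (theta tau) (theta (2 * tau)) (theta4 tau) (Dop (@theta R) tau)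
  (Dop (@theta4 R) tau) (Dop (@theta R) (2 * tau)) => a A b a' b' A' H.
have -> : 2 * (a * a' + b * b') = 2 * a * a' + 2 * b * b' by ring.
by rewrite H; ring.
Qed.

Lemma Dtheta_product tau : inH tau ->
  Dop (@theta R) tau * theta4 tau + theta tau * Dop (@theta4 R) tau =
  4 * theta4 (2 * tau) * Dop (@theta4 R) (2 * tau).
Proof.
move=> h; have H3 := hasD_theta; have H4 := hasD_theta4.
have := hasD_unique (@theta_theta4 R) (hasDM H3 H4) (hasDX 2 (hasD2 H4)) h.
by rewrite !expr1 => ->; move: (theta4 _) (Dop _ _) => a b; ring.
Qed.

Lemma theta_sqrD tau : inH tau ->
  theta tau ^+ 2 + theta4 tau ^+ 2 = 2 * theta (2 * tau) ^+ 2.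
Proof. by move=> h; rewrite theta_sqr// theta4_sqr//; ring. Qed.

Lemma theta_sqrB tau : inH tau ->
  theta tau ^+ 2 - theta4 tau ^+ 2 = 2 * theta_half (2 * tau) ^+ 2.
Proof. by move=> h; rewrite theta_sqr// theta4_sqr//; ring. Qed.

Lemma theta_half_pow4 tau : inH tau ->
  theta_half tau ^+ 4 = 4 * theta_half (2 * tau) ^+ 2 * theta (2 * tau) ^+ 2.
Proof.
move=> h; have -> : theta_half tau ^+ 4 = (theta_half tau ^+ 2) ^+ 2 by rewrite -exprM.
by rewrite theta_half_sqr//; ring.
Qed.

Lemma epi_quarter4 tau : epi 4^-1 tau ^+ 4 = epi 1 tau.
Proof. by rewrite /epi -cexpMn; congr cexp; field. Qed.

Lemma theta_half4_psi tau : inH tau -> theta_half tau ^+ 4 = epi 1 tau * psi tau ^+ 4.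
Proof. by move=> h; rewrite theta_half_psi// exprMn epi_quarter4. Qed.

(* The quotient M / N of the two sides is invariant under tau |-> 2 tau and
   tends to 1 at i oo. *)
Lemma Dlog_theta_theta4 tau : inH tau ->
  Dop (@theta R) tau / theta tau - Dop (@theta4 R) tau / theta4 tau
  = theta_half tau ^+ 4 / 4.
Proof.
move=> h.
pose M t := Dop (@theta R) t * theta4 t - theta t * Dop (@theta4 R) t.
pose N t := theta t * theta4 t * theta_half t ^+ 4 / 4.
have nz t : inH t -> [/\ theta t != 0, theta4 t != 0 & theta_half t != 0].
  by move=> ht; rewrite theta_neq0// theta4_neq0// theta_half_neq0.
have inv t : inH t -> M t / N t = M (2 * t) / N (2 * t).
  move=> ht; have [n3 n4 n2] := nz _ ht; have [m3 m4 m2] := nz _ (inH2 ht).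
  have := Dtheta_mean ht; have := Dtheta_product ht.
  have := theta_sqrD ht; have := theta_sqrB ht.
  rewrite /M /N theta_half_pow4// theta_theta4//.
  have ab := theta_theta4 ht.
  move: (theta t) (theta4 t) (Dop (@theta R) t) (Dop (@theta4 R) t) n3 n4 ab => a b a' b' n3 n4 ab.
  move: (theta (2 * t)) (theta4 (2 * t)) (theta_half (2 * t)) (Dop (@theta R) (2 * t)) (Dop (@theta4 R) (2 * t)) m3 m4 m2 ab.
  move=> A B T A' B' m3 m4 m2 ab sB sD eP eM.
  (* The Wronskian of [theta] and [theta4] at [2 tau] is reached from the one at [tau] by
     eliminating between the derivatives of the mean and product identities. *)
  have key : 4 * A * B * (A' * B - A * B') = T ^+ 2 * (a' * b - a * b').
    apply: (@mulfI _ 2); first by rewrite pnatr_eq0.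
    have -> : 2 * (4 * A * B * (A' * B - A * B')) =
      2 * (4 * A * A') * B ^+ 2 - (4 * B * B') * (2 * A ^+ 2) by ring.
    have -> : 2 * (T ^+ 2 * (a' * b - a * b')) = (2 * T ^+ 2) * (a' * b - a * b') by ring.
    by rewrite -eM -eP -ab -sB -sD; ring.
  have -> : a' * b - a * b' = 4 * A * B * (A' * B - A * B') / T ^+ 2.
    by rewrite key; field.
  by field; rewrite m3 m4 m2.
have lim : limI (fun t => M t / N t) 1.
  have [c3 Q3 [c30 c31]] := qexp_theta R; have [c4 Q4 [c40 c41]] := qexp_theta4 R.
  have [cp Qp cp0] := qexp_psi R.
  have [Q3' _] := qexp_Dop Q3; have [Q4' _] := qexp_Dop Q4.
  have l3 := qexp_lim0 Q3; have l4 := qexp_lim0 Q4; have lp := qexp_lim0 Qp.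
  have := qexp_lim1 Q3'; rewrite {1}/qD mul0r => /(_ erefl) l3'.
  have := qexp_lim1 Q4'; rewrite {1}/qD mul0r => /(_ erefl) l4'.
  have := limIM (limIB (limIM l3' l4) (limIM l3 l4'))
    (limIV _ (limIM (limIM l3 l4) (limIM (limIX 4 lp) (limI_cst 4^-1)))).
  rewrite /qD c30 c40 cp0 c31 c41.
  (* Divided by q, both [M] and [N] tend to 4: [M] through the linear coefficients 2 and -2, [N]
     through [psi ^+ 4 / 4] with [psi] tending to 2. *)
  have -> : (1%:R * 2 * 1 - 1 * (1%:R * -2)) / (1 * 1 * (2 ^+ 4 / 4)) = 1 :> C by field.
  move=> H; apply: limI_eqH (H _) => [t ht|].
    have [n3 n4 n2] := nz _ ht.
    rewrite /M /N theta_half4_psi//.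
    have p0 : psi t != 0.
      by move: n2; rewrite theta_half_psi// mulf_eq0 negb_or => /andP[].
    have q0 := epi_neq0 1 t.
    move: (theta t) (theta4 t) (psi t) (epi 1 t) (Dop (@theta R) t) (Dop (@theta4 R) t) n3 n4 p0 q0.
    by move=> a b p q a' b' n3 n4 p0 q0; field; rewrite n3 n4 p0 q0.
  by rewrite !mulf_neq0 ?expf_neq0 ?oner_eq0 ?invr_eq0 ?pnatr_eq0.
have := double_invariant inv lim h.
have [n3 n4 n2] := nz _ h.
have N0 : N tau != 0.
  by rewrite /N !mulf_neq0 ?expf_neq0// invr_eq0 pnatr_eq0.
move=> /(congr1 ( *%R^~ (N tau))); rewrite divfK// mul1r /M /N => H.
apply: (@mulfI _ (theta tau * theta4 tau)); first by rewrite mulf_neq0.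
rewrite [RHS]mulrA -H; move: (theta tau) (theta4 tau) (Dop (@theta R) tau) (Dop (@theta4 R) tau) n3 n4.
by move=> a b a' b' n3 n4; field; rewrite n3 n4.
Qed.

Definition pf tau : C := Dop (@theta R) tau / theta tau.
Definition Dpf tau : C :=
  (Dop (Dop (@theta R)) tau * theta tau - Dop (@theta R) tau ^+ 2) / theta tau ^+ 2.

Lemma hasD_pf : hasD pf Dpf.
Proof.
have [c Q _] := qexp_theta R; have [Q' H] := qexp_Dop Q; have [_ H'] := qexp_Dop Q'.
apply: hasD_eq (hasDM H' (hasDV (@theta_neq0) H)) => // t h; rewrite /Dpf.
have := theta_neq0 h; move: (theta t) (Dop (Dop (@theta R)) t) (Dop (@theta R) t) => a d e a0.
by field.
Qed.

Lemma Dtheta_pf tau : inH tau -> Dop (@theta R) tau = theta tau * pf tau.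
Proof. by move=> h; rewrite /pf mulrC divfK// theta_neq0. Qed.

Lemma Dtheta4_pf tau : inH tau ->
  Dop (@theta4 R) tau = theta4 tau * (pf tau - theta_half tau ^+ 4 / 4).
Proof.
move=> h; rewrite -Dlog_theta_theta4// /pf opprB addrC subrK mulrC divfK//.
exact: theta4_neq0.
Qed.

(** In the derivative of the mean identity, [theta_half ^+ 4] factors as [theta^2 - theta4^2] times
    [theta^2 + theta4^2]; the second factor is twice the square of [theta (2 tau)] and divides
    out. *)
Lemma pf_double tau : inH tau ->
  2 * pf (2 * tau) =
  pf tau - theta4 tau ^+ 2 * (theta tau ^+ 2 - theta4 tau ^+ 2) / 4.
Proof.
move=> h; have h2 := inH2 h.
have := Dtheta_mean h; rewrite !Dtheta_pf// Dtheta4_pf//.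
have := theta_sqrD h; have := theta_jacobi h; have := theta_neq0 h2.
move: (theta_half tau ^+ 4) (theta (2 * tau)) (pf _) (pf _) => y A P p.
move: (theta tau) (theta4 tau) => a b A0 J S H.
have yE : y = a ^+ 4 - b ^+ 4 by rewrite J addrC addKr.
have A2 : A ^+ 2 != 0 by rewrite expf_neq0.
apply: (mulfI A2); apply: (@mulfI _ 2); first by rewrite pnatr_eq0.
have -> : 2 * (A ^+ 2 * (2 * P)) = 4 * A * (A * P) by ring.
have -> : forall z, 2 * (A ^+ 2 * z) = (2 * A ^+ 2) * z by move=> z; ring.
rewrite -H -S yE; by field.
Qed.

Lemma Dpf_double tau : inH tau -> 4 * Dpf (2 * tau) = Dpf tau -
  (2 * theta4 tau * Dop (@theta4 R) tau * (theta tau ^+ 2 - theta4 tau ^+ 2)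
   + theta4 tau ^+ 2 * (2 * theta tau * Dop (@theta R) tau
                        - 2 * theta4 tau * Dop (@theta4 R) tau)) / 4.
Proof.
move=> h; have H3 := hasD_theta; have H4 := hasD_theta4.
have L := hasDZ 2 (hasD2 hasD_pf).
have Rr := hasDD hasD_pf (hasDZ (- 4^-1) (hasDM (hasDX 2 H4)
   (hasDD (hasDX 2 H3) (hasDZ (-1) (hasDX 2 H4))))).
have := hasD_unique _ L Rr h; rewrite /= !expr1 => E.
have -> : 4 * Dpf (2 * tau) = 2 * (2 * Dpf (2 * tau)) by ring.
rewrite E; last first.
  by move=> t ht; rewrite pf_double//; move: (theta t) (theta4 t) (pf t) => a b p; field.
by move: (theta tau) (theta4 tau) (Dop (@theta R) tau) (Dop (@theta4 R) tau) (Dpf tau) => a b a' b' p; field.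
Qed.

(** The defect in [D p = 2 p^2 - x y / 8]; the sign of the last term comes from
    [x = - theta4 ^+ 4]. *)
Definition riccati tau : C :=
  Dpf tau - 2 * pf tau ^+ 2 - theta_half tau ^+ 4 * theta4 tau ^+ 4 / 8.

Lemma riccati_double tau : inH tau -> riccati tau = 4 * riccati (2 * tau).
Proof.
move=> h; have h2 := inH2 h.
have -> : 4 * riccati (2 * tau) = 4 * Dpf (2 * tau) - 2 * (2 * pf (2 * tau)) ^+ 2 -
   (2 * theta_half (2 * tau) ^+ 2) ^+ 2 * (theta4 (2 * tau) ^+ 2) ^+ 2 / 8.
  by rewrite /riccati; field.
rewrite -theta_sqrB// -theta_theta4// pf_double// Dpf_double//.
rewrite Dtheta_pf// Dtheta4_pf// /riccati.
have -> : theta_half tau ^+ 4 = theta tau ^+ 4 - theta4 tau ^+ 4.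
  by rewrite theta_jacobi// addrC addKr.
by field.
Qed.

Lemma limI_riccati : limI (fun t => riccati t / epi 1 t) 0.
Proof.
have [c3 Q3 [c30 c31]] := qexp_theta R; have [c4 Q4 [c40 c41]] := qexp_theta4 R.
have [cp Qp cp0] := qexp_psi R.
have [Q3' _] := qexp_Dop Q3; have [Q3'' _] := qexp_Dop Q3'.
have l3 := qexp_lim0 Q3; have l4 := qexp_lim0 Q4; have lp := qexp_lim0 Qp.
have l3d := qexp_lim0 Q3'.
have := qexp_lim1 Q3'; rewrite {1}/qD mul0r => /(_ erefl) l3'.
have := qexp_lim1 Q3''; rewrite {1}/qD mul0r => /(_ erefl) l3''.
have n1 : (1 : C) != 0 by rewrite oner_eq0.
rewrite c30 in l3; have iv := limIV n1 l3.
have := limIB (limIB (limIM l3'' iv) (limIM (limI_cst 3) (limIM (limIM l3' l3d) (limIX 2 iv))))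
   (limIM (limIM (limIX 4 lp) (limIX 4 l4)) (limI_cst 8^-1)).
rewrite /qD c31 cp0 c40.
(* The factor 3 adds the square of [D theta / theta] in [Dpf] to the two in [2 p^2], and that square
   is o(q). The linear terms cancel: [2 - 2^4 / 8 = 0]. *)
have -> : 1%:R * (1%:R * 2) / 1 - 3 * (1%:R * 2 * (0%:R * c3 0%N) * 1^-1 ^+ 2) -
   2 ^+ 4 * 1 ^+ 4 / 8 = 0 :> C by field.
apply: limI_eqH => t h.
rewrite /riccati /Dpf /pf theta_half4_psi//.
have := theta_neq0 h; have := epi_neq0 1 t.
move: (theta t) (theta4 t) (psi t) (epi 1 t) (Dop (Dop (@theta R)) t) (Dop (@theta R) t).
by move=> a b p q d e q0 a0; field; rewrite a0 q0.
Qed.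

(* Doubling tau divides riccati by 4 only, while it is o(q) at i oo. *)
Lemma riccati_eq0 tau : inH tau -> riccati tau = 0.
Proof.
move=> h; apply: cabs_eps_eq0 => e e0.
have rk k : riccati tau = 4 ^+ k * riccati (2 ^+ k * tau).
  elim: k => [|k IH]; first by rewrite !mul1r.
  rewrite IH riccati_double; last exact: inH_pow2.
  by rewrite mulrA -exprSr (exprS 2) mulrA.
have [Y HY] := limI_riccati ltr01.
have [k0 Hk] := pow2_large Y h.
have qt : 0 < qabs tau < 1 by rewrite qabs_gt0 qabs_lt1.
(* [M] bounds [n^3 |q|^n]; at [n = 2^k] this reads [4^k |q|^(2^k) <= M / 2^k], which beats the
   factor [4^k] of the doubling. *)
have [M HM] := subexpMn (subexpMn (@subexp_nat R)) qt.
have M0 : 0 <= M by apply: le_trans (HM 0%N); rewrite mul0r cabs0 mul0r.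
pose k := maxn k0 (Num.truncn (M / e)).+1.
have := HY _ (Hk k (leq_maxl _ _)); rewrite subr0 cabsM cabsV cabs_epi1.
rewrite ltr_pdivrMr ?qabs_gt0// mul1r => Hr.
rewrite (rk k) cabsM cabsX cabs_nat.
have qk : qabs (2 ^+ k * tau) = qabs tau ^+ (2 ^ k).
  rewrite /qabs Im_pow2 -expRM_natl; congr expR.
  by rewrite natrX; ring.
rewrite qk in Hr.
apply: (@le_lt_trans _ _ (4 ^+ k * qabs tau ^+ (2 ^ k))).
  by rewrite ler_wpM2l ?exprn_ge0// ltW.
have k2 : (0 : R) < (2 ^ k)%:R by rewrite ltr0n expn_gt0.
have := HM (2 ^ k)%N; rewrite !cabsM cabs_nat => HMk.
rewrite -(ltr_pM2l k2); apply: le_lt_trans (_ : M < _).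
  apply: le_trans HMk; rewrite le_eqVlt; apply/orP; left; apply/eqP.
  have -> : (4 : R) = 2 * 2 by rewrite -natrM.
  by rewrite exprMn !natrX; ring.
rewrite -ltr_pdivrMr//; apply: (@lt_trans _ _ (Num.truncn (M / e)).+1%:R).
  by rewrite truncnS_gt.
by rewrite ltr_nat (leq_ltn_trans (leq_maxr k0 _))// ltn_expl.
Qed.

Lemma Dpf_eq tau : inH tau ->
  Dpf tau = 2 * pf tau ^+ 2 + theta_half tau ^+ 4 * theta4 tau ^+ 4 / 8.
Proof.
by move=> /riccati_eq0; rewrite /riccati -addrA -opprD => /eqP; rewrite subr_eq0 => /eqP.
Qed.

Lemma hasD_xf : hasD (@xf R) (fun t => xf t * (4 * pf t - yf t)).
Proof.
apply: hasD_eq (hasDZ (-1) (hasDX 4 hasD_theta4)) => t h /=.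
  by rewrite mulN1r.
rewrite Dtheta4_pf// /xf /yf; by field.
Qed.

Lemma yf_theta tau : inH tau -> yf tau = theta tau ^+ 4 + xf tau.
Proof. by move=> h; rewrite /yf /xf theta_jacobi//; ring. Qed.

Lemma hasD_yf : hasD (@yf R) (fun t => yf t * (4 * pf t - xf t)).
Proof.
apply: hasD_eq (hasDD (hasDX 4 hasD_theta) hasD_xf) => t h /=.
  by rewrite yf_theta.
by rewrite Dtheta_pf// yf_theta//; ring.
Qed.

Lemma hasD_pf_xy : hasD pf (fun t => 2 * pf t ^+ 2 - xf t * yf t / 8).
Proof.
apply: hasD_eq hasD_pf => // t h; rewrite Dpf_eq// /xf /yf; by field.
Qed.

Lemma xf_neq0 tau : inH tau -> xf tau != 0.
Proof. by move=> h; rewrite /xf oppr_eq0 expf_neq0// theta4_neq0. Qed.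

Lemma AfE tau : Af tau = - (2 * pi%:C ^+ 2) * pf tau.
Proof.
have p0 := pii_neq0 R.
have pi0 : (pi%:C : C) != 0 by move: p0; rewrite mulf_eq0 negb_or => /andP[].
have i0 : ('i : C) != 0 by move: p0; rewrite mulf_eq0 negb_or => /andP[].
rewrite /Af /tf /pf /Dop !invfM.
have -> : (2 : C)^-1 * pi%:C^-1 * 'i^-1 * (derive1 (@theta R) tau / theta tau) =
  2^-1 * ((pi%:C^-1 * 'i^-1) * derive1 (@theta R) tau / theta tau) by ring.
move: (_ / theta tau) => X; by field.
Qed.

End ThetaODE.

(** * The Gamma function *)

Section GammaFunction.
Variable R : realType.
Local Notation mu := (@lebesgue_measure R).
Implicit Types (s t a b : R).

Lemma Rintegral_FTC (f F : R -> R) a b : a < b ->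
  (forall x, x \in `[a, b] -> derivable f x 1) ->
  (forall x, x \in `[a, b] -> is_derive x 1 F (f x)) ->
  \int[mu]_(x in `[a, b]) f x = F b - F a.
Proof.
move=> ab df dF.
have cF x : x \in `[a, b] -> {for x, continuous F}.
  move=> xab; apply: differentiable_continuous.
  by apply/derivable1_diffP; have [] := dF x xab.
rewrite /Rintegral (@continuous_FTC2 _ f F a b)//=.
- exact: derivable_within_continuous.
- split.
  + move=> x /subset_itv_oo_cc xab; by have [] := dF x xab.
  + by apply: cvg_at_right_filter; apply: cF; rewrite in_itv /= lexx ltW.
  + by apply: cvg_at_left_filter; apply: cF; rewrite in_itv /= lexx ltW.
- move=> x /subset_itv_oo_cc xab; rewrite derive1E.
  by have [] := dF x xab.
Qed.

Lemma integrable_derivable (f : R -> R) a b :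
  (forall x, x \in `[a, b] -> derivable f x 1) ->
  mu.-integrable `[a, b] (EFin \o f).
Proof.
move=> df; apply: continuous_compact_integrable; first exact: segment_compact.
exact: derivable_within_continuous.
Qed.

Lemma Rintegral_EFin (f : R -> R) a b : mu.-integrable `[a, b] (EFin \o f) ->
  (\int[mu]_(x in `[a, b]) (f x)%:E)%E = (\int[mu]_(x in `[a, b]) f x)%:E.
Proof. by move=> fi; rewrite /Rintegral fineK//; exact: (integrable_fin_num _ fi). Qed.

Lemma Rintegral_le_subset (f : R -> R) a b c d :
  mu.-integrable `[c, d] (EFin \o f) -> [set` `[a, b]] `<=` [set` `[c, d]] ->
  (forall x, 0 <= f x) -> mu.-integrable `[a, b] (EFin \o f) ->
  \int[mu]_(x in `[a, b]) f x <= \int[mu]_(x in `[c, d]) f x.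
Proof.
move=> icd sub f0 iab; rewrite -lee_fin -!Rintegral_EFin//.
have /integrableP[mf _] := icd.
by apply: ge0_subset_integral => // x _; rewrite lee_fin.
Qed.

Definition gamma_fun s t : R := t `^ (s - 1) * expR (- t).

Lemma is_derive_expRN t : is_derive t 1 (fun x : R => expR (- x)) (- expR (- t)).
Proof.
have h : is_derive t 1 (-%R : R -> R) (-1) := is_deriveN (is_derive_id t 1).
have := @is_derive1_comp R expR -%R t _ _ (is_derive_expR (- t)) h.
by rewrite mulrN1.
Qed.

Lemma is_derive_gamma_fun s t : 0 < t ->
  is_derive t 1 (fun x => x `^ s * expR (- x)) (s * gamma_fun s t - gamma_fun (s + 1) t).
Proof.
move=> t0; have := is_deriveM (is_derive1_powR s t0) (is_derive_expRN t).
move=> /is_derive_eq; apply; rewrite /gamma_fun /GRing.scale /= addrK.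
ring.
Qed.

Lemma gamma_fun_ge0 s t : 0 <= gamma_fun s t.
Proof. by rewrite mulr_ge0 ?powR_ge0 ?expR_ge0. Qed.

Lemma derivable_gamma_fun s t : 0 < t -> derivable (gamma_fun s) t 1.
Proof. by move=> t0; have [] := is_derive_gamma_fun (s - 1) t0. Qed.

(** Compact intervals exhausting []0, +oo[], on which the integrand is continuous and can be
    integrated by parts. The index is shifted so that all of them contain [[1, 2]]. *)
Let lo n : R := n.+2%:R^-1.
Let hi n : R := n.+2%:R.
Let J s n := \int[mu]_(t in `[lo n, hi n]) gamma_fun s t.

Let lo_gt0 n : 0 < lo n. Proof. by rewrite invr_gt0. Qed.
Let lo_lt1 n : lo n < 1. Proof. by rewrite invf_lt1// ltr1n. Qed.

Let lo_hi n : lo n < hi n.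
Proof. by apply: lt_trans (lo_lt1 n) _; rewrite ltr1n. Qed.

Let itv_gt0 n t : t \in `[lo n, hi n] -> 0 < t.
Proof. by rewrite in_itv /= => /andP[h _]; apply: lt_le_trans h. Qed.

Let gamma_integrable s n : mu.-integrable `[lo n, hi n] (EFin \o gamma_fun s).
Proof.
by apply: integrable_derivable => t /itv_gt0; exact: derivable_gamma_fun.
Qed.

Let J_parts s n : J (s + 1) n =
  s * J s n - (hi n `^ s * expR (- hi n) - lo n `^ s * expR (- lo n)).
Proof.
have <- : \int[mu]_(t in `[lo n, hi n]) (s * gamma_fun s t - gamma_fun (s + 1) t) =
    hi n `^ s * expR (- hi n) - lo n `^ s * expR (- lo n).
  apply: (@Rintegral_FTC _ (fun x => x `^ s * expR (- x))) => // t /itv_gt0 t0.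
    apply: derivableB; last exact: derivable_gamma_fun.
    by apply: derivableM; [exact: derivable_cst|exact: derivable_gamma_fun].
  exact: is_derive_gamma_fun.
rewrite RintegralB//; last first.
  apply: integrable_derivable => t /itv_gt0 t0.
  by apply: derivableM; [exact: derivable_cst|exact: derivable_gamma_fun].
by rewrite RintegralZl// -/(J s n) -/(J (s + 1) n); ring.
Qed.

(** With [N = s + 1], [N exp (t / N) >= N + t >= 1 + t]; the [N]-th power gives the bound [N^N]. *)
Lemma exp_powR_bound s : 0 <= s -> exists2 K : R, 0 < K & forall t, 0 <= t ->
  (1 + t) `^ (s + 1) * expR (- t) <= K.
Proof.
move=> s0; pose N := s + 1; have N1 : 1 <= N by rewrite lerDr.
have N0 : 0 < N by lra.
exists (N `^ N) => [|t t0]; first exact: powR_gt0.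
rewrite expRN ler_pdivrMr ?expR_gt0// -/N.
have -> : expR t = expR (t / N) `^ N by rewrite -expRM divfK// gt_eqF.
rewrite -powRM ?expR_ge0 ?(ltW N0)// ge0_ler_powR ?nnegrE ?mulr_ge0 ?expR_ge0 ?(ltW N0)//.
  by rewrite addr_ge0.
apply: le_trans (ler_wpM2l (ltW N0) (expR_ge1Dx (t / N))).
rewrite mulrDr mulr1 mulrC divfK ?gt_eqF//; lra.
Qed.

Let tail_bound s : 0 <= s -> exists2 K : R, 0 < K & forall t, 0 < t ->
  t `^ s * expR (- t) <= K / (1 + t).
Proof.
move=> s0; have [K K0 HK] := exp_powR_bound s0; exists K => // t t0.
have t1 : 0 < 1 + t by lra.
rewrite ler_pdivlMr//; apply: le_trans (HK t (ltW t0)).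
rewrite mulrAC ler_wpM2r ?expR_ge0// powRD; last by rewrite (gt_eqF t1) implybT.
rewrite powRr1 ?(ltW t1)// ler_wpM2r ?(ltW t1)//.
by rewrite ge0_ler_powR ?nnegrE ?(ltW t0) ?(ltW t1)//; lra.
Qed.

(** The integrand is dominated by [K / (1 + t)^2], which has the primitive [- K / (1 + t)]. *)
Let J_bound1 s : 0 <= s -> exists K : R, forall n, J (s + 1) n <= K.
Proof.
move=> s0; have [|K K0 HK] := @exp_powR_bound (s + 1); first lra.
have bnd t : 0 < t -> gamma_fun (s + 1) t <= K * ((1 + t)^-1 * (1 + t)^-1).
  move=> t0; have t1 : 0 < 1 + t by lra.
  rewrite -invfM -expr2 -ler_pdivrMr ?invr_gt0 ?exprn_gt0// invrK.
  apply: le_trans (HK t (ltW t0)); rewrite /gamma_fun addrK mulrAC ler_wpM2r ?expR_ge0//.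
  rewrite (_ : s + 1 + 1 = s + 2%:R); last by rewrite -addrA.
  rewrite powRD; last by rewrite (gt_eqF t1) implybT.
  rewrite powR_mulrn ?(ltW t1)// ler_wpM2r ?exprn_ge0 ?(ltW t1)//.
  by rewrite ge0_ler_powR ?nnegrE ?(ltW t0) ?(ltW t1)//; lra.
have dh t : is_derive t 1 (fun x : R => 1 + x) 1.
  by have := is_deriveD (is_derive_cst (1 : R) t 1) (is_derive_id t 1); rewrite add0r.
have dF t : 0 < t -> is_derive t 1 (fun x : R => - K / (1 + x)) (K * ((1 + t)^-1 * (1 + t)^-1)).
  move=> t0; have t1 : 1 + t != 0 by rewrite gt_eqF//; lra.
  have := is_deriveV t1 (dh t) => h'.
  have := is_deriveZ (- K) h' => h''; apply: is_derive_eq h'' _.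
  by rewrite /GRing.scale /= mulr1 mulrNN expr2 invfM.
have dG t : 0 < t -> derivable (fun t : R => K * ((1 + t)^-1 * (1 + t)^-1)) t 1.
  move=> t0; have t1 : 1 + t != 0 by rewrite gt_eqF//; lra.
  have [dV _] := is_deriveV t1 (dh t).
  by apply: derivableM; [exact: derivable_cst | exact: (derivableM dV dV)].
exists K => n; apply: (@le_trans _ _ (\int[mu]_(t in `[lo n, hi n]) (K * ((1 + t)^-1 * (1 + t)^-1)))).
  apply: le_Rintegral => //.
    by apply: integrable_derivable => t /itv_gt0; exact: dG.
  by move=> t /= /itv_gt0; exact: bnd.
have -> : \int[mu]_(t in `[lo n, hi n]) (K * ((1 + t)^-1 / (1 + t))) =
    - K / (1 + hi n) - (- K / (1 + lo n)).
  by apply: (@Rintegral_FTC _ (fun x : R => - K / (1 + x))) => // t /itv_gt0; [exact: dG | exact: dF].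
have l0 := lo_gt0 n; have h0 : 0 < hi n by rewrite ltr0n.
rewrite !mulNr opprK.
have : 0 <= K / (1 + hi n) by rewrite divr_ge0 ?(ltW K0)//; lra.
have : K / (1 + lo n) <= K by rewrite ler_pdivrMr ?ler_peMr ?(ltW K0)//; lra.
lra.
Qed.

(** For [s < 1] the integrand is unbounded at 0; integration by parts brings the bound down from
    [s + 1] to [s]. *)
Let J_bound s : 0 < s -> exists K : R, forall n, J s n <= K.
Proof.
move=> s0; have [K HK] := J_bound1 (ltW s0).
have [L L0 HL] := tail_bound (ltW s0).
exists ((K + L) / s) => n; rewrite ler_pdivlMr// mulrC.
have := J_parts s n; have := HK n.
have h0 : 0 < hi n by rewrite ltr0n.
have : hi n `^ s * expR (- hi n) <= L.
  apply: le_trans (HL _ h0) _; rewrite ler_pdivrMr; last lra.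
  by rewrite ler_peMr ?(ltW L0)//; lra.
have : 0 <= lo n `^ s * expR (- lo n) by rewrite mulr_ge0 ?powR_ge0 ?expR_ge0.
lra.
Qed.

Let itv_cover : \bigcup_n [set` `[lo n, hi n]] = [set` `]0, +oo[%R].
Proof.
apply/seteqP; split => [t [n _] /itv_gt0 t0|t]; rewrite /= in_itv /= ?andbT//.
move=> t0; pose n := Num.truncn (t + t^-1).
have tn : t + t^-1 < n.+1%:R by exact: truncnS_gt.
have i0 : 0 < t^-1 by rewrite invr_gt0.
have n12 : (n.+1%:R : R) <= n.+2%:R by rewrite ler_nat.
exists n => //=; rewrite in_itv /=; apply/andP; split.
  by rewrite /lo -[leRHS]invrK lef_pV2 ?posrE//; lra.
by rewrite /hi; lra.
Qed.

Let J_EFin s n : (\int[mu]_(t in `[lo n, hi n]) (gamma_fun s t)%:E)%E = (J s n)%:E.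
Proof. exact: Rintegral_EFin (gamma_integrable s n). Qed.

Lemma Gamma_cvg s : 0 < s -> J s @ \oo --> Gamma s.
Proof.
move=> s0.
have H : (fun n => (J s n)%:E) @ \oo --> (\int[mu]_(t in `]0%R, +oo[) (gamma_fun s t)%:E)%E.
  have -> : (fun n => (J s n)%:E) = (fun n => \int[mu]_(t in `[lo n, hi n]) (gamma_fun s t)%:E)%E.
    by apply/funext => n; rewrite J_EFin.
  have := @ge0_nondecreasing_set_cvg_integral _ (measurableTypeR R) R (fun n => [set` `[lo n, hi n]])
    (fun t => (gamma_fun s t)%:E) mu; rewrite itv_cover; apply => //.
  - apply/nondecreasing_seqP => n; apply/subsetPset => t /=; rewrite !in_itv /=.
    move=> /andP[h1 h2]; apply/andP; split.
      by apply: le_trans h1; rewrite lef_pV2 ?posrE// ler_nat.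
    by apply: le_trans h2 _; rewrite ler_nat.
  - by move=> n; have /integrableP[] := gamma_integrable s n.
  - by move=> n t _; rewrite lee_fin gamma_fun_ge0.
have [K HK] := J_bound s0.
(* [Gamma] is the real part of an extended integral, so the limit given by monotone convergence has
   to be shown finite before it can be identified with [Gamma s]. *)
have fin : (\int[mu]_(t in `]0%R, +oo[) (gamma_fun s t)%:E)%E \is a fin_num.
  rewrite ge0_fin_numE; last first.
    by apply: integral_ge0 => t _; rewrite lee_fin gamma_fun_ge0.
  apply: (@le_lt_trans _ _ K%:E); last exact: ltry.
  rewrite -(cvg_lim _ H)//; apply: lime_le; first by apply/cvg_ex; eexists; exact: H.
  by near=> n; rewrite lee_fin.
move: H; rewrite -(fineK fin) => /fine_cvgP[_].
by apply: cvg_trans; apply: near_eq_cvg; near=> n.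
Unshelve. all: by end_near. Qed.

Lemma GammaS s : 0 < s -> Gamma (s + 1) = s * Gamma s.
Proof.
move=> s0.
have s10 : 0 < s + 1 by lra.
have to0 : (fun n => hi n `^ s * expR (- hi n) - lo n `^ s * expR (- lo n)) @ \oo --> (0 : R).
  rewrite -[X in _ --> X](subr0 0); apply: cvgB.
    have [L L0 HL] := tail_bound (ltW s0).
    apply: (@squeeze_cvgr _ _ _ _ (cst 0) (fun n => L * n.+1%:R^-1)).
    - near=> n; rewrite mulr_ge0 ?powR_ge0 ?expR_ge0//=.
      apply: le_trans (HL _ _) _; first by rewrite ltr0n.
      rewrite ler_wpM2l ?(ltW L0)// lef_pV2 ?posrE//; last by rewrite ltr_wpDl.
      by have : (n.+1%:R : R) <= hi n; [rewrite ler_nat | lra].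
    - exact: cvg_cst.
    - rewrite -[X in _ --> X](mulr0 L); apply: cvgM; first exact: cvg_cst.
      exact: cvg_harmonic.
  apply: (@squeeze_cvgr _ _ _ _ (cst 0) (fun n => lo n `^ s)).
  - near=> n; rewrite mulr_ge0 ?powR_ge0 ?expR_ge0//=.
    rewrite ler_piMr ?powR_ge0// -expR0 ler_expR oppr_le0.
    exact/ltW/lo_gt0.
  - exact: cvg_cst.
  - have := powR_cvg0 s0; move/cvg_at_rightP; apply; split => //.
    apply: (@squeeze_cvgr _ _ _ _ (cst 0) (fun n => n.+1%:R^-1)).
    - by near=> n; rewrite (ltW (lo_gt0 n)) /= lef_pV2 ?posrE// ler_nat.
    - exact: cvg_cst.
    - exact: cvg_harmonic.
have H1 := Gamma_cvg s10; have H2 := Gamma_cvg s0.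
have H3 : J (s + 1) @ \oo --> s * Gamma s - 0.
  under eq_cvg do rewrite J_parts.
  by apply: cvgB => //; apply: cvgM => //; exact: cvg_cst.
rewrite subr0 in H3.
by rewrite -(cvg_lim _ H1)// -(cvg_lim _ H3).
Unshelve. all: by end_near. Qed.

Lemma Gamma_gt0 s : 0 < s -> 0 < Gamma s.
Proof.
move=> s0.
(* On [[1, 2]], [t^(s-1) >= 1/t >= 1/2] and [exp (- t) >= exp (- 2)]. *)
pose c : R := expR (- 2) / 2.
have c0 : 0 < c by rewrite divr_gt0 ?expR_gt0.
apply: lt_le_trans c0 _.
have Jc n : c <= J s n.
  have sub : [set` `[(1 : R), 2]] `<=` [set` `[lo n, hi n]].
    move=> t /=; rewrite !in_itv /= => /andP[t1 t2]; apply/andP; split.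
      by apply: le_trans t1; exact/ltW/lo_lt1.
    by apply: le_trans t2 _; rewrite ler_nat.
  have c1 : \int[mu]_(t in `[(1 : R), 2]) c = c.
    rewrite Rintegral_cst//= lebesgue_measure_itv /= lte_fin ltr1n /=.
    by rewrite (_ : 2 - 1 = 1) ?mulr1//; lra.
  rewrite -c1; apply: (@le_trans _ _ (\int[mu]_(t in `[(1 : R), 2]) gamma_fun s t)).
    apply: le_Rintegral => //.
    - by apply: integrable_derivable => t _; exact: derivable_cst.
    - apply: integrable_derivable => t; rewrite in_itv /= => /andP[t1 _].
      by apply: derivable_gamma_fun; exact: lt_le_trans t1.
    - move=> t /=; rewrite in_itv /= => /andP[t1 t2].
      rewrite /gamma_fun /c mulrC; have t0 : 0 < t by lra.
      apply: ler_pM; rewrite ?expR_ge0 ?invr_ge0 ?ler0n//.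
        rewrite powRB; last by rewrite (gt_eqF t0) implybT.
        rewrite powRr1 ?(ltW t0)// ler_pdivlMr//.
        apply: (@le_trans _ _ 1); first by lra.
        by rewrite -(powRr0 t) ler_powR// ltW.
      by rewrite ler_expR lerN2.
  apply: (@Rintegral_le_subset (gamma_fun s) 1 2 (lo n) (hi n)) => //; first exact: gamma_fun_ge0.
  apply: integrable_derivable => t; rewrite in_itv /= => /andP[t1 _].
  by apply: derivable_gamma_fun; exact: lt_le_trans t1.
have := Gamma_cvg s0 => H; rewrite -(cvg_lim _ H)//.
by apply: limr_ge; [apply/cvg_ex; eexists; exact: H | near=> n].
Unshelve. all: by end_near. Qed.

End GammaFunction.

(** * The generating series *)

Section Convolution.
Variable F : fieldType.
Implicit Types (a b c : nat -> F).

Definition conv a b n : F := \sum_(i < n.+1) a i * b (n - i)%N.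

Lemma convE a b (N n : nat) : (n <= N)%N ->
  conv a b n = ((\poly_(i < N.+1) a i) * (\poly_(i < N.+1) b i))`_n.
Proof.
move=> nN; rewrite coefM; apply: eq_bigr => -[i i_n] _ /=.
rewrite !coef_poly !ltnS (leq_trans (leq_subr _ _) nN).
by rewrite (leq_trans _ nN).
Qed.

(** Up to index [n] a convolution is a product of truncated polynomials, from which associativity is
    inherited. *)
Lemma convA a b c n : conv a (conv b c) n = conv (conv a b) c n.
Proof.
pose pol (u : nat -> F) := \poly_(i < n.+1) u i.
have key (p q r : nat -> F) (i : 'I_n.+1) : conv p q i = (pol p * pol q)`_i.
  by rewrite (@convE p q n) // -ltnS.
transitivity ((pol a * (pol b * pol c))`_n).
  rewrite coefM; apply: eq_bigr => i _.
  by rewrite (@convE b c n) ?leq_subr// /pol coef_poly ltn_ord.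
rewrite mulrA coefM; apply: eq_bigr => i _.
by rewrite (@convE a b n) -1?ltnS// /pol [(\poly_(_ < _) c _)`__]coef_poly ltnS leq_subr.
Qed.

Lemma conv_delta a n : conv (fun i => if i == 0%N then 1 else 0) a n = a n.
Proof.
rewrite /conv big_ord_recl /= mul1r subn0 big1 ?addr0// => i _.
by rewrite mul0r.
Qed.

Definition prev a n : F := if n is m.+1 then a m else 0.

Lemma conv_prev a b m : conv (prev a) b m = conv a (prev b) m.
Proof.
rewrite /conv big_ord_recl /= mul0r add0r big_ord_recr /= subnn mulr0 addr0.
apply: eq_bigr => i _; rewrite /bump /= add1n.
by case: m i => [[]//|m] i /=; rewrite subSS subSn// -ltnS.
Qed.

(* The coefficient identity behind z G'' + w G' = - D G for G = exp (A z) Phi: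
   e stands for A^i / i!, phi for the coefficients of Phi, phi' for their
   derivatives; B - A^2 is the derivative of A. *)
Lemma conv_recurrence (A B w : F) (e phi phi' : nat -> F) m :
  (forall i, i.+1%:R * e i.+1 = A * e i) ->
  (forall n, n.+1%:R * (n%:R + w) * phi n.+1 + (2 * n%:R + w) * A * phi n
             + phi' n + B * prev phi n = 0) ->
  m.+1%:R * (m%:R + w) * conv e phi m.+1 =
  - (conv e phi' m + (B - A ^+ 2) * conv (prev e) phi m).
Proof.
move=> He Hphi.
have phi'E n : phi' n = - (n.+1%:R * (n%:R + w) * phi n.+1
    + (2 * n%:R + w) * A * phi n + B * prev phi n).
  by have /eqP := Hphi n; rewrite addrAC addrC addr_eq0 => /eqP ->.
(* Every term is brought to the form weight times [e_i phi_j] with [i + j = m + 1]. The weights then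
   add up by [j (j - 1 + w) + i (2 j + w) + i (i - 1) = (m + 1) (m + w)]. *)
have S1 : \sum_(i < m.+1) e i * ((m - i).+1%:R * ((m - i)%:R + w) * phi (m - i).+1) =
    \sum_(i < m.+2) ((m.+1 - i)%:R * ((m.+1 - i)%:R - 1 + w)) * (e i * phi (m.+1 - i)%N).
  rewrite [RHS]big_ord_recr /= subnn !mul0r addr0; apply: eq_bigr => i _.
  rewrite subSn; last by rewrite -ltnS.
  by rewrite -natr1 addrK; ring.
have S2 : \sum_(i < m.+1) e i * ((2 * (m - i)%:R + w) * A * phi (m - i)%N) =
    \sum_(i < m.+2) (i%:R * (2 * (m.+1 - i)%:R + w)) * (e i * phi (m.+1 - i)%N).
  rewrite [RHS]big_ord_recl /= !mul0r add0r; apply: eq_bigr => i _.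
  rewrite /bump /= add1n subSS.
  have -> : e i * ((2 * (m - i)%:R + w) * A * phi (m - i)%N) =
    (A * e i) * ((2 * (m - i)%:R + w) * phi (m - i)%N) by ring.
  by rewrite -He; ring.
have S4 : A ^+ 2 * conv (prev e) phi m =
    \sum_(i < m.+2) (i%:R * (i%:R - 1)) * (e i * phi (m.+1 - i)%N).
  rewrite mulr_sumr [RHS]big_ord_recl /= !mul0r add0r; apply: eq_bigr => i _.
  rewrite /bump /= add1n subSS -[in RHS]natr1 addrK.
  case: i => -[|i] i_m /=; first by rewrite mul0r mulr0 mulr0 mul0r.
  have -> : A ^+ 2 * (e i * phi (m - i.+1)%N) = A * (A * e i) * phi (m - i.+1)%N by ring.
  rewrite -He natr1.
  have -> : A * (i.+1%:R * e i.+1) = i.+1%:R * (A * e i.+1) by ring.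
  by rewrite -He; ring.
have S3 : \sum_(i < m.+1) e i * (B * prev phi (m - i)) = B * conv (prev e) phi m.
  by rewrite conv_prev mulr_sumr; apply: eq_bigr => i _; ring.
have E : conv e phi' m = - (\sum_(i < m.+1) e i * ((m - i).+1%:R * ((m - i)%:R + w) * phi (m - i).+1)
   + \sum_(i < m.+1) e i * ((2 * (m - i)%:R + w) * A * phi (m - i)%N)
   + \sum_(i < m.+1) e i * (B * prev phi (m - i))).
  rewrite -!big_split /= -sumrN; apply: eq_bigr => i _; rewrite phi'E; ring.
rewrite mulrBl E S1 S2 S3 S4.
have -> : m.+1%:R * (m%:R + w) * conv e phi m.+1 =
    \sum_(i < m.+2) (m.+1%:R * (m%:R + w)) * (e i * phi (m.+1 - i)%N).
  by rewrite /conv mulr_sumr.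
have alg (a b c d : F) : - (- (a + b + c) + (c - d)) = a + b + d by ring.
rewrite alg -!big_split /=; apply: eq_bigr => i _.
have le_i : (i <= m.+1)%N by rewrite -ltnS.
have -> : (m%:R : F) = m.+1%:R - 1 by rewrite -natr1 addrK.
by rewrite -{1 2}(subnKC le_i) natrD; ring.
Qed.

End Convolution.

(** * Bessel coefficients and the double series of g *)

Section BesselSeries.
Variable R : realType.
Local Notation C := R[i].
Implicit Types (tau z : C).

Definition poch (w : R) n : R := \prod_(i < n) (i%:R + w).

Lemma poch_gt0 w n : 0 < w -> 0 < poch w n.
Proof. by move=> w0; apply: prodr_gt0 => i _; rewrite ltr_wpDl. Qed.

Lemma pochS w n : poch w n.+1 = poch w n * (n%:R + w).
Proof. by rewrite /poch big_ord_recr. Qed.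

Lemma Gamma_poch w n : 0 < w -> Gamma (n%:R + w) = Gamma w * poch w n.
Proof.
move=> w0; elim: n => [|n IH]; first by rewrite add0r /poch big_ord0 mulr1.
rewrite pochS mulrA -IH -natr1 addrAC GammaS; last by rewrite ltr_wpDl.
by rewrite mulrC.
Qed.

Definition bessel_coef w n : C := (-1) ^+ n / (n`!%:R * (poch w n)%:C).

Lemma jw_coef w z : 0 < w ->
  jw (w - 1) z = csum (fun n => bessel_coef w n * z ^+ n).
Proof.
move=> w0; rewrite /jw; congr csum; apply/funext => n.
have -> : n%:R + (w - 1) + 1 = n%:R + w by rewrite addrA subrK.
rewrite subrK Gamma_poch// rmorphM /= /bessel_coef.
have G0 : (Gamma w)%:C != 0 by rewrite eq_complex /= eqxx andbT gt_eqF// Gamma_gt0.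
have P0 : (poch w n)%:C != 0 by rewrite eq_complex /= eqxx andbT gt_eqF// poch_gt0.
have N0 : (n`!%:R : C) != 0 by rewrite pnatr_eq0 -lt0n fact_gt0.
by move: G0 P0 N0; move: (Gamma w)%:C (poch w n)%:C (n`!%:R) => g p f g0 p0 f0; field; rewrite g0 p0 f0.
Qed.

Lemma poch_decay w (e : R) : 0 < w -> 0 < e ->
  exists2 K : R, 0 <= K & forall n, (poch w n)^-1 <= K * e ^+ n.
Proof.
move=> w0 e0; pose u n := (poch w n)^-1 * e ^- n.
have u0 n : 0 <= u n by rewrite mulr_ge0 ?invr_ge0 ?exprn_ge0 ?ltW ?poch_gt0.
(* Past [N], which exceeds [1 / e], each further factor [1 / (e (n + w))] is at most 1, so [u] is
   bounded by its first values. *)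
pose N := (Num.truncn e^-1).+1.
have step n : (N <= n)%N -> u n.+1 <= u n.
  move=> Nn; have en : 1 <= e * (n%:R + w).
    rewrite -ler_pdivrMl// mulr1; apply: (@le_trans _ _ N%:R).
      exact/ltW/truncnS_gt.
    by rewrite ler_wpDr ?(ltW w0)// ler_nat.
  rewrite /u pochS exprS !invfM.
  have -> : (poch w n)^-1 / (n%:R + w) * (e^-1 * e ^- n) =
     ((poch w n)^-1 * e ^- n) * (e * (n%:R + w))^-1 by rewrite invfM; ring.
  rewrite ler_piMr ?u0// invf_le1//; exact: lt_le_trans en.
exists (\sum_(i < N.+1) u i); first exact: sumr_ge0.
move=> n; rewrite -ler_pdivrMr ?exprn_gt0// -/(u n).
have small k : (k <= N)%N -> u k <= \sum_(i < N.+1) u i.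
  move=> kN; rewrite (bigD1 (inord k)) //= inordK ?ltnS//.
  by rewrite lerDl sumr_ge0.
case: (leqP n N) => [/small //|/ltnW Nn].
have /(_ (n - N)%N) : forall k, u (k + N)%N <= u N.
  elim=> [|k IH]; first by rewrite add0n.
  by apply: le_trans (step _ _) IH; exact: leq_addl.
rewrite subnK// => H; apply: le_trans H _; exact: small.
Qed.

Lemma cabs_bessel_coef w n : 0 < w ->
  cabs (bessel_coef w n) = (n`!%:R)^-1 * (poch w n)^-1.
Proof.
move=> w0; rewrite /bessel_coef cabsM cabsX cabsN cabs1 expr1n mul1r cabsV cabsM.
by rewrite cabs_nat cabs_real ger0_norm ?invfM// ltW// poch_gt0.
Qed.

(** The exponent [e] is arbitrarily small: at [pi^2 n z] the Bessel function grows more slowly than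
    any exponential in [n], and the decay of [q^n] absorbs it. *)
Lemma bessel_bound w (e : R) : 0 < w -> 0 < e -> exists2 K : R, 0 <= K &
  forall (z : C) s, uniq s ->
    \sum_(n <- s) cabs (bessel_coef w n * z ^+ n) <= K * expR (e * cabs z).
Proof.
move=> w0 e0; have [K K0 HK] := poch_decay w0 e0; exists K => // z s us.
have ez : 0 <= e * cabs z by rewrite mulr_ge0 ?cabs_ge0// ltW.
apply: le_trans (ler_wpM2l K0 (exp_term_bound ez us)).
rewrite mulr_sumr; apply: ler_sum => n _.
rewrite cabsM cabs_bessel_coef// cabsX cabs_real ger0_norm; last first.
  by rewrite divr_ge0// exprn_ge0.
rewrite exprMn.
have -> : K * (e ^+ n * cabs z ^+ n / n`!%:R) = (n`!%:R)^-1 * (K * e ^+ n) * cabs z ^+ n by ring.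
by rewrite ler_wpM2r ?exprn_ge0 ?cabs_ge0// ler_wpM2l.
Qed.

Lemma has_sum_jw w z : 0 < w ->
  has_sum (fun n => bessel_coef w n * z ^+ n) (jw (w - 1) z).
Proof.
move=> w0; rewrite jw_coef//; apply: csum_has_sum.
have [K K0 HK] := bessel_bound w0 (@ltr01 R).
by exists (K * expR (1 * cabs z)) => s us; exact: HK.
Qed.

Lemma qabs_rescale tau (Z : R) : inH tau -> 0 <= Z ->
  exists2 e : R, 0 < e & qabs tau * expR (e * Z) < 1.
Proof.
move=> h Z0; have y0 : 0 < complex.Im tau := h; have p0 := pi_gt0 R.
have Z1 : 0 < Z + 1 by lra.
have py : 0 < pi * complex.Im tau by rewrite mulr_gt0.
exists (pi * complex.Im tau / (Z + 1)); first by rewrite divr_gt0.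
rewrite /qabs -expRD -[ltRHS]expR0 ltr_expR addrC subr_lt0 mulrAC ltr_pdivrMr//.
by rewrite ltr_pM2l//; lra.
Qed.

(** One absolutely summable family indexed by the exponent [n] of q and the exponent [m] of z: its
    rows sum to the terms of [g], its columns to the iterated derivatives of [f]. *)
Lemma has_sum_g_term f c w z tau : qexp f c -> 0 < w -> inH tau ->
  exists l, has_sum (g_term c (w - 1) z tau) l /\
  has_sum (fun m => bessel_coef w m * (pi%:C ^+ 2 * z) ^+ m * qsum (iter m (@qD R) c) tau) l.
Proof.
move=> [Cc _] w0 h.
pose a (p : nat * nat) : C := c p.1 * epi p.1%:R tau *
  (bessel_coef w p.2 * (pi%:C ^+ 2 * p.1%:R * z) ^+ p.2).
pose Z := cabs (pi%:C ^+ 2 * z).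
have [e e0 He] := qabs_rescale h (cabs_ge0 (pi%:C ^+ 2 * z)).
have [K K0 HK] := bessel_bound w0 e0.
have r01 : 0 <= qabs tau * expR (e * Z) < 1.
  by rewrite He andbT mulr_ge0 ?expR_ge0// ltW// qabs_gt0.
have [M HM] := subexp_sum Cc r01.
have row n s : uniq s -> \sum_(m <- s) cabs (a (n, m)) <=
    K * (cabs (c n) * (qabs tau * expR (e * Z)) ^+ n).
  move=> us; rewrite /a /=; under eq_bigr do rewrite cabsM.
  rewrite -mulr_sumr; apply: le_trans (ler_wpM2l (cabs_ge0 _) (HK _ _ us)) _.
  rewrite cabsM cabs_epi_nat.
  have -> : cabs (pi%:C ^+ 2 * n%:R * z) = n%:R * Z.
    by rewrite -cabs_nat -cabsM /Z; congr cabs; ring.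
  have -> : expR (e * (n%:R * Z)) = expR (e * Z) ^+ n.
    by rewrite -expRM_natl; congr expR; ring.
  by rewrite exprMn le_eqVlt; apply/orP; left; apply/eqP; ring.
have A : absum a.
  apply: (@absum_prod _ _ _ _ _ (K * M)) row _ => s us.
  by rewrite -mulr_sumr ler_wpM2l// HM.
have [l Hl] := has_sum_ex A; exists l; split.
  apply: (has_sum_fubini Hl) => n.
  have -> : g_term c (w - 1) z tau n =
      c n * epi n%:R tau * jw (w - 1) (pi%:C ^+ 2 * n%:R * z) by rewrite /g_term mulrAC.
  by apply: has_sum_ext (has_sumZ _ (has_sum_jw _ w0)) => m.
have sw : bijective (fun p : nat * nat => (p.2, p.1)).
  by exists (fun p => (p.2, p.1)) => -[].
have Hl' := (has_sum_bij _ _ sw).2 Hl.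
apply: (has_sum_fubini Hl') => m.
have itD n : iter m (@qD R) c n = n%:R ^+ m * c n.
  by elim: m => [|m IH]; rewrite ?mul1r//= /qD IH exprS mulrA.
have Sm : subexp (iter m (@qD R) c).
  by elim: m {itD} => //= m; exact: subexpMn.
have [_ /(_ _ h) Hq] := qexp_qsum Sm.
apply: has_sum_ext (has_sumZ (bessel_coef w m * (pi%:C ^+ 2 * z) ^+ m) Hq) => n.
by rewrite /a /= itD !exprMn; ring.
Qed.

End BesselSeries.

(** * Splitting off the exponential factor *)

Section MainExpansion.
Variable R : realType.
Local Notation C := R[i].
Implicit Types (tau z : C).

Let A tau : C := - (2 * pi%:C ^+ 2) * pf tau.
Let A' tau : C := - (2 * pi%:C ^+ 2) * (2 * pf tau ^+ 2 - xf tau * yf tau / 8).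

Lemma hasD_A : hasD A A'.
Proof. exact: hasDZ _ (@hasD_pf_xy R). Qed.

Variables (w : R) (f : C -> C) (c : nat -> C) (phi phi' : nat -> C -> C).
Hypothesis w_gt0 : 0 < w.
Hypothesis fc : qexp f c.
Hypothesis phi0 : forall tau, inH tau -> phi 0 tau = f tau.
Hypothesis phiD : forall n, hasD (phi n) (phi' n).
(** The factor of the last term is [A^2 + pi^2 D A], where the contributions of [p^2] have
    cancelled. *)
Hypothesis phi_rec : forall n tau, inH tau ->
  n.+1%:R * (n%:R + w%:C) * phi n.+1 tau + (2 * n%:R + w%:C) * A tau * phi n tau
  + pi%:C ^+ 2 * phi' n tau
  + pi%:C ^+ 4 * (xf tau * yf tau / 4) * prev (fun n => phi n tau) n = 0.

Let e tau i : C := A tau ^+ i / i`!%:R.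
Let H m tau : C := conv (e tau) (fun n => phi n tau) m.

Let fact_neq0 (n : nat) : (n`!%:R : C) != 0.
Proof. by rewrite pnatr_eq0 -lt0n fact_gt0. Qed.

Let eS tau i : i.+1%:R * e tau i.+1 = A tau * e tau i.
Proof.
rewrite /e factS natrM exprS; field.
by rewrite fact_neq0 nat1r pnatr_eq0.
Qed.

Let hasD_e i : hasD (fun tau => e tau i) (fun tau => A' tau * prev (e tau) i).
Proof.
have := hasDZ (i`!%:R)^-1 (hasDX i hasD_A); apply: hasD_eq => t _.
  by rewrite /e mulrC.
case: i => [|i] /=; first by rewrite !(mul0r, mulr0).
by rewrite /e factS natrM; field; rewrite fact_neq0 nat1r pnatr_eq0.
Qed.

Let hasD_H m : hasD (H m) (fun tau =>
  conv (e tau) (fun n => phi' n tau) m + A' tau * conv (prev (e tau)) (fun n => phi n tau) m).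
Proof.
have := hasD_sum (index_enum 'I_m.+1) (fun i : 'I_m.+1 => hasDM (hasD_e i) (@phiD (m - i)%N)).
apply: hasD_eq => // t _.
by rewrite big_split /= addrC; congr (_ + _); rewrite mulr_sumr; apply: eq_bigr => i _; rewrite mulrA.
Qed.

Let H_rec m tau : inH tau -> m.+1%:R * (m%:R + w%:C) * H m.+1 tau =
  - (pi%:C ^+ 2 * (conv (e tau) (fun n => phi' n tau) m
     + A' tau * conv (prev (e tau)) (fun n => phi n tau) m)).
Proof.
move=> h.
have := @conv_recurrence _ (A tau) (pi%:C ^+ 4 * (xf tau * yf tau / 4)) w%:C (e tau)
  (fun n => phi n tau) (fun n => pi%:C ^+ 2 * phi' n tau) m (eS tau) (fun n => phi_rec n h).
move=> ->; congr (- _); rewrite mulrDr; congr (_ + _).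
  by rewrite /conv mulr_sumr; apply: eq_bigr => i _; rewrite mulrCA.
rewrite [RHS]mulrA; congr (_ * _); rewrite /A /A'.
by move: (pf tau) (xf tau) (yf tau) => p x y; field.
Qed.

Let w_neq0 (m : nat) : (m%:R + w%:C : C) != 0.
Proof.
rewrite -(rmorph_nat (real_complex R)) -rmorphD eq_complex /= eqxx andbT.
by rewrite gt_eqF// ltr_wpDl.
Qed.

Let H_coef m tau : inH tau ->
  H m tau = bessel_coef w m * pi%:C ^+ (2 * m) * qsum (iter m (@qD R) c) tau.
Proof.
elim: m tau => [|m IH] tau h.
  rewrite /H /conv big_ord1 /e /bessel_coef /poch big_ord0 !expr0 fact0 !divr1 !mul1r mulr1.
  by rewrite invr1 !mul1r phi0// (qexp_qsumE fc).
have Sm : subexp (iter m (@qD R) c).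
  by have [Cc _] := fc; elim: m {IH} => //= m; exact: subexpMn.
(* The formula at [m] is differentiated: [H_rec] turns the left side into a multiple of [H m.+1],
   and the right side acquires one more [qD]. *)
have := hasD_unique IH (hasD_H m) (hasDZ _ (qexp_hasD (qexp_qsum Sm))) h => E.
have nz : m.+1%:R * (m%:R + w%:C) != 0 :> C by rewrite mulf_neq0// pnatr_eq0.
apply: (mulfI nz); rewrite H_rec// E /= /bessel_coef factS natrM.
have -> : (poch w m.+1)%:C = (poch w m)%:C * (m%:R + w%:C).
  by rewrite pochS -(rmorph_nat (real_complex R)) -rmorphD -rmorphM.
rewrite mulnS exprD [(-1) ^+ m.+1]exprS.
have P0 : (poch w m)%:C != 0 by rewrite eq_complex /= eqxx andbT gt_eqF// poch_gt0.
move: (fact_neq0 m) (w_neq0 m) P0; move: (m`!%:R) (poch w m)%:C (w%:C) (qsum _ _) => g p v q g0 v0 p0.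
have m0 : (m.+1%:R : C) != 0 by rewrite pnatr_eq0.
move: m0 v0; move: (m.+1%:R) (m%:R) (pi%:C ^+ (2 * m)) => M N P m0 v0.
by field; rewrite g0 m0 v0 p0.
Qed.

(** By [H_coef] the double series sums [H m z^m]. Convolution with the exponential series of [- A z]
    recovers [phi], so the convergence of the second series is that of a Cauchy product. *)
Lemma generating_series_expansion z tau : inH tau ->
  [/\ cvgn (series (g_term c (w - 1) z tau)),
      cvgn (series (fun n => phi n tau * z ^+ n))
    & csum (g_term c (w - 1) z tau)
      = cexp (Af tau * z) * csum (fun n => phi n tau * z ^+ n)].
Proof.
move=> h; have [l [Hg Hm]] := has_sum_g_term z fc w_gt0 h.
have HH : has_sum (fun m => H m tau * z ^+ m) l.
  apply: has_sum_ext Hm => m; rewrite H_coef// exprMn exprM; ring.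
have Hphi : has_sum (fun n => phi n tau * z ^+ n) (cexp (- (A tau * z)) * l).
  apply: has_sum_ext (has_sum_cauchy (has_sum_cexp (- (A tau * z))) HH) => n.
  have -> : phi n tau = conv (fun i => (- A tau) ^+ i / i`!%:R) (fun m => H m tau) n.
    rewrite /H convA -(conv_delta (fun n => phi n tau) n).
    congr (conv _ _ _); apply/funext => i.
    have := exp_cauchy (- A tau) (A tau) i; rewrite /conv => ->.
    rewrite addNr; case: i => [|i]; first by rewrite expr0 divr1.
    by rewrite expr0n mul0r.
  rewrite /conv mulr_suml; apply: eq_bigr => i _.
  have le_i : (i <= n)%N by rewrite -ltnS.
  have -> : z ^+ n = z ^+ i * z ^+ (n - i) by rewrite -exprD subnKC.
  by rewrite -mulNr exprMn; ring.
split.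
- by apply/cvg_ex; exists l; exact: has_sum_series.
- by apply/cvg_ex; eexists; exact: has_sum_series Hphi.
- rewrite (has_sum_csum Hg) (has_sum_csum Hphi) AfE -/(A tau) mulrA -cexpD.
  by rewrite subrr cexp0 mul1r.
Qed.

End MainExpansion.

(** * Inversion on the imaginary axis *)

Section RealDerivatives.
Variable R : realType.
Implicit Types (f df : R -> R) (a b : R).

Lemma is_derive_mvt f df a b : a <= b ->
  (forall x, x \in `[a, b] -> is_derive x 1 f (df x)) ->
  exists2 c, c \in `[a, b] & f b - f a = df c * (b - a).
Proof.
move=> ab H.
have Hc : {within [set` `[a, b]], continuous f}.
  by apply: derivable_within_continuous => x /H [].
have Hd x : x \in `]a, b[ -> is_derive x 1 f (df x).
  by move=> xab; apply: H; exact: subset_itv_oo_cc xab.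
exact: (MVT_segment ab Hd Hc).
Qed.

Lemma is_derive_nincr f df a b : a <= b ->
  (forall x, x \in `[a, b] -> is_derive x 1 f (df x)) ->
  (forall x, x \in `[a, b] -> df x <= 0) -> f b <= f a.
Proof.
move=> ab H H0; have [c cab E] := is_derive_mvt ab H.
by rewrite -subr_le0 E mulr_le0_ge0 ?H0// subr_ge0.
Qed.

End RealDerivatives.

(** * Riemann sums of the Gaussian *)

Section GaussianSums.
Variable R : realType.
Local Notation mu := (@lebesgue_measure R).
Local Notation g := (@gauss_fun R).

Let I (x : R) : R := gauss_integral_proof.integral0_gauss x.

Let gauss_integrable (i : interval R) (a b : R) : [set` i] `<=` [set` `[a, b]] ->
  mu.-integrable [set` i] (EFin \o g).
Proof.
move=> sub.
have : mu.-integrable `[a, b] (EFin \o g).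
  apply: continuous_compact_integrable; first exact: segment_compact.
  by apply: continuous_subspaceT; exact: continuous_gauss_fun.
by apply: integrableS.
Qed.

Let gauss_decr (x y : R) : 0 <= x -> x <= y -> g y <= g x.
Proof.
move=> x0 xy; rewrite /gauss_fun ler_expR lerN2 ler_pXn2r ?nnegrE//.
exact: le_trans xy.
Qed.

Let I_step (x y : R) : 0 <= x -> x <= y ->
  g y * (y - x) <= I y - I x /\ I y - I x <= g x * (y - x).
Proof.
move=> x0 xy.
have iy : mu.-integrable `[0, y] (EFin \o g) by apply: (@gauss_integrable _ 0 y).
have ixy : mu.-integrable `]x, y] (EFin \o g).
  by apply: (@gauss_integrable _ x y) => t /=; rewrite !in_itv /= => /andP[/ltW -> ->].
have -> : I y - I x = \int[mu]_(t in `]x, y]) g t.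
  rewrite /I /gauss_integral_proof.integral0_gauss Rintegral_itvB//.
have ic (k : R) : mu.-integrable `]x, y] (EFin \o (fun _ => k)).
  have : mu.-integrable `[x, y] (EFin \o (fun _ : R => k)).
    by apply: integrable_derivable => t _; exact: derivable_cst.
  by apply: integrableS => // t /=; rewrite !in_itv /= => /andP[/ltW -> ->].
have intc (k : R) : \int[mu]_(t in `]x, y]) k = k * (y - x).
  rewrite Rintegral_cst//= lebesgue_measure_itv /= lte_fin.
  case: ltP => [//|yx]; rewrite (_ : y = x) ?subrr//.
  by apply/eqP; rewrite eq_le xy yx.
split.
  rewrite -intc; apply: le_Rintegral => // t /=; rewrite in_itv /= => /andP[xt ty].
  by apply: gauss_decr => //; apply: le_trans (ltW xt).
rewrite -intc; apply: le_Rintegral => // t /=; rewrite in_itv /= => /andP[xt ty].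
by apply: gauss_decr => //; exact: ltW.
Qed.

Let I_lim : I x @[x --> +oo] --> Num.sqrt pi / 2.
Proof.
have : Num.sqrt (I x ^+ 2) @[x --> +oo] --> Num.sqrt (pi / 4).
  apply: continuous_cvg => //; first exact: sqrt_continuous.
  exact: gauss_integral_proof.cvg_integral0_gauss_sqr.
rewrite sqrtrM ?pi_ge0// sqrtrV// (_ : 4 = 2 ^+ 2); last by rewrite expr2 -natrM.
rewrite sqrtr_sqr ger0_norm// (_ : (fun _ => Num.sqrt _) = I)//.
apply/funext => r; rewrite sqrtr_sqr ger0_norm//.
exact: gauss_integral_proof.integral0_gauss_ge0.
Qed.

Let I_le (x : R) : 0 <= x -> I x <= Num.sqrt pi / 2.
Proof.
move=> x0; rewrite -(cvg_lim (@Rhausdorff R) I_lim).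
apply: limr_ge; first by apply/cvg_ex; eexists; exact: I_lim.
near=> y; have xy : x <= y by near: y; apply: nbhs_pinfty_ge; exact: num_real.
have [H _] := I_step x0 xy; rewrite -subr_ge0; apply: le_trans H.
by rewrite mulr_ge0 ?expR_ge0// subr_ge0.
Unshelve. all: by end_near. Qed.

Let I0 : I 0 = 0.
Proof. by rewrite /I /gauss_integral_proof.integral0_gauss set_itv1 Rintegral_set1. Qed.

(** The Gaussian decreases on the half-line, so values at right endpoints stay below the integral;
    values at left endpoints, in the next lemma, stay above it. *)
Lemma gauss_sum_upper (h : R) N : 0 < h ->
  \sum_(n < N) g (n.+1%:R * h) <= Num.sqrt pi / 2 / h.
Proof.
move=> h0; rewrite ler_pdivlMr//.
have nh (n : nat) : 0 <= n%:R * h by rewrite mulr_ge0// ltW.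
apply: le_trans (I_le (nh N)).
elim: N => [|N IH]; first by rewrite big_ord0 mul0r I0.
rewrite big_ord_recr /= mulrDl -[leRHS](subrKC (I (N%:R * h))); apply: lerD => //.
have [|H _] := I_step (nh N) (_ : N%:R * h <= N.+1%:R * h).
  by rewrite ler_wpM2r ?ler_nat// ltW.
apply: le_trans H; rewrite -natr1; lra.
Qed.

Lemma gauss_sum_lower (h e : R) : 0 < h -> 0 < e ->
  exists N, Num.sqrt pi / 2 / h - e <= \sum_(n < N) g (n%:R * h).
Proof.
move=> h0 e0.
have nh (n : nat) : 0 <= n%:R * h by rewrite mulr_ge0// ltW.
have IN N : I (N%:R * h) <= (\sum_(n < N) g (n%:R * h)) * h.
  elim: N => [|N IH]; first by rewrite big_ord0 mul0r I0.
  rewrite big_ord_recr /= mulrDl -[leLHS](subrKC (I (N%:R * h))); apply: lerD => //.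
  have [|_ H] := I_step (nh N) (_ : N%:R * h <= N.+1%:R * h).
    by rewrite ler_wpM2r ?ler_nat// ltW.
  apply: le_trans H _; rewrite -natr1; lra.
have eh : 0 < e * h by rewrite mulr_gt0.
move/cvgrPdist_le: I_lim => /(_ _ eh)[M [_ HM]].
pose N := (Num.truncn (`|M| / h)).+1.
have MN : M < N%:R * h.
  apply: le_lt_trans (ler_norm M) _; rewrite -ltr_pdivrMr//; exact: truncnS_gt.
exists N; rewrite lerBlDr ler_pdivrMr// mulrDl.
have := HM _ MN; have := IN N; have := ler_norm (Num.sqrt pi / 2 - I (N%:R * h)).
lra.
Qed.

End GaussianSums.

(** * Theta values on the imaginary axis *)

Section ImaginaryAxis.
Variable R : realType.
Local Notation C := R[i].
Implicit Types (s t : R).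

Definition iax s : C := 0 +i* s.

Lemma inH_iax s : 0 < s -> inH (iax s). Proof. by []. Qed.

Lemma iaxE s : iax s = 0 + s%:C * 'i.
Proof. by rewrite add0r; apply/eqP; rewrite eq_complex /=; apply/andP; split; apply/eqP; ring. Qed.

Lemma iax2 s : 2 * iax s = iax (2 * s).
Proof. by rewrite !iaxE !add0r rmorphM rmorph_nat mulrA. Qed.

Lemma epi_iax (x s : R) : epi x%:C (iax s) = (expR (- (pi * x * s)))%:C.
Proof.
rewrite /epi -cexp_real; congr cexp; rewrite iaxE add0r !(rmorphM, rmorphN) /=.
have -> : pi%:C * 'i * x%:C * (s%:C * 'i) = ('i * 'i) * (pi%:C * x%:C * s%:C) :> C by ring.
by rewrite -expr2 sqr_i mulN1r.
Qed.

Lemma has_sum_Re (I : eqType) (b : I -> R) (l : C) :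
  has_sum (fun i => (b i)%:C) l -> l = (complex.Re l)%:C.
Proof.
move=> [_ H]; apply/eqP; rewrite eq_complex eqxx /=; apply/eqP.
apply: complexI; apply: cabs_eps_eq0 => e /H[s us /(_ s us (fun _ => id))].
rewrite -rmorph_sum /= => Hs; rewrite cabs_real; apply: le_lt_trans Hs.
have -> : complex.Im l = - complex.Im ((\sum_(i <- s) b i)%:C - l).
  by rewrite raddfB /= sub0r opprK.
by rewrite normrN cabs_Im.
Qed.

Lemma has_sum_Re_ge (I : eqType) (b : I -> R) (l : C) (s : seq I) :
  (forall i, 0 <= b i) -> uniq s ->
  has_sum (fun i => (b i)%:C) l -> \sum_(i <- s) b i <= complex.Re l.
Proof.
move=> b0 us [_ H]; apply/ler_addgt0Pr => e e0.
have [s0 us0 {}H] := H e e0; have [t ut [h0 h1]] := uniq_join s0 s.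
have := H t ut h0; rewrite -rmorph_sum /= => Ht.
have := le_lt_trans (cabs_Re _) Ht; rewrite raddfB /=.
have := ler_norm (\sum_(i <- t) b i - complex.Re l).
have := ler_sum_subset us ut h1 b0; lra.
Qed.

Lemma has_sum_theta_iax s : 0 < s ->
  has_sum (fun n : int => (expR (- (pi * (`|n| ^ 2)%N%:R * s)))%:C) (theta (iax s)).
Proof.
move=> s0; apply: has_sum_ext (has_sum_theta (inH_iax s0)) => n.
by rewrite intr_sqr -(rmorph_nat (real_complex R)) epi_iax.
Qed.

Definition t3 s := complex.Re (theta (iax s)).
Definition t4 s := complex.Re (theta4 (iax s)).
Definition t2 s := complex.Re (theta_half (iax s)).

Lemma theta_iax s : 0 < s -> theta (iax s) = (t3 s)%:C.
Proof. by move=> /has_sum_theta_iax /has_sum_Re. Qed.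

Lemma theta_half_iax s : 0 < s -> theta_half (iax s) = (t2 s)%:C.
Proof.
move=> s0; pose b (n : int) := expR (- (pi * ((pronic n)%:R + 4^-1) * s)).
apply: (@has_sum_Re _ b).
apply: has_sum_ext (has_sum_theta_half (inH_iax s0)) => n.
have -> : ((n%:~R : C) + 2^-1) ^+ 2 = ((pronic n)%:R + 4^-1 : R)%:C.
  by rewrite intr_half_sqr rmorphD fmorphV !rmorph_nat.
by rewrite epi_iax.
Qed.

Lemma theta4_iax s : 0 < s -> theta4 (iax s) = (t4 s)%:C.
Proof.
move=> s0; pose b (n : int) := (-1) ^ n * expR (- (pi * (`|n| ^ 2)%N%:R * s)).
apply: (@has_sum_Re _ b).
apply: has_sum_ext (has_sum_theta4 (inH_iax s0)) => n.
rewrite intr_sqr -(rmorph_nat (real_complex R)) epi_iax /b.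
have -> (X : R) : ((-1) ^ n * X)%:C = ((-1) ^ n)%:C * X%:C by rewrite rmorphM.
by rewrite (fmorphXz (real_complex R)) rmorphN1.
Qed.

Lemma t3_ge1 s : 0 < s -> 1 <= t3 s.
Proof.
move=> s0.
have := has_sum_Re_ge (s := [:: 0]) (fun n => expR_ge0 _) isT (has_sum_theta_iax s0).
by rewrite big_seq1 absz0 exp0n // mulr0 mul0r oppr0 expR0.
Qed.

Lemma t4_neq0 s : 0 < s -> t4 s != 0.
Proof.
move=> s0; have := theta4_neq0 (inH_iax s0); rewrite theta4_iax//.
by rewrite eq_complex /= eqxx andbT.
Qed.

Lemma t2_neq0 s : 0 < s -> t2 s != 0.
Proof.
move=> s0; have := theta_half_neq0 (inH_iax s0); rewrite theta_half_iax//.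
by rewrite eq_complex /= eqxx andbT.
Qed.

(** The doubling formulas act on squares, and one doubling of [s] is one arithmetic-geometric step
    from [agmA], [agmB]. Squares are also positive whatever the signs of the theta values. *)
Definition agmA s := t3 s ^+ 2.
Definition agmB s := t4 s ^+ 2.
Definition agmC s := t2 s ^+ 2.

Lemma agmA_ge1 s : 0 < s -> 1 <= agmA s.
Proof. by move=> /t3_ge1 h; rewrite exprn_ege1. Qed.

Lemma agmA_gt0 s : 0 < s -> 0 < agmA s.
Proof. by move=> /agmA_ge1; apply: lt_le_trans. Qed.

Lemma agmB_gt0 s : 0 < s -> 0 < agmB s.
Proof. by move=> s0; rewrite exprn_even_gt0 //= t4_neq0. Qed.

Lemma agmC_gt0 s : 0 < s -> 0 < agmC s.
Proof. by move=> s0; rewrite exprn_even_gt0 //= t2_neq0. Qed.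

Lemma agmA_double s : 0 < s -> agmA (2 * s) = (agmA s + agmB s) / 2.
Proof.
move=> s0; have s20 : 0 < 2 * s by rewrite mulr_gt0.
have := theta_sqrD (inH_iax s0); rewrite iax2 !theta_iax// theta4_iax//.
rewrite -!rmorphXn -rmorphD -(rmorph_nat (real_complex R)) -rmorphM => /complexI.
by rewrite /agmA /agmB => ->; field.
Qed.

Lemma agmC_double s : 0 < s -> agmC (2 * s) = (agmA s - agmB s) / 2.
Proof.
move=> s0; have s20 : 0 < 2 * s by rewrite mulr_gt0.
have := theta_sqrB (inH_iax s0); rewrite iax2 theta_iax// theta4_iax// theta_half_iax//.
rewrite -!rmorphXn -rmorphB -(rmorph_nat (real_complex R)) -rmorphM => /complexI.
by rewrite /agmA /agmB /agmC => ->; field.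
Qed.

Lemma agmB_double s : 0 < s -> agmB (2 * s) ^+ 2 = agmA s * agmB s.
Proof.
move=> s0; have s20 : 0 < 2 * s by rewrite mulr_gt0.
have := theta_theta4 (inH_iax s0); rewrite iax2 theta_iax// !theta4_iax//.
rewrite -!rmorphXn -rmorphM => /complexI.
by rewrite /agmA /agmB -exprMn => ->.
Qed.

Lemma agmC_sqr s : 0 < s -> agmC s ^+ 2 = 4 * agmC (2 * s) * agmA (2 * s).
Proof.
move=> s0; have s20 : 0 < 2 * s by rewrite mulr_gt0.
have := theta_half_pow4 (inH_iax s0); rewrite iax2 !theta_iax// !theta_half_iax//.
rewrite -!rmorphXn -(rmorph_nat (real_complex R)) -!rmorphM => /complexI.
by rewrite /agmA /agmC -exprM => ->.
Qed.

Lemma agm_jacobi s : 0 < s -> agmA s ^+ 2 = agmB s ^+ 2 + agmC s ^+ 2.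
Proof.
move=> s0; have := theta_jacobi (inH_iax s0).
rewrite theta_iax// theta4_iax// theta_half_iax//.
by rewrite -!rmorphXn -rmorphD => /complexI; rewrite /agmA /agmB /agmC -!exprM.
Qed.

Lemma agmA_lim s : 0 < s -> (fun n => agmA (2 ^+ n * s)) @ \oo --> (1 : R).
Proof.
move=> s0.
have [c Q [c0 _]] := qexp_theta R; have L := limIX 2 (qexp_lim0 Q).
rewrite c0 expr1n in L.
apply/cvgrPdist_lt => e e0; have [Y HY] := L e e0.
have [k0 Hk] := pow2_large Y (inH_iax s0); exists k0 => // n /= kn.
have E : 2 ^+ n * iax s = iax (2 ^+ n * s).
  by rewrite !iaxE !add0r rmorphM rmorphXn rmorph_nat mulrA.
have := HY _ (Hk n kn); rewrite E theta_iax; last by rewrite mulr_gt0// exprn_gt0.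
by rewrite -rmorphXn -(rmorph1 (real_complex R)) -rmorphB cabs_real distrC.
Qed.

(** The theta series is a Riemann sum of step [sqrt (pi s)]. The error 1 does not depend on [s],
    hence is negligible against [1 / sqrt s] as [s] tends to 0. *)
Lemma t3_gauss s : 0 < s ->
  (Num.sqrt s)^-1 - 1 <= t3 s /\ t3 s <= (Num.sqrt s)^-1 + 1.
Proof.
move=> s0; have p0 := pi_gt0 R.
pose h := Num.sqrt (pi * s).
have h0 : 0 < h by rewrite sqrtr_gt0 mulr_gt0.
have hE : Num.sqrt pi / 2 / h = (Num.sqrt s)^-1 / 2.
  rewrite /h sqrtrM ?(ltW p0)//.
  have : Num.sqrt pi != 0 :> R by rewrite gt_eqF// sqrtr_gt0.
  have : Num.sqrt s != 0 by rewrite gt_eqF// sqrtr_gt0.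
  by move: (Num.sqrt pi) (Num.sqrt s) => x y x0 y0; field; rewrite x0 y0.
have gE (n : nat) : gauss_fun (n%:R * h) = expR (- (pi * (n ^ 2)%N%:R * s)).
  rewrite /gauss_fun exprMn sqr_sqrtr ?mulr_ge0 ?(ltW p0) ?(ltW s0)// natrX.
  by congr expR; ring.
pose G (n : nat) : R := gauss_fun (n%:R * h).
have A := has_sum_absum (has_sum_theta_iax s0).
have HP : has_sum (fun n : nat => (G n)%:C) (csum (fun n : nat => (G n)%:C)).
  apply: csum_has_sum; have := absum_inj (h := Posz) _ A.
  move=> /(_ (fun m n => _)) H; apply: absum_le (H _) => [n /=|m n [] //].
  by rewrite /G gE.
have HN : has_sum (fun n : nat => (G n.+1)%:C) (csum (fun n : nat => (G n)%:C) - 1).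
  have := has_sum_shift 1 HP; rewrite big_ord1 /G mul0r /gauss_fun expr0n oppr0 expR0.
  by apply: has_sum_ext => n; rewrite addn1.
have E : theta (iax s) = csum (fun n : nat => (G n)%:C) + (csum (fun n : nat => (G n)%:C) - 1).
  apply: has_sum_unique (has_sum_theta_iax s0) _.
  pose a (n : int) : C := (expR (- (pi * (`|n| ^ 2)%N%:R * s)))%:C.
  have := zsum_has_sum A; rewrite /zsum.
  have -> : csum (fun n => a (Posz n)) = csum (fun n : nat => (G n)%:C).
    by congr csum; apply/funext => n; rewrite /a /G gE.
  have -> : csum (fun n => a (Negz n)) = csum (fun n : nat => (G n)%:C) - 1.
    rewrite -(has_sum_csum HN); congr csum; apply/funext => n; rewrite /a /G gE.
    by rewrite NegzE abszN.
  by [].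
set S := csum _ in E HP HN.
have SR := has_sum_Re HP.
have t3E : t3 s = 2 * complex.Re S - 1.
  by rewrite /t3 E raddfD raddfB /=; lra.
have G0 n : 0 <= G n by exact: gauss_fun_ge0.
have up : complex.Re S - 1 <= (Num.sqrt s)^-1 / 2.
  rewrite -hE; apply/ler_addgt0Pr => e e0.
  have [_ /(_ e e0)[s1 us1 H]] := HN.
  pose N := (\max_(i <- s1) i).+1.
  have /H : uniq (iota 0 N) by exact: iota_uniq.
  have sub : {subset s1 <= iota 0 N}.
    by move=> i i1; rewrite mem_iota ltnS; apply: (leq_bigmax_seq (F := id)).
  move=> /(_ sub); rewrite -rmorph_sum => Hl.
  have := gauss_sum_upper N h0.
  rewrite -(big_mkord xpredT (fun n => gauss_fun (n.+1%:R * h))) /index_iota subn0.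
  change (\sum_(i <- iota 0 N) G i.+1 <= Num.sqrt pi / 2 / h ->
    complex.Re S - 1 <= Num.sqrt pi / 2 / h + e).
  move: Hl; set X := \sum_(i <- _) _ => Hl.
  have Hr : `|X - (complex.Re S - 1)| < e.
    have <- (z : C) : complex.Re (X%:C - (z - 1)) = X - (complex.Re z - 1) by case: z.
    exact: le_lt_trans (cabs_Re _) Hl.
  have := ler_norm (- (X - (complex.Re S - 1))); rewrite normrN => ? ?; lra.
have low : (Num.sqrt s)^-1 / 2 <= complex.Re S.
  rewrite -hE; apply/ler_addgt0Pr => e e0.
  have [N HN'] := gauss_sum_lower h0 e0.
  have := has_sum_Re_ge G0 (iota_uniq 0 N) HP.
  rewrite -lerBlDr; apply: le_trans; apply: le_trans HN' _.
  by rewrite -(big_mkord xpredT (fun n => gauss_fun (n%:R * h))) /index_iota subn0.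
by rewrite t3E; split; lra.
Qed.

End ImaginaryAxis.

(** * Arithmetic-geometric iterations of limit 1 *)

Section AgmComparison.
Variable R : realType.
Implicit Types (u v : nat -> R).

(** The geometric mean enters through its square, which avoids roots; positivity determines it. *)
Definition is_agm u v := [/\ (forall n, 0 < u n), (forall n, 0 < v n),
  (forall n, u n.+1 = (u n + v n) / 2), (forall n, v n.+1 ^+ 2 = u n * v n)
  & u @ \oo --> (1 : R)].

(** Scaled by [r = u'_0 / u_0], the first iteration starts below the second in both entries and
    stays there; in the limit [r <= 1]. *)
Lemma is_agm_ratio_le u v u' v' : is_agm u v -> is_agm u' v' ->
  v 0%N * u' 0%N <= v' 0%N * u 0%N -> u' 0%N <= u 0%N.
Proof.
move=> [u0 v0 uS vS lu] [u'0 v'0 u'S v'S lu'] E.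
pose r := u' 0%N / u 0%N.
have r0 : 0 < r by rewrite divr_gt0.
have key n : r * u n <= u' n /\ r * v n <= v' n.
  elim: n => [|n [IHu IHv]].
    rewrite /r divfK ?gt_eqF//; split => //.
    by rewrite mulrAC ler_pdivrMr// mulrC.
  split.
    rewrite u'S uS mulrA ler_pM2r ?invr_gt0// mulrDr; exact: lerD.
  have rv : 0 <= r * v n.+1 by exact: mulr_ge0 (ltW r0) (ltW (v0 _)).
  rewrite -(@ler_pXn2r _ 2)// ?nnegrE ?(ltW (v'0 _))//.
  rewrite v'S exprMn vS expr2 mulrACA.
  by apply: ler_pM => //; [exact: mulr_ge0 (ltW r0) (ltW (u0 _))|exact: mulr_ge0 (ltW r0) (ltW (v0 _))].
have lr : (fun n => r * u n) @ \oo --> r * 1 by apply: cvgM => //; exact: cvg_cst.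
have r1 : r <= 1.
  rewrite -[r]mulr1 -(cvg_lim (@Rhausdorff R) lr) -(cvg_lim (@Rhausdorff R) lu').
  apply: ler_lim; [by apply/cvg_ex; eexists; exact: lr|by apply/cvg_ex; eexists; exact: lu'|].
  by near=> m; case: (key m).
by move: r1; rewrite ler_pdivrMr// mul1r.
Unshelve. all: by end_near. Qed.

Lemma is_agm_shift u v : is_agm u v -> is_agm (fun n => u n.+1) (fun n => v n.+1).
Proof.
move=> [u0 v0 uS vS lu]; split=> [n|n|n|n|]; try by [].
by rewrite cvg_shiftS.
Qed.

(** The weak comparison is applied after one step, where it compares the means: [a' + b' <= a + b].
    If [a <= a'], then [b' <= b], against the strict inequality of ratios. *)
Lemma is_agm_ratio_lt u v u' v' : is_agm u v -> is_agm u' v' -> v' 0%N <= u' 0%N ->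
  v 0%N * u' 0%N < v' 0%N * u 0%N -> u' 0%N < u 0%N.
Proof.
move=> A A' le' E; have B := is_agm_shift A; have B' := is_agm_shift A'.
have [u0 v0 uS vS _] := A; have [u'0 v'0 u'S v'S _] := A'.
have := is_agm_ratio_le B B'.
move: (u0 0%N) (v0 0%N) (u'0 0%N) (v'0 0%N) (v0 1%N) (v'0 1%N).
move: (uS 0%N) (u'S 0%N) (vS 0%N) (v'S 0%N) E le'.
move: (u 0%N) (v 0%N) (u' 0%N) (v' 0%N) (u 1%N) (v 1%N) (u' 1%N) (v' 1%N).
move=> a b a' b' a1 b1 a1' b1' -> -> hb hb' E le' a0 b0 a'0 b'0 b10 b1'0 H.
have {H}: (a' + b') / 2 <= (a + b) / 2.
  have p1 : 0 <= b1 * ((a' + b') / 2) by rewrite mulr_ge0 ?divr_ge0 ?addr_ge0 ?ltW.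
  have p2 : 0 <= b1' * ((a + b) / 2) by rewrite mulr_ge0 ?divr_ge0 ?addr_ge0 ?ltW.
  apply: H; rewrite -(@ler_pXn2r _ 2)// ?nnegrE//.
  rewrite !exprMn hb hb' -subr_ge0.
  (* The order of the ratios survives the step: the difference of squares factors, and both factors
     are nonnegative because the second entries do not exceed the first. *)
  have -> : a' * b' * ((a + b) ^+ 2 * 2^-1 ^+ 2) - a * b * ((a' + b') ^+ 2 * 2^-1 ^+ 2)
      = (b' * a - b * a') * (a * a' - b * b') / 4.
    by field.
  have ba : b < a by nra.
  have p3 : 0 <= b' * a - b * a' by rewrite subr_ge0 ltW.
  have p4 : 0 <= a * a' - b * b' by rewrite subr_ge0; apply: ler_pM => //; exact: ltW.
  by rewrite divr_ge0// mulr_ge0.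
move=> H; rewrite ltNge; apply/negP => aa'.
by nra.
Qed.

Definition unit_agm (a b : R) :=
  exists u v, [/\ is_agm u v, u 0%N = a & v 0%N = b].

Lemma agm_ratio_le (a b a' b' : R) : unit_agm a b -> unit_agm a' b' ->
  b * a' <= b' * a -> a' <= a.
Proof. by move=> [u [v [A <- <-]]] [u' [v' [A' <- <-]]]; exact: is_agm_ratio_le. Qed.

Lemma agm_ratio_lt (a b a' b' : R) : unit_agm a b -> unit_agm a' b' ->
  b' <= a' -> b * a' < b' * a -> a' < a.
Proof. by move=> [u [v [A <- <-]]] [u' [v' [A' <- <-]]]; exact: is_agm_ratio_lt. Qed.

End AgmComparison.

Section AxisInversion.
Variable R : realType.
Implicit Types s : R.

Lemma agmBC_le_agmA s : 0 < s -> agmB s <= agmA s /\ agmC s <= agmA s.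
Proof.
move=> s0; have := agm_jacobi s0; have := agmA_gt0 s0; have := agmB_gt0 s0.
have := agmC_gt0 s0; move: (agmA s) (agmB s) (agmC s) => a b c c0 b0 a0 E.
have sq x : 0 < x -> x ^+ 2 <= a ^+ 2 -> x <= a by move=> x0; rewrite ler_pXn2r// nnegrE ltW.
by split; apply: sq => //; rewrite E ?lerDl ?lerDr sqr_ge0.
Qed.

Lemma agm_axis s : 0 < s -> unit_agm (agmA s) (agmB s).
Proof.
move=> s0; exists (fun n => agmA (2 ^+ n * s)), (fun n => agmB (2 ^+ n * s)).
have E0 : 2 ^+ 0 * s = s by rewrite mul1r.
split; rewrite ?E0//.
have h n : 0 < 2 ^+ n * s by rewrite mulr_gt0// exprn_gt0.
have E n : 2 ^+ n.+1 * s = 2 * (2 ^+ n * s) by rewrite exprS mulrA.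
split=> [n|n|n|n|]; [exact: agmA_gt0|exact: agmB_gt0|..|exact: agmA_lim].
  by rewrite E; exact: agmA_double.
by rewrite E; exact: agmB_double.
Qed.

Lemma agm_axis_dual_lim s : 0 < s ->
  (fun n => agmA (2 ^+ n * s)^-1 / (2 ^+ n * s)) @ \oo --> (1 : R).
Proof.
move=> s0; have h n : 0 < 2 ^+ n * s by rewrite mulr_gt0// exprn_gt0.
(* [e] is the reciprocal of the expected size of [t3] at [1 / (2^n s)]; [t3_gauss] becomes
   [1 - e <= t3 e <= 1 + e]. *)
pose e n : R := Num.sqrt (2 ^+ n * s)^-1.
have e0 n : 0 < e n by rewrite sqrtr_gt0 invr_gt0.
have E n : agmA (2 ^+ n * s)^-1 / (2 ^+ n * s) = (t3 (2 ^+ n * s)^-1 * e n) ^+ 2.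
  by rewrite exprMn sqr_sqrtr// invr_ge0 ltW.
have le : e @ \oo --> (0 : R).
  have E2 n : e n ^+ 2 = s^-1 * 2^-1 ^+ n.
    by rewrite sqr_sqrtr ?invr_ge0 ?ltW// invfM exprVn mulrC.
  have L : (fun n => s^-1 * 2^-1 ^+ n) @ \oo --> s^-1 * 0.
    by apply: cvgM; [exact: cvg_cst|apply: cvg_expr; rewrite ger0_norm ?invr_ge0// invf_lt1// ltr1n].
  rewrite mulr0 in L.
  apply/cvgrPdist_lt => d d0; have d2 : 0 < d ^+ 2 by rewrite exprn_gt0.
  move/cvgrPdist_lt: L => /(_ _ d2) [N _ HN]; exists N => // n /HN.
  rewrite -E2 !sub0r !normrN ger0_norm ?sqr_ge0// ger0_norm ?(ltW (e0 n))//.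
  by rewrite ltr_pXn2r// nnegrE ltW.
have l3 : (fun n => t3 (2 ^+ n * s)^-1 * e n) @ \oo --> (1 : R).
  apply: (@squeeze_cvgr _ _ _ _ (fun n => 1 - e n) (fun n => 1 + e n)).
  - near=> n; have hn : 0 < (2 ^+ n * s)^-1 by rewrite invr_gt0.
    have [] := t3_gauss hn; rewrite -/(e n) => lo up.
    have V : (e n)^-1 * e n = 1 by rewrite mulVf// gt_eqF.
    have := ler_wpM2r (ltW (e0 n)) lo; have := ler_wpM2r (ltW (e0 n)) up.
    by rewrite !mulrDl V mulN1r mul1r => -> ->.
  - by rewrite -[X in _ --> X]subr0; apply: cvgB => //; exact: cvg_cst.
  - by rewrite -[X in _ --> X]addr0; apply: cvgD => //; exact: cvg_cst.
rewrite (_ : (fun n => _) = (fun n => (t3 (2 ^+ n * s)^-1 * e n) ^+ 2)); last exact/funext.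
have H : (fun n => (t3 (2 ^+ n * s)^-1 * e n) * (t3 (2 ^+ n * s)^-1 * e n)) @ \oo --> (1 * 1 : R).
  exact: cvgM.
by move: H; rewrite mulr1.
Unshelve. all: by end_near. Qed.

(* As s doubles, the means at 1/s run through the descending Landen step, which
   is again an arithmetic-geometric step after division by s. *)
Lemma agm_axis_dual s : 0 < s -> unit_agm (agmA s^-1 / s) (agmC s^-1 / s).
Proof.
move=> s0; exists (fun n => agmA (2 ^+ n * s)^-1 / (2 ^+ n * s)).
exists (fun n => agmC (2 ^+ n * s)^-1 / (2 ^+ n * s)).
have E0 : 2 ^+ 0 * s = s by rewrite mul1r.
split; rewrite ?E0//.
have h n : 0 < 2 ^+ n * s by rewrite mulr_gt0// exprn_gt0.
have half n : (2 ^+ n * s)^-1 = 2 * (2 ^+ n.+1 * s)^-1.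
  by rewrite exprS -mulrA [in RHS]invfM mulVKf.
have h' n : 0 < (2 ^+ n * s)^-1 by rewrite invr_gt0.
split=> [n|n|n|n|].
- by rewrite mulr_gt0// agmA_gt0.
- by rewrite mulr_gt0// agmC_gt0.
- have := agmA_double (h' n.+1); have := agmC_double (h' n.+1).
  rewrite -half exprS -mulrA; set t := 2 ^+ n * s => -> ->.
  have t0 : t != 0 by rewrite gt_eqF// h.
  move: (agmA _) (agmB _) => a b.
  by field.
- have := agmC_sqr (h' n.+1).
  rewrite -half (_ : 2 ^+ n.+1 * s = 2 * (2 ^+ n * s)); last by rewrite exprS mulrA.
  set t := 2 ^+ n * s => H.
  rewrite [LHS]exprMn H.
  have t0 : t != 0 by rewrite gt_eqF// h.
  move: (agmA _) (agmC _) => a b.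
  by field.
exact: agm_axis_dual_lim.
Qed.

(* Equality of r s := agmB s / agmA s and r' s^-1 := agmC s^-1 / agmA s^-1: since
   agmA s is a decreasing function of r s, and s * agmA s the same function of
   r' s, a strict inequality between them is contradictory at s and 1/s. *)
Lemma agm_ratio_inv s : 0 < s ->
  agmB s * agmA s^-1 = agmC s^-1 * agmA s.
Proof.
move=> s0; have i0 : 0 < s^-1 by rewrite invr_gt0.
have p := (agmA_gt0 s0, agmB_gt0 s0, agmC_gt0 s0, agmA_gt0 i0, agmB_gt0 i0, agmC_gt0 i0).
have [BA CA] := agmBC_le_agmA s0; have [BA' CA'] := agmBC_le_agmA i0.
(* By Jacobi's identity the squared ratios of [agmB] and [agmC] to [agmA] add up to 1. Passing to
   complements carries a strict inequality at [s] to the corresponding one at [1/s]. *)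
have cross : ((agmB s * agmA s^-1 < agmC s^-1 * agmA s) =
              (agmB s^-1 * agmA s < agmC s * agmA s^-1)) *
             ((agmC s^-1 * agmA s < agmB s * agmA s^-1) =
              (agmC s * agmA s^-1 < agmB s^-1 * agmA s)).
  have := agm_jacobi s0; have := agm_jacobi i0; move: p.
  move: (agmA s) (agmB s) (agmC s) (agmA s^-1) (agmB s^-1) (agmC s^-1).
  move=> a b c a' b' c' p E1 E2.
  have sq (x y : R) : 0 < x -> 0 < y -> (x < y) = (x ^+ 2 < y ^+ 2).
    by move=> x0 y0; rewrite ltr_pXn2r// nnegrE ltW.
  rewrite (sq (b * a')) ?(sq (c' * a)) ?(sq (b' * a)) ?(sq (c * a')); try by rewrite mulr_gt0// p.
  rewrite !exprMn E1 E2; move: (b ^+ 2) (c ^+ 2) (b' ^+ 2) (c' ^+ 2) => x y x' y'.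
  by split; apply/idP/idP; nra.
apply/eqP; rewrite eq_le; apply/andP; split; rewrite leNgt; apply/negP => H.
(* The comparisons at [s] and at [1/s] yield [s agmA s < agmA (1/s)] and its strict converse. *)
- have H1 : agmA s < agmA s^-1 / s.
    apply: agm_ratio_lt (agm_axis_dual s0) (agm_axis s0) BA _.
    by rewrite mulrAC mulrA ltr_pM2r// invr_gt0.
  have H2 : agmA s^-1 < agmA s * s.
    have := agm_ratio_lt (agm_axis_dual i0) (agm_axis i0) BA'.
    by rewrite invrK; apply; rewrite mulrAC mulrA ltr_pM2r// -cross.
  by move: H1; rewrite ltr_pdivlMr// ltNge (ltW H2).
- have H1 : agmA s^-1 / s < agmA s.
    apply: agm_ratio_lt (agm_axis s0) (agm_axis_dual s0) _ _.
      by rewrite ler_pM2r.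
    by rewrite mulrA [ltRHS]mulrAC ltr_pM2r.
  have H2 : agmA s * s < agmA s^-1.
    have := agm_ratio_lt (agm_axis i0) (agm_axis_dual i0).
    rewrite invrK; apply; first by rewrite ler_pM2r.
    by rewrite mulrA [ltRHS]mulrAC ltr_pM2r// -cross.
  by move: H1; rewrite ltr_pdivrMr// ltNge (ltW H2).
Qed.

Lemma agmA_inv s : 0 < s -> agmA s^-1 = s * agmA s.
Proof.
move=> s0.
have E : agmB s * (agmA s^-1 / s) = agmC s^-1 / s * agmA s.
  by rewrite mulrA agm_ratio_inv// mulrAC.
have := agm_ratio_le (agm_axis s0) (agm_axis_dual s0).
have := agm_ratio_le (agm_axis_dual s0) (agm_axis s0).
rewrite E lexx => /(_ isT) H1 /(_ isT) H2.
have -> : agmA s = agmA s^-1 / s by apply/eqP; rewrite eq_le H1.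
by rewrite mulrC divfK// gt_eqF.
Qed.

Lemma agmC_inv s : 0 < s -> agmC s^-1 = s * agmB s.
Proof.
move=> s0; have a0 := agmA_gt0 s0.
have := agm_ratio_inv s0; rewrite agmA_inv// mulrA => /mulIf H.
by rewrite -H ?gt_eqF// mulrC.
Qed.

End AxisInversion.

(** * Inversion on the half-plane *)

Section LinearODE.
Variable R : realType.
Local Notation C := R[i].
Implicit Types (f g : C -> C) (z v : C).

(** A complex derivative is determined along a single real direction, so an identity known only on
    the imaginary axis can be differentiated. *)
Lemma cderiv_line_unique f g z v d d' (r : R) : v != 0 -> 0 < r ->
  cderiv f z d -> cderiv g z d' ->
  (forall t : R, `|t| < r -> f (z + t%:C * v) = g (z + t%:C * v)) -> d = d'.
Proof.
move=> v0 r0 [p [E P <-]] [q [F Q <-]] H.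
have fg : f z = g z by have := H 0; rewrite normr0 mul0r addr0; apply.
apply/eqP; rewrite -subr_eq0; apply/eqP; apply: cabs_eps_eq0 => e e0.
have e2 : 0 < e / 2 by rewrite divr_gt0.
have [d1 d10 {}P] := P _ e2; have [d2 d20 {}Q] := Q _ e2.
have V : 0 < cabs v + 1 by rewrite ltr_wpDl ?cabs_ge0.
pose t := Num.min r (Num.min d1 d2 / (cabs v + 1)) / 2.
have m0 : 0 < Num.min d1 d2 / (cabs v + 1) by rewrite divr_gt0// lt_min d10.
have t0 : 0 < t by rewrite divr_gt0// lt_min r0.
have tr : t < r.
  have : Num.min r (Num.min d1 d2 / (cabs v + 1)) <= r by rewrite ge_min lexx.
  rewrite /t; lra.
have td : t * cabs v < Num.min d1 d2.
  have : Num.min r (Num.min d1 d2 / (cabs v + 1)) <= Num.min d1 d2 / (cabs v + 1).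
    by rewrite ge_min lexx orbT.
  move=> le1.
  have : t < Num.min d1 d2 / (cabs v + 1) by rewrite /t; lra.
  rewrite ltr_pdivlMr// => lt1; apply: le_lt_trans lt1.
  by rewrite ler_wpM2l ?(ltW t0)// lerDl.
have eq : p (z + t%:C * v) = q (z + t%:C * v).
  have := H t; rewrite ger0_norm ?ltW// tr => /(_ isT).
  rewrite E F fg => /addrI; rewrite addrAC subrr add0r => /mulIf; apply.
  by rewrite mulf_neq0// eq_complex /= eqxx andbT gt_eqF.
have dist : cabs (z + t%:C * v - z) < Num.min d1 d2.
  by rewrite addrAC subrr add0r cabsM cabs_real ger0_norm ?ltW.
move: dist; rewrite lt_min => /andP[/P Hp /Q Hq].
apply: le_lt_trans (cabs_triangle (p (z + t%:C * v)) _ _) _.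
rewrite cabsC; apply: lt_le_trans (ltrD Hp _) _.
  by rewrite eq; exact: Hq.
by rewrite -splitr.
Qed.

(** The extreme value theorem for real functions is applied to the real parts of [f], [- f], [i f]
    and [- i f], which bound both coordinates from both sides. *)
Lemma cderiv_line_bound f z v :
  (forall s : R, s \in `[0, 1] -> exists d, cderiv f (z + s%:C * v) d) ->
  exists K : R, forall s : R, s \in `[0, 1] -> cabs (f (z + s%:C * v)) <= K.
Proof.
move=> H.
have bnd g : (forall s : R, s \in `[0, 1] -> exists d, cderiv g (z + s%:C * v) d) ->
    exists K : R, forall s : R, s \in `[0, 1] -> complex.Re (g (z + s%:C * v)) <= K.
  move=> G; pose h (s : R) : R := complex.Re (g (z + s%:C * v)).
  have ch : {within [set` `[0, 1]], continuous h}.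
    apply: derivable_within_continuous => s /G[d /cderiv_Re_line D].
    by case: D.
  have [c _ Hc] := EVT_max ler01 ch.
  by exists (h c).
have [K1 H1] := bnd _ H.
have [|K2 H2] := bnd (fun w => - f w).
  by move=> s /H[d D]; exists (- d); exact: cderivN.
have [|K3 H3] := bnd (fun w => 'i * f w).
  by move=> s /H[d D]; exists ('i * d); exact: cderivZ.
have [|K4 H4] := bnd (fun w => - ('i * f w)).
  by move=> s /H[d D]; exists (- ('i * d)); exact: cderivN (cderivZ _ D).
exists (Num.max K1 K2 + Num.max K3 K4) => s hs.
move: (H1 s hs) (H2 s hs) (H3 s hs) (H4 s hs).
move: (f _) => [a b] /=; rewrite !mul0r !mul1r !sub0r opprK => h1 h2 h3 h4.
apply: le_trans (cabs_ReIm _) _ => /=; apply: lerD.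
  by rewrite ler_norml lerNl !le_max h1 h2 ?orbT.
by rewrite ler_norml lerNl !le_max h3 h4 ?orbT.
Qed.

(** The square of the modulus stays differentiable at zeros of [f], where the modulus itself may
    fail to be; its derivative is [2 Re (conj f v f')]. *)
Lemma cabs_sqr_line f z v (s : R) d : cderiv f (z + s%:C * v) d ->
  exists2 e : R, is_derive s 1 (fun t : R => cabs (f (z + t%:C * v)) ^+ 2) e
   & e <= 2 * cabs v * (cabs (f (z + s%:C * v)) * cabs d).
Proof.
move=> D.
have D1 := cderiv_Re_line D; have D2 := cderiv_Re_line (cderivZ 'i D).
have E t : cabs (f (z + t%:C * v)) ^+ 2 =
  complex.Re (f (z + t%:C * v)) * complex.Re (f (z + t%:C * v)) +
  complex.Re ('i * f (z + t%:C * v)) * complex.Re ('i * f (z + t%:C * v)).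
  move: (f _) => [a b]; rewrite cabs_def sqr_sqrtr ?addr_ge0 ?sqr_ge0//=; ring.
eexists.
  rewrite (funext E).
  apply: is_deriveD; apply: is_deriveM.
rewrite /GRing.scale /=.
set w := f _; have -> : forall a b x y : R, a * x + a * x + (b * y + b * y) = 2 * (a * x + b * y).
  by move=> *; ring.
rewrite -mulrA ler_pM2l//.
have -> : complex.Re w * complex.Re (v * d) + complex.Re ('i * w) * complex.Re (v * ('i * d))
   = complex.Re (conjc w * (v * d)).
  have gen (a b c : C) : complex.Re a * complex.Re (b * c) +
      complex.Re ('i * a) * complex.Re (b * ('i * c)) = complex.Re (conjc a * (b * c)).
    by case: a b c => [a b] [x y] [t u] /=; ring.
  exact: gen.
apply: le_trans (ler_norm _) _; apply: le_trans (cabs_Re _) _.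
rewrite !cabsM mulrCA ler_wpM2l ?cabs_ge0// ler_wpM2r ?cabs_ge0//.
by rewrite !cabs_def; case: w => a b /=; rewrite sqrrN.
Qed.

Lemma gronwall (p p' : R -> R) (K : R) :
  (forall s : R, s \in `[0, 1] -> is_derive s 1 p (p' s)) ->
  (forall s : R, s \in `[0, 1] -> p' s <= K * p s) -> p 0 = 0 -> p 1 <= 0.
Proof.
move=> D le p0.
have : p 1 * expR (- (K * 1)) <= p 0 * expR (- (K * 0)).
  apply: (@is_derive_nincr _ (fun s => p s * expR (- (K * s)))
    (fun s => (p' s - K * p s) * expR (- (K * s)))) => //.
  - move=> s hs; have Ds := D s hs.
    have De : is_derive s 1 (fun s => expR (- (K * s))) (- K * expR (- (K * s))).
      have -> : (fun s => expR (- (K * s))) = expR \o (fun s => - K * s).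
        by apply/funext => t /=; rewrite mulNr.
      have D1 : is_derive s 1 (fun s => - K * s) (- K).
        have := @is_deriveZ _ _ _ id (- K) s 1 1 (is_derive_id _ _).
        by rewrite /GRing.scale /= mulr1.
      have := @is_derive1_comp _ expR (fun s => - K * s) s _ _ (is_derive_expR _) D1.
      by rewrite [_ * - K]mulrC [in expR (- K * s)]mulNr.
    apply: is_derive_eq (is_deriveM Ds De) _.
    rewrite /GRing.scale /=; ring.
  move=> s hs; rewrite mulr_le0_ge0 ?expR_ge0// subr_le0; exact: le.
by rewrite p0 mul0r pmulr_lle0// expR_gt0.
Qed.

Definition line_deriv f f' z v :=
  forall s : R, s \in `[0, 1] -> cderiv f (z + s%:C * v) (f' (z + s%:C * v)).

Lemma linear_ode_zero (f1 f2 f3 f1' f2' f3' : C -> C) z v (K : R) :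
  line_deriv f1 f1' z v -> line_deriv f2 f2' z v -> line_deriv f3 f3' z v ->
  (forall s : R, s \in `[0, 1] -> let w := z + s%:C * v in
    let S := cabs (f1 w) + cabs (f2 w) + cabs (f3 w) in
    [/\ cabs (f1' w) <= K * S, cabs (f2' w) <= K * S & cabs (f3' w) <= K * S]) ->
  f1 z = 0 -> f2 z = 0 -> f3 z = 0 -> f1 (z + v) = 0.
Proof.
move=> D1 D2 D3 H z1 z2 z3.
pose p (s : R) : R := cabs (f1 (z + s%:C * v)) ^+ 2 + cabs (f2 (z + s%:C * v)) ^+ 2
  + cabs (f3 (z + s%:C * v)) ^+ 2.
have K0 : 0 <= `|K| by [].
(* The 6 is the 2 from differentiating a square times the 3 in
   [(a + b + c)^2 <= 3 (a^2 + b^2 + c^2)]. *)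
have [p' Hp'] : {p' : R -> R & forall s : R, s \in `[0, 1] ->
   is_derive s 1 p (p' s) /\ p' s <= 6 * cabs v * `|K| * p s}.
  apply: (@choice _ _ (fun (s : R) (e : R) => s \in `[0, 1] ->
     is_derive s 1 p e /\ e <= 6 * cabs v * `|K| * p s)) => s.
  have [hs|] := boolP (s \in `[0, 1]); last by exists 0.
  have [e1 E1 L1] := cabs_sqr_line (D1 s hs); have [e2 E2 L2] := cabs_sqr_line (D2 s hs).
  have [e3 E3 L3] := cabs_sqr_line (D3 s hs).
  exists (e1 + e2 + e3) => _; split; first exact: is_deriveD (is_deriveD E1 E2) E3.
  have := H s hs; rewrite /p /=.
  move: L1 L2 L3 (cabs_ge0 (f1 (z + s%:C * v))) (cabs_ge0 (f2 (z + s%:C * v)))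
    (cabs_ge0 (f3 (z + s%:C * v))) (cabs_ge0 v).
  move: (cabs (f1 _)) (cabs (f2 _)) (cabs (f3 _)) (cabs (f1' _)) (cabs (f2' _)) (cabs (f3' _)) (cabs v).
  move=> a b c a' b' c' V L1 L2 L3 a0 b0 c0 V0 [M1 M2 M3].
  have KS : K * (a + b + c) <= `|K| * (a + b + c).
    by rewrite ler_wpM2r ?addr_ge0// ler_norm.
  have {}M1 := le_trans M1 KS; have {}M2 := le_trans M2 KS; have {}M3 := le_trans M3 KS.
  have {}L1 : e1 <= 2 * V * (a * (`|K| * (a + b + c))).
    by apply: le_trans L1 _; rewrite ler_wpM2l ?mulr_ge0// ler_wpM2l.
  have {}L2 : e2 <= 2 * V * (b * (`|K| * (a + b + c))).
    by apply: le_trans L2 _; rewrite ler_wpM2l ?mulr_ge0// ler_wpM2l.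
  have {}L3 : e3 <= 2 * V * (c * (`|K| * (a + b + c))).
    by apply: le_trans L3 _; rewrite ler_wpM2l ?mulr_ge0// ler_wpM2l.
  apply: le_trans (lerD (lerD L1 L2) L3) _.
  have -> : 2 * V * (a * (`|K| * (a + b + c))) + 2 * V * (b * (`|K| * (a + b + c)))
     + 2 * V * (c * (`|K| * (a + b + c))) = 2 * V * `|K| * (a + b + c) ^+ 2 by ring.
  have -> : 6 * V * `|K| * (a ^+ 2 + b ^+ 2 + c ^+ 2) =
     2 * V * `|K| * (3 * (a ^+ 2 + b ^+ 2 + c ^+ 2)) by ring.
  rewrite ler_wpM2l ?mulr_ge0//.
  have := sqr_ge0 (a - b); have := sqr_ge0 (b - c); have := sqr_ge0 (a - c).
  rewrite !sqrrB !sqrrD; lra.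
have : p 1 <= 0.
  apply: (@gronwall p p' (6 * cabs v * `|K|)) => [s /Hp'[]//|s /Hp'[]//|].
  by rewrite /p !mul0r addr0 z1 z2 z3 !cabs0 !expr0n !addr0.
rewrite /p mul1r => L.
apply/eqP; rewrite -cabs_eq0 -sqrf_eq0 eq_le sqr_ge0 andbT.
have := sqr_ge0 (cabs (f2 (z + v))); have := sqr_ge0 (cabs (f3 (z + v))); lra.
Qed.

End LinearODE.

Section Inversion.
Variable R : realType.
Local Notation C := R[i].
Implicit Types (tau : C).

Definition invH tau : C := - tau^-1.

Lemma inH_neq0 tau : inH tau -> tau != 0.
Proof. by apply: contraTneq => ->; rewrite /inH /= ltxx. Qed.

Lemma inH_invH tau : inH tau -> inH (invH tau).
Proof.
move=> h; have := inH_neq0 h; move: h; case: tau => a b; rewrite /inH /= => b0 _.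
rewrite opprK divr_gt0// ltr_wpDl ?sqr_ge0// exprn_gt0//.
Qed.

Lemma hasD_invH f g : hasD f g ->
  hasD (fun t => f (invH t)) (fun t => g (invH t) / t ^+ 2).
Proof.
move=> F tau h; have h0 := inH_neq0 h.
have D : cderiv invH tau (tau ^- 2).
  by apply: cderiv_eq (cderivN (cderivV h0 (cderiv_id tau))) _; rewrite mulNr opprK mul1r.
apply: cderiv_eq (cderiv_comp D (F _ (inH_invH h))) _; ring.
Qed.

Lemma hasD_inv_sqr : hasD (fun t : C => t ^- 2) (fun t => - 2 / (pi%:C * 'i) / t ^+ 3).
Proof.
move=> tau h; have h0 := inH_neq0 h; have p0 := pii_neq0 R.
have := @cderivV _ (fun t => t ^+ 2) tau _ (expf_neq0 2 h0) (cderivX 2 (cderiv_id tau)).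
move=> /cderiv_eq; apply; move: (pi%:C * 'i) p0 => p p0 /=; field.
by rewrite p0 h0.
Qed.

(** The weight 2 action of [tau -> - 1 / tau], with [x] and [y] exchanged. As [p] is a logarithmic
    derivative of a function of weight 1/2, [pinv] carries the term [1 / (2 pi i tau)]; with it the
    triple solves the system of [x], [y], [p]. *)
Definition xinv tau : C := yf (invH tau) / tau ^+ 2.
Definition yinv tau : C := xf (invH tau) / tau ^+ 2.
Definition pinv tau : C := pf (invH tau) / tau ^+ 2 - (2 * (pi%:C * 'i) * tau)^-1.

Lemma hasD_xinv : hasD xinv (fun t => xinv t * (4 * pinv t - yinv t)).
Proof.
apply: hasD_eq (hasDM (hasD_invH (@hasD_yf R)) hasD_inv_sqr) => // t h.
rewrite /xinv /yinv /pinv; have h0 := inH_neq0 h; have p0 := pii_neq0 R.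
move: (pi%:C * 'i) p0 (yf _) (xf _) (pf _) => p p0 y x q; field.
by rewrite p0 h0.
Qed.

Lemma hasD_yinv : hasD yinv (fun t => yinv t * (4 * pinv t - xinv t)).
Proof.
apply: hasD_eq (hasDM (hasD_invH (@hasD_xf R)) hasD_inv_sqr) => // t h.
rewrite /xinv /yinv /pinv; have h0 := inH_neq0 h; have p0 := pii_neq0 R.
move: (pi%:C * 'i) p0 (yf _) (xf _) (pf _) => p p0 y x q; field.
by rewrite p0 h0.
Qed.

Lemma hasD_pinv : hasD pinv (fun t => 2 * pinv t ^+ 2 - xinv t * yinv t / 8).
Proof.
have H1 := hasDM (hasD_invH (@hasD_pf_xy R)) hasD_inv_sqr.
have H2 : hasD (fun t => (2 * (pi%:C * 'i) * t)^-1)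
    (fun t => - (2 * (pi%:C * 'i) ^+ 2 * t ^+ 2)^-1 : C).
  move=> tau h; have h0 := inH_neq0 h; have p0 := pii_neq0 R.
  have := cderivV _ (cderivZ (2 * (pi%:C * 'i)) (cderiv_id tau)).
  move=> /(_ (mulf_neq0 (mulf_neq0 _ p0) h0)) /cderiv_eq; apply; first by rewrite pnatr_eq0.
  by move: (pi%:C * 'i) p0 => p p0; field; rewrite p0 h0.
apply: hasD_eq (hasDD H1 (hasDZ (-1) H2)) => t h; first by rewrite mulN1r.
rewrite /xinv /yinv /pinv; have h0 := inH_neq0 h; have p0 := pii_neq0 R.
move: (pi%:C * 'i) p0 (yf _) (xf _) (pf _) => p p0 y x q; field.
by rewrite p0 h0.
Qed.

Lemma invH_iax (s : R) : s != 0 -> invH (iax s) = iax s^-1.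
Proof.
move=> s0; apply/eqP; rewrite eq_complex /=; apply/andP; split; apply/eqP.
  by rewrite expr0n add0r mul0r oppr0.
by rewrite expr0n add0r opprK expr2 invfM mulrA mulfV// mul1r.
Qed.

Lemma inv_axis (s : R) : 0 < s ->
  xinv (iax s) = xf (iax s) /\ yinv (iax s) = yf (iax s).
Proof.
move=> s0; have i0 : 0 < s^-1 by rewrite invr_gt0.
have X (t : R) : 0 < t -> xf (iax t) = - (agmB t ^+ 2)%:C.
  by move=> t0; rewrite /xf theta4_iax// -rmorphXn /agmB -exprM.
have Y (t : R) : 0 < t -> yf (iax t) = (agmC t ^+ 2)%:C.
  by move=> t0; rewrite /yf theta_half_iax// -rmorphXn /agmC -exprM.
have S : iax s ^+ 2 = - (s ^+ 2)%:C.
  by apply/eqP; rewrite eq_complex /=; apply/andP; split; apply/eqP; ring.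
have s2 : s ^+ 2 != 0 by rewrite expf_neq0// gt_eqF.
have B : agmB s^-1 = s * agmC s.
  have := agmC_inv i0; rewrite invrK => ->; rewrite mulrA mulfV ?mul1r//.
  by rewrite gt_eqF.
have sn0 : s != 0 by rewrite gt_eqF.
split; rewrite /xinv /yinv (invH_iax sn0) !(X, Y)// S.
  by rewrite (agmC_inv s0) invrN mulrN -fmorphV -rmorphM exprMn mulrC mulKf.
by rewrite B invrN mulrNN -fmorphV -rmorphM exprMn mulrC mulKf.
Qed.

(** [xinv] and [xf] agree along the axis, hence so do their derivatives at i; in these, [p] is the
    only quantity not yet known to agree. *)
Lemma pinv_i : pinv (iax 1) = pf (iax 1).
Proof.
have h : inH (iax (1 : R)) by exact: inH_iax.
have [Ex Ey] := inv_axis (ltr01 : 0 < (1 : R)).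
have := @cderiv_line_unique R xinv (@xf R) (iax 1) (iax 1) _ _ 1 _ ltr01
  (hasD_xinv h) (hasD_xf h).
rewrite Ex Ey => H; have {H} : pi%:C * 'i * (xf (iax 1) * (4 * pinv (iax 1) - yf (iax 1))) =
  pi%:C * 'i * (xf (iax 1) * (4 * pf (iax 1) - yf (iax (1 : R)))).
  apply: H => [|t t1]; first exact: inH_neq0.
  have -> : iax 1 + t%:C * iax 1 = iax (1 + t).
    by apply/eqP; rewrite eq_complex /=; apply/andP; split; apply/eqP; ring.
  apply: (proj1 (inv_axis _)); move: t1; rewrite ltr_norml => /andP[]; lra.
move=> /(mulfI (pii_neq0 R)) /(mulfI (xf_neq0 h)) /addIr /mulfI; apply.
by rewrite pnatr_eq0.
Qed.

Lemma hasD_line f g tau : inH tau -> hasD f g ->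
  line_deriv f (fun t => pi%:C * 'i * g t) (iax 1) (tau - iax 1).
Proof.
move=> h F s; rewrite in_itv /= => /andP[s0 s1]; apply: F.
move: h; case: tau => a b; rewrite /inH /=; nra.
Qed.

(* Both triples solve the same autonomous system and agree at i. *)
Lemma inversion tau : inH tau -> xinv tau = xf tau /\ yinv tau = yf tau.
Proof.
move=> h; pose z : C := iax 1; pose v := tau - z.
have zv : z + v = tau by rewrite addrC subrK.
have [Ex Ey] := inv_axis (ltr01 : 0 < (1 : R)); have Ep := pinv_i.
pose f1 (t : C) := xinv t - xf t; pose f2 (t : C) := yinv t - yf t.
pose f3 (t : C) := pinv t - pf t.
have B f g : hasD f g -> exists2 K : R, 0 <= K & forall s : R, s \in `[0, 1] ->
    cabs (f (z + s%:C * v)) <= K.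
  move=> F; have [|K HK] := @cderiv_line_bound _ f z v.
    by move=> s hs; exists (pi%:C * 'i * g (z + s%:C * v)); have := hasD_line h F; apply.
  exists K => //; apply: le_trans (cabs_ge0 _) (HK 0 _).
  by rewrite in_itv /= lexx ler01.
have [K1 K10 H1] := B _ _ (hasDD (hasDZ 4 hasD_pinv) (hasDZ (-1) hasD_yinv)).
have [K2 K20 H2] := B _ _ (hasDD (hasDZ 4 hasD_pinv) (hasDZ (-1) hasD_xinv)).
have [K3 K30 H3] := B _ _ (hasDZ 2 (hasDD hasD_pinv (@hasD_pf_xy R))).
have [K4 K40 H4] := B _ _ (hasDZ 8^-1 hasD_yinv).
have [K5 K50 H5] := B _ _ (@hasD_xf R). have [K6 K60 H6] := B _ _ (@hasD_yf R).
(* Each difference of products is split as [(a - a') b + a' (b - b')], which makes the system for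
   the differences linear, with coefficients bounded on the segment from i to [tau]. *)
have D1 : hasD f1 (fun t => f1 t * (4 * pinv t + -1 * yinv t) + xf t * (4 * f3 t - f2 t)).
  apply: hasD_eq (hasDD hasD_xinv (hasDZ (-1) (@hasD_xf R))) => t ht; first by rewrite mulN1r.
  by rewrite /f1 /f2 /f3; ring.
have D2 : hasD f2 (fun t => f2 t * (4 * pinv t + -1 * xinv t) + yf t * (4 * f3 t - f1 t)).
  apply: hasD_eq (hasDD hasD_yinv (hasDZ (-1) (@hasD_yf R))) => t ht; first by rewrite mulN1r.
  by rewrite /f1 /f2 /f3; ring.
have D3 : hasD f3 (fun t => f3 t * (2 * (pinv t + pf t)) +
    (f1 t * (- (8^-1 * yinv t)) + xf t * (- 8^-1 * f2 t))).
  apply: hasD_eq (hasDD hasD_pinv (hasDZ (-1) (@hasD_pf_xy R))) => t ht; first by rewrite mulN1r.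
  by rewrite /f1 /f2 /f3; field.
have est (a b c d : C) (k l : R) : cabs b <= k -> cabs c <= l ->
    cabs (a * b + c * d) <= cabs a * k + l * cabs d.
  move=> bk cl; apply: le_trans (cabsD _ _) _; rewrite !cabsM.
  by apply: lerD; [rewrite ler_wpM2l ?cabs_ge0|rewrite ler_wpM2r ?cabs_ge0].
pose K := K1 + K2 + K3 + K4 + 4 * K5 + 4 * K6.
have T (a b : C) : cabs (4 * a - b) <= 4 * cabs a + cabs b.
  by apply: le_trans (cabsB _ _) _; rewrite cabsM cabs_nat.
suff : f1 (z + v) = 0 /\ f2 (z + v) = 0.
  by rewrite zv => -[/eqP + /eqP]; rewrite !subr_eq0 => /eqP ? /eqP ?.
have z1 : f1 z = 0 by rewrite /f1 Ex subrr.
have z2 : f2 z = 0 by rewrite /f2 Ey subrr.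
have z3 : f3 z = 0 by rewrite /f3 Ep subrr.
have L1 := hasD_line h D1.
have L2 := hasD_line h D2.
have L3 := hasD_line h D3.
have main s : s \in `[0, 1] -> let w := z + s%:C * v in
    let S := cabs (f1 w) + cabs (f2 w) + cabs (f3 w) in
    [/\ cabs (f1 w * (4 * pinv w + -1 * yinv w) + xf w * (4 * f3 w - f2 w)) <= K * S,
        cabs (f2 w * (4 * pinv w + -1 * xinv w) + yf w * (4 * f3 w - f1 w)) <= K * S
      & cabs (f3 w * (2 * (pinv w + pf w)) +
          (f1 w * (- (8^-1 * yinv w)) + xf w * (- 8^-1 * f2 w))) <= K * S].
  move=> hs w S.
  have a1 := cabs_ge0 (f1 w); have a2 := cabs_ge0 (f2 w); have a3 := cabs_ge0 (f3 w).
  split.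
  - apply: le_trans (est _ _ _ _ _ _ (H1 s hs) (H5 s hs)) _.
    have := ler_wpM2l K50 (T (f3 w) (f2 w)); rewrite -/w /S /K.
    move: (cabs (f1 w)) (cabs (f2 w)) (cabs (f3 w)) (cabs (_ - _)) a1 a2 a3 => a b c d *; nra.
  - apply: le_trans (est _ _ _ _ _ _ (H2 s hs) (H6 s hs)) _.
    have := ler_wpM2l K60 (T (f3 w) (f1 w)); rewrite -/w /S /K.
    move: (cabs (f1 w)) (cabs (f2 w)) (cabs (f3 w)) (cabs (_ - _)) a1 a2 a3 => a b c d *; nra.
  - apply: le_trans (cabsD _ _) _.
    have H4' : cabs (- (8^-1 * yinv w)) <= K4 by rewrite cabsN; exact: H4.
    have E1 := est (f1 w) _ _ (- 8^-1 * f2 w) _ _ H4' (H5 s hs).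
    have E2 : cabs (f3 w * (2 * (pinv w + pf w))) <= cabs (f3 w) * K3.
      by rewrite cabsM ler_wpM2l ?cabs_ge0//; exact: H3.
    apply: le_trans (lerD E2 E1) _.
    have -> : cabs (- 8^-1 * f2 w) = 8^-1 * cabs (f2 w).
      by rewrite cabsM cabsN cabsV cabs_nat.
    rewrite /S /K; move: (cabs (f1 w)) (cabs (f2 w)) (cabs (f3 w)) a1 a2 a3 => a b c *; nra.
have scale (g : C -> C) (S : R) w : cabs (g w) <= K * S -> cabs (pi%:C * 'i * g w) <= pi * K * S.
  by rewrite !cabsM cabsi cabs_real ger0_norm ?pi_ge0// mulr1 -mulrA ler_pM2l ?pi_gt0.
split.
  apply: (linear_ode_zero (K := pi * K) L1 L2 L3) => // s hs w S.
  by have [? ? ?] := main s hs; split; apply: scale.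
(* [linear_ode_zero] concludes for its first function, so the system is fed again with [f2] in
   front. *)
apply: (linear_ode_zero (K := pi * K) L2 L1 L3) => // s hs w S.
have [] := main s hs; rewrite -/w /S [cabs (f2 w) + _]addrC => ? ? ?; split; exact: scale.
Qed.

Lemma xf_inv tau : inH tau -> xf (invH tau) = tau ^+ 2 * yf tau.
Proof.
by move=> h; have [_ <-] := inversion h; rewrite /yinv mulrC divfK// expf_neq0// inH_neq0.
Qed.

Lemma yf_inv tau : inH tau -> yf (invH tau) = tau ^+ 2 * xf tau.
Proof.
by move=> h; have [<- _] := inversion h; rewrite /xinv mulrC divfK// expf_neq0// inH_neq0.
Qed.

End Inversion.

(** * Modularity *)

Section Gamma2.
Variable R : realType.
Local Notation C := R[i].
Implicit Types (tau : C) (f : C -> C).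

(** [theta_half] involves [q^(1/4)]; Jacobi's identity supplies the integral expansion of its fourth
    power. *)
Lemma qexp_yf : exists c, qexp (@yf R) c.
Proof.
have [c Q _] := qexp_theta R; have [c4 Q4 _] := qexp_theta4 R.
have [d D] := qexpX 4 Q; have [d4 D4] := qexpX 4 Q4.
exists (fun n => d n + -1 * d4 n); apply: qexp_eq (qexpD D (qexpZ (-1) D4)) => t h.
by rewrite yf_theta// mulN1r.
Qed.

Lemma qexp_xf : exists c, qexp (@xf R) c.
Proof.
have [c4 Q4 _] := qexp_theta4 R; have [d4 D4] := qexpX 4 Q4.
exists (fun n => -1 * d4 n); apply: qexp_eq (qexpZ (-1) D4) => t h.
by rewrite mulN1r.
Qed.

Lemma epi_even n (k : int) : epi n%:R (2 * k%:~R : C) = 1.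
Proof.
have E1 : epi 1 (2 : C) = 1.
  rewrite /epi mulr1 /cexp.
  have -> : pi%:C * 'i * 2 = 0 +i* (pi *+ 2) :> C.
    by apply/eqP; rewrite eq_complex /=; apply/andP; split; apply/eqP; ring.
  by rewrite /= expR0 cos2pi sin2pi mul1r.
have Em (m : nat) : epi 1 (2 * m%:R : C) = 1.
  by rewrite mulrC epi_scale mul1r epi_nat E1 expr1n.
rewrite epi_nat (_ : epi 1 _ = 1) ?expr1n//; case: k => m; first exact: Em.
have := epiDr 1 (2 * m.+1%:R) (2 * (Negz m)%:~R : C).
by rewrite NegzE rmorphN mulrN subrr /epi mulr0 cexp0 -/(epi _ _) -/(epi _ _) Em mul1r => <-.
Qed.

Lemma inH_even tau (k : int) : inH tau -> inH (tau + 2 * k%:~R).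
Proof.
rewrite /inH raddfD /=.
have -> : 2 * k%:~R = (2 * k%:~R : R)%:C :> C by rewrite rmorphM rmorph_nat rmorph_int.
by rewrite addr0.
Qed.

Lemma qexp_period f c (k : int) tau : qexp f c -> inH tau ->
  f (tau + 2 * k%:~R) = f tau.
Proof.
move=> [_ F] h.
apply: has_sum_unique (F _ (inH_even k h)) _; apply: has_sum_ext (F _ h) => n.
by rewrite epiDr epi_even mulr1.
Qed.

(** Phrased in the entries, so that the descent can act by row operations. *)
Definition automorphic (a b c d : int) : Prop := forall tau, inH tau ->
  let N := a%:~R * tau + b%:~R in let D := c%:~R * tau + d%:~R in
  [/\ D != 0, inH (N / D), xf (N / D) = D ^+ 2 * xf tau & yf (N / D) = D ^+ 2 * yf tau].

Lemma automorphic_T a b c d (k : int) : automorphic a b c d ->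
  automorphic (a + 2 * k * c) (b + 2 * k * d) c d.
Proof.
move=> H tau h /=; have [D0 hN X Y] := H tau h.
have -> : ((a + 2 * k * c)%:~R * tau + (b + 2 * k * d)%:~R) / (c%:~R * tau + d%:~R)
   = (a%:~R * tau + b%:~R) / (c%:~R * tau + d%:~R) + 2 * k%:~R :> C.
  by rewrite !rmorphD !rmorphM /=; field.
have [cx Qx] := qexp_xf; have [cy Qy] := qexp_yf.
rewrite !(qexp_period _ Qx, qexp_period _ Qy)//; split=> //; exact: inH_even.
Qed.

(** [tau / (2 k tau + 1)] is the translation by [- 2 k] conjugated by the inversion; the exchange of
    [x] and [y] takes place twice. *)
Lemma lower_unipotent (k : int) tau : inH tau ->
  let D := 2 * k%:~R * tau + 1 in
  [/\ D != 0, inH (tau / D), xf (tau / D) = D ^+ 2 * xf tau & yf (tau / D) = D ^+ 2 * yf tau].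
Proof.
move=> h D; have h0 := inH_neq0 h; have hi := inH_invH h.
have hv := inH_even (- k) hi.
have v0 := inH_neq0 hv.
have E : D = - (tau * (invH tau + 2 * (- k)%:~R)).
  by rewrite /D /invH rmorphN /=; field.
have D0 : D != 0 by rewrite E oppr_eq0 mulf_neq0.
have Ei : tau / D = invH (invH tau + 2 * (- k)%:~R).
  by rewrite E invrN mulrN invfM mulrA mulfV ?mul1r.
have [cx Qx] := qexp_xf; have [cy Qy] := qexp_yf.
rewrite Ei xf_inv// yf_inv// (qexp_period _ Qx)// (qexp_period _ Qy)// xf_inv// yf_inv//.
by split=> //; rewrite ?E; [exact: inH_invH|ring|ring].
Qed.

Lemma automorphic_U a b c d (k : int) : automorphic a b c d ->
  automorphic a b (c + 2 * k * a) (d + 2 * k * b).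
Proof.
move=> H tau h /=; have [D0 hN X Y] := H tau h.
have [D0' hN' X' Y'] := lower_unipotent k hN.
have E : (c + 2 * k * a)%:~R * tau + (d + 2 * k * b)%:~R =
  (2 * k%:~R * ((a%:~R * tau + b%:~R) / (c%:~R * tau + d%:~R)) + 1) * (c%:~R * tau + d%:~R) :> C.
  by rewrite !rmorphD !rmorphM /=; field.
have gen (x y z : C) : x / (y * z) = x / z / y by rewrite invfM mulrCA mulrC.
rewrite E gen X' Y' X Y; split => //; first exact: mulf_neq0.
  by rewrite mulrA -exprMn.
by rewrite mulrA -exprMn.
Qed.

(* Euclidean descent on |a| + |c|: since a is odd and c even, one of the two can
   be reduced by twice the other. *)
Lemma automorphic_Gamma2 n a b c d : (`|a| + `|c| <= n)%N ->
  a * d - b * c = 1 -> (exists a', a = 2 * a' + 1) -> (exists b', b = 2 * b') ->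
  (exists c', c = 2 * c') -> (exists d', d = 2 * d' + 1) -> automorphic a b c d.
Proof.
elim: n a b c d => [|n IH] a b c d le det [a' Ea] [b' Eb] [c' Ec] [d' Ed].
  by exfalso; lia.
(* Determinant 1 leaves [a = d] equal to 1 or -1: a translation by an even integer, the sign
   disappearing from the square of the denominator. *)
have [c0|c0] := eqVneq c 0.
  move: det; rewrite c0 mulr0 subr0 => ad.
  have ad' : a = d /\ d * d = 1.
    have := congr1 absz ad; rewrite abszM absz1 => /eqP; rewrite muln_eq1 => /andP[/eqP a1 _].
    have {a1} [a1|a1] : a = 1 \/ a = -1 by lia.
      by move: ad; rewrite a1 mul1r => ->; rewrite mulr1.
    have d1 : d = -1 by move: ad; rewrite a1 mulN1r; lia.
    by rewrite a1 d1.
  have dd : (d%:~R : C) * d%:~R = 1 by rewrite -rmorphM; case: ad' => _ ->.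
  have d0 : (d%:~R : C) != 0.
    by apply/eqP => d0; move/eqP: dd; rewrite d0 mul0r eq_sym oner_eq0.
  move=> tau h /=; rewrite mul0r add0r expr2 dd !mul1r.
  have -> : (a%:~R * tau + b%:~R) / d%:~R = tau + 2 * (d * b')%:~R :> C.
    case: ad' => -> _; rewrite Eb !rmorphM /= mulrDl mulrAC mulfV// mul1r.
    have -> : (d%:~R : C)^-1 = d%:~R by apply: (mulfI d0); rewrite mulfV// dd.
    by ring.
  have [cx Qx] := qexp_xf; have [cy Qy] := qexp_yf.
  by rewrite (qexp_period _ Qx)// (qexp_period _ Qy)//; split=> //; exact: inH_even.
have [ac|ac] := ltnP `|c| `|a|.
  (* [s] is the sign of [a c]; since [0 < |c| < |a|], subtracting [2 s c] lowers [|a|]. *)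
  pose s : int := if (0 < a) == (0 < c) then 1 else -1.
  have := @automorphic_T (a - 2 * s * c) (b - 2 * s * d) c d s.
  rewrite !subrK; apply; apply: IH.
  - by rewrite /s; case: ifP => /eqP; lia.
  - by rewrite -det; ring.
  - by exists (a' - s * c); rewrite Ea; ring.
  - by exists (b' - s * d); rewrite Eb; ring.
  - by exists c'.
  - by exists d'.
pose s : int := if (0 < a) == (0 < c) then 1 else -1.
have := @automorphic_U a b (c - 2 * s * a) (d - 2 * s * b) s.
rewrite !subrK; apply; apply: IH.
- by rewrite /s; case: ifP => /eqP; lia.
- by rewrite -det; ring.
- by exists a'.
- by exists b'.
- by exists (c' - s * a); rewrite Ec; ring.
- by exists (d' - s * b); rewrite Ed; ring.
Qed.

Lemma mobius_Gamma2 (g : 'M[int]_2) tau : in_Gamma2 g -> inH tau ->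
  let D := (g 1 0)%:~R * tau + (g 1 1)%:~R in
  [/\ D != 0, inH (mobius g tau), xf (mobius g tau) = D ^+ 2 * xf tau
    & yf (mobius g tau) = D ^+ 2 * yf tau].
Proof.
move=> [det par] h; apply: (@automorphic_Gamma2 _ (g 0 0) (g 0 1) (g 1 0) (g 1 1)) h => //.
- rewrite -det (expand_det_row _ 0) !big_ord_recl big_ord0 /cofactor !det_mx11 !mxE /=.
  by rewrite addr0 expr0 mul1r expr1 mulN1r mulrN; congr (_ * g _ _ - g _ _ * g _ _); exact/val_inj.
all: rewrite [X in exists _, X = _](divz_eq _ 2) par !mxE /=.
all: by eexists; rewrite mulrC ?addr0.
Qed.

Lemma theta_iax_bound tau : inH tau ->
  cabs (theta tau) <= t3 (complex.Im tau) /\ cabs (theta4 tau) <= t3 (complex.Im tau).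
Proof.
move=> h.
have le (e : int -> C) l : (forall n, cabs (e n) = 1) ->
    has_sum (fun n : int => e n * epi (n%:~R ^+ 2) tau) l -> cabs l <= t3 (complex.Im tau).
  move=> e1 H; apply: has_sum_le H _ => s us.
  have := has_sum_Re_ge (fun n => expR_ge0 _) us (has_sum_theta_iax h).
  apply: le_trans; apply: ler_sum => n _.
  rewrite cabsM e1 mul1r intr_sqr -(rmorph_nat (real_complex R)) cabs_epi_real.
  by rewrite ler_expR lerN2 mulrAC.
split; last first.
  by apply: le (has_sum_theta4 h) => n; exact: cabs_sign.
apply: (@le (fun=> 1)) => [n|]; first exact: cabs1.
by apply: has_sum_ext (has_sum_theta h) => n; rewrite mul1r.
Qed.

Lemma xf_yf_bound tau : inH tau -> complex.Im tau <= 1 ->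
  cabs (xf tau) <= 32 * complex.Im tau ^- 2 /\ cabs (yf tau) <= 32 * complex.Im tau ^- 2.
Proof.
move=> h t1; have [b3 b4] := theta_iax_bound h; have [_ up] := t3_gauss h.
set t := complex.Im tau in h t1 b3 b4 up *.
have t0 : 0 < t by [].
pose e := (Num.sqrt t)^-1.
have e1 : 1 <= e.
  rewrite invf_ge1 ?sqrtr_gt0// -(@sqrtr1 R) ler_wsqrtr//.
have e4 : e ^+ 4 = t ^- 2.
  by rewrite (exprM e 2 2) exprVn sqr_sqrtr ?ltW// exprVn.
(* For [t <= 1] the bound [1 / sqrt t + 1] is at most [2 / sqrt t], with fourth power [16 / t^2];
   [y = theta^4 + x] accounts for 32. *)
have B (z : C) : cabs z <= t3 t -> cabs (z ^+ 4) <= 16 * t ^- 2.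
  move=> zt; rewrite cabsX -e4 (_ : 16 = 2 ^+ 4); last by rewrite -natrX.
  rewrite -exprMn lerXn2r ?nnegrE ?cabs_ge0//; first by rewrite mulr_ge0// (le_trans ler01).
  by apply: le_trans zt _; apply: le_trans up _; rewrite -/e; lra.
have := B _ b3; have := B _ b4.
have xE : cabs (xf tau) = cabs (theta4 tau ^+ 4) by rewrite /xf cabsN.
rewrite -xE => X Y; have := cabsD (theta tau ^+ 4) (xf tau); rewrite -yf_theta//.
have : 0 <= t ^- 2 by rewrite invr_ge0 exprn_ge0// ltW.
move: (t ^- 2) X Y => T X Y *; split; lra.
Qed.

End Gamma2.

Lemma recurrence_map (K L : fieldType) (f : {rmorphism K -> L}) (k a b : K) (p q r : {poly K}) (u : L) :
  k *: p + ('X^2 - 'X) * q^`() - (a%:P + b *: 'X) * q + 4^-1 *: ('X * r) = 0 ->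
  f k * (map_poly f p).[u] + (u ^+ 2 - u) * (map_poly f q)^`().[u]
  - (f a + f b * u) * (map_poly f q).[u] + 4^-1 * (u * (map_poly f r).[u]) = 0.
Proof.
move/(congr1 (fun p => (map_poly f p).[u])).
rewrite rmorph0 horner0 => <-.
rewrite !(rmorphD, rmorphN, rmorphM) /= !map_polyZ !rmorphM.
rewrite !(map_polyXn, map_polyX, map_polyC, deriv_map).
rewrite /= map_polyX.
by rewrite !(hornerD, hornerN, hornerM, hornerZ, hornerX, hornerXn, hornerC) fmorphV rmorph_nat.
Qed.

Section PolynomialRecurrence.
Variable K : fieldType.
Implicit Types (H : nat -> {poly K} -> {poly K} -> {poly K}) (p : {poly K}).

Lemma poly_rec_exists H p : exists P : nat -> {poly K},
  P 0%N = p /\ forall n, P n.+1 = H n (P n) (prev_poly P n).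
Proof.
pose st := fix st n : {poly K} * {poly K} :=
  if n is m.+1 then (H m (st m).1 (st m).2, (st m).1) else (p, 0).
exists (fun n => (st n).1); split=> // n /=.
by congr H; case: n.
Qed.

Lemma poly_rec_unique H p (P Q : nat -> {poly K}) :
  P 0%N = p -> (forall n, P n.+1 = H n (P n) (prev_poly P n)) ->
  Q 0%N = p -> (forall n, Q n.+1 = H n (Q n) (prev_poly Q n)) -> P = Q.
Proof.
move=> P0 PS Q0 QS; suff E n : P n = Q n /\ prev_poly P n = prev_poly Q n.
  by apply/funext => n; case: (E n).
elim: n => [|n [E1 E2]]; first by rewrite P0 Q0.
by rewrite PS QS E1 E2.
Qed.

Lemma solve_scale (k : K) (p q : {poly K}) : k != 0 ->
  (k *: p + q = 0) <-> (p = - (k^-1 *: q)).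
Proof.
move=> k0; split=> [/eqP|->]; last by rewrite scalerN scalerA mulfV// scale1r addNr.
by rewrite addr_eq0 => /eqP E; rewrite -scalerN -E scalerA mulVf// scale1r.
Qed.

End PolynomialRecurrence.

Section Modularity.
Variable R : realType.
Local Notation C := R[i].
Implicit Types (tau : C) (p : {poly C}).

(** The terms [4 p] cancel in the quotient [y / x]; this is the source of [u^2 - u] in the
    recurrences. *)
Lemma hasD_uf : hasD (@uf R) (fun t => xf t * (uf t ^+ 2 - uf t)).
Proof.
apply: hasD_eq (hasDM (@hasD_yf R) (hasDV (@xf_neq0 R) (@hasD_xf R))) => // t h.
rewrite /uf; have := xf_neq0 h; move: (xf t) (yf t) (pf t) => x y q x0.
by field.
Qed.

Lemma hasD_poly (g g' : C -> C) p : hasD g g' ->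
  hasD (fun t => p.[g t]) (fun t => p^`().[g t] * g' t).
Proof.
move=> G; elim/poly_ind: p => [|p c IH].
  by apply: hasD_eq (hasD_cst 0) => t h; rewrite ?deriv0 ?horner0 ?mul0r.
apply: hasD_eq (hasDD (hasDM IH G) (hasD_cst c)) => t h; first by rewrite hornerMXaddC.
by rewrite derivMXaddC hornerD hornerMX; ring.
Qed.

Lemma uf_x tau : inH tau -> xf tau * uf tau = yf tau.
Proof. by move=> h; rewrite /uf mulrC divfK// xf_neq0. Qed.

(** The factor [x^N] clears the denominators of [u], so that upper bounds for [x] and [y] alone
    control the growth at the cusps. *)
Lemma homogenize N p tau : inH tau -> (size p <= N.+1)%N ->
  xf tau ^+ N * p.[uf tau] = \sum_(j < N.+1) p`_j * (xf tau ^+ (N - j) * yf tau ^+ j).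
Proof.
move=> h sp; rewrite (horner_coef_wide _ sp) mulr_sumr; apply: eq_bigr => j _.
have jN : (j <= N)%N by rewrite -ltnS.
rewrite -uf_x//; move: (xf tau) (uf tau) => x u.
have -> : x ^+ N = x ^+ (N - j) * x ^+ j by rewrite -exprD subnK.
by rewrite exprMn; ring.
Qed.

Lemma modular_form_poly N p (a : C) : (size p <= N.+1)%N ->
  modular_form_Gamma2 (2 * N) (fun tau : C => a * xf tau ^+ N * p.[uf tau]).
Proof.
move=> sp; split=> [tau h|g tau gG h|r].
- have D := hasDM (hasDZ a (hasDX N (@hasD_xf R))) (hasD_poly p hasD_uf).
  by have [] := cderiv_is_derive (D tau h).
- have [D0 _ X Y] := mobius_Gamma2 gG h.
  have U : uf (mobius g tau) = uf tau.
    rewrite /uf X Y; move: (xf tau) (xf_neq0 h) (yf tau) => x x0 y; move: (_ + _) D0 => D D0.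
    by field; rewrite x0.
  by rewrite U X exprMn exprM; ring.
exists (2 * N)%N, (cabs a * \sum_(j < N.+1) cabs p`_j * 32 ^+ N).
near=> y.
have y0 : 0 < y by near: y; exact: nbhs_right_gt.
have y1 : y <= 1 by near: y; apply: nbhs_right_le.
have h : inH (ratr r +i* y) by [].
have [Bx By] := xf_yf_bound h y1; rewrite /= in Bx By.
rewrite -cabsE lecR -mulrA homogenize// cabsM -mulrA ler_wpM2l ?cabs_ge0//.
rewrite mulr_suml; apply: le_trans (cabs_sum _ _ _) _; apply: ler_sum => j _.
rewrite cabsM -mulrA ler_wpM2l ?cabs_ge0// cabsM (cabsX (xf _)) (cabsX (yf _)).
have jN : (j <= N)%N by rewrite -ltnS.
have -> : 32 ^+ N * y ^- (2 * N) = (32 * y ^- 2) ^+ (N - j) * (32 * y ^- 2) ^+ j.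
  by rewrite -exprD subnK// exprMn exprM exprVn.
have := le_trans (cabs_ge0 _) Bx.
move: (cabs _) (cabs _) (32 * _) (cabs_ge0 (xf (ratr r +i* y))) (cabs_ge0 (yf (ratr r +i* y))) Bx By => X Y B X0 Y0 BX BY B0.
by rewrite ler_pM ?exprn_ge0// lerXn2r// nnegrE.
Unshelve. all: by end_near. Qed.

End Modularity.

(** * Homogeneous polynomials in x and y *)

Section HomogeneousPolynomial.
Variable R : realType.
Local Notation C := R[i].
Implicit Types (tau : C).

Lemma mmap1_pair (S : comNzRingType) (a b : S) (m : mpoly.multinom 2) :
  \prod_i tnth [tuple a; b] i ^+ m i = a ^+ m 0%R * b ^+ m 1%R.
Proof.
have E : lift ord0 ord0 = 1 :> 'I_2 by exact/val_inj.
by rewrite big_ord_recl big_ord1 E.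
Qed.

Lemma mdeg_pair (m : mpoly.multinom 2) : mdeg m = (m 0%R + m 1%R)%N.
Proof. by rewrite mpoly.mdegE big_ord_recl big_ord1; congr (m _ + m _)%N; exact/val_inj. Qed.

Variables (k : nat) (P : mpoly 2 C).
Hypothesis k_gt0 : (1 <= k)%N.
Hypothesis homP : P \is ishomog1 k mdeg.
Let f tau := meval (tnth [tuple xf tau; yf tau]) P.
Let P0 : {poly C} := mmap (@polyC C) (tnth [tuple 1; 'X]) P.

Let mdegP m : m \in msupp P -> (m 0%R + m 1%R)%N = k.
Proof. by move/dhomogP: homP => H /H; rewrite -mdeg_pair. Qed.

Let P0E : P0 = \sum_(m <- msupp P) (mcoeff m P)%:P * 'X^(m 1).
Proof.
by rewrite /P0 /mmap; apply: eq_bigr => m _; rewrite /mmap1 mmap1_pair expr1n mul1r.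
Qed.

Let fE tau : f tau = \sum_(m <- msupp P) mcoeff m P * (xf tau ^+ m 0 * yf tau ^+ m 1).
Proof. by rewrite /f mevalE; apply: eq_bigr => m _; rewrite mmap1_pair. Qed.

Lemma f_dehomogenize tau : inH tau -> f tau = xf tau ^+ k * P0.[uf tau].
Proof.
move=> h; rewrite fE P0E horner_sum mulr_sumr; apply: eq_big_seq => m /mdegP <-.
rewrite hornerM hornerC hornerXn -uf_x//; move: (xf tau) (uf tau) => x u.
by rewrite exprMn exprD; ring.
Qed.

Lemma qexp_homogeneous : exists c, qexp f c.
Proof.
have [cx X] := qexp_xf R; have [cy Y] := qexp_yf R.
have [|c Q] := @qexp_sum R _ (msupp P) (fun m tau => mcoeff m P * (xf tau ^+ m 0 * yf tau ^+ m 1)).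
  move=> m; have [d D] := qexpX (m 0) X; have [e E] := qexpX (m 1) Y.
  by eexists; exact: qexpZ (qexpM D E).
by exists c; apply: qexp_eq Q => t _; rewrite fE.
Qed.

Let kap (n : nat) : C := n.+1%:R * (n%:R + 2 * k%:R).

Let kap_neq0 n : kap n != 0.
Proof. by rewrite /kap -natrM -natrD -natrM pnatr_eq0; lia. Qed.

Let recP (Q : nat -> {poly C}) := Q 0%N = P0 /\ forall n : nat,
  (n.+1%:R * (n%:R + 2 * k%:R)) *: Q n.+1 + ('X^2 - 'X) * deriv (Q n)
    - (n%:R + k%:R) *: ('X * Q n) + 4^-1 *: ('X * prev_poly Q n) = 0.

Let G n (p q : {poly C}) : {poly C} := - ((kap n)^-1 *:
   (('X^2 - 'X) * deriv p - (n%:R + k%:R) *: ('X * p) + 4^-1 *: ('X * q))).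

Let recPE Q : recP Q <-> Q 0%N = P0 /\ forall n, Q n.+1 = G n (Q n) (prev_poly Q n).
Proof.
split=> -[Q0 H]; split=> // n.
  by apply/(solve_scale _ _ (kap_neq0 n)); rewrite -(H n) !addrA.
by have /(solve_scale _ _ (kap_neq0 n)) := H n; rewrite !addrA.
Qed.

Lemma recP_unique : exists! Q, recP Q.
Proof.
have [Q HQ] := poly_rec_exists G P0.
exists Q; split; first exact/recPE.
by move: HQ => [Q0 QS] Q' /recPE[Q'0 Q'S]; exact: poly_rec_unique Q0 QS Q'0 Q'S.
Qed.

(** The degree bound behind modularity: [(X^2 - X) p'] and [X p] raise the degree by at most one. *)
Lemma recP_size Q n : recP Q -> (size (Q n) <= (n + k).+1)%N.
Proof.
move=> /recPE[Q0 QS].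
have sX (p : {poly C}) m : (size p <= m)%N -> (size ('X * p)%R <= m.+1)%N.
  by move=> pm; apply: leq_trans (size_polyMleq _ _) _; rewrite size_polyX; lia.
have sD (p q : {poly C}) m : (size p <= m -> size q <= m -> size (p + q)%R <= m)%N.
  by move=> pm qm; apply: leq_trans (size_polyD _ _) _; rewrite geq_max pm.
have sZ (a : C) (p : {poly C}) m : (size p <= m -> size (a *: p)%R <= m)%N.
  by move=> pm; exact: leq_trans (size_scale_leq _ _) pm.
have sN (p : {poly C}) m : (size p <= m -> size (- p)%R <= m)%N by rewrite size_polyN.
suff: (size (Q n) <= (n + k).+1)%N /\ (size (prev_poly Q n) <= n + k)%N by case.
elim: n => [|n [IH1 IH2]].
  rewrite Q0 size_poly0; split=> //; rewrite P0E big_seq.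
  apply: (@big_ind _ (fun p : {poly C} => (size p <= (0 + k).+1)%N)) => [|p q|m /mdegP mk].
  - by rewrite size_poly0.
  - exact: sD.
  rewrite mul_polyC; apply: sZ; rewrite size_polyXn; lia.
split; last exact: IH1.
rewrite QS /G; apply/sN/sZ/sD; last by apply/sZ/sX; rewrite (leq_trans IH2)// leqnSn.
apply: (sD); last exact/sN/sZ/sX.
have s' : (size (Q n)^`() <= n + k)%N.
  by apply: leq_trans (size_poly _ _) _; lia.
rewrite (_ : ('X^2 - 'X) * _ = 'X * ('X * (Q n)^`() - (Q n)^`())); last by ring.
by apply/sX/sD; [exact/sX|apply/sN/ltnW].
Qed.

Lemma homogeneous_expansion c Q : is_expansion f c -> recP Q ->
  let fn := fun (n : nat) (tau : C) =>
    pi%:C ^+ (2 * n) * xf tau ^+ (n + k) * (Q n).[uf tau] in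
  (forall n : nat, modular_form_Gamma2 (2 * (n + k)) (fn n)) /\
  forall z tau, inH tau ->
    [/\ cvgn (series (g_term c (2 * k%:R - 1) z tau)),
        cvgn (series (fun n => fn n tau * z ^+ n))
      & csum (g_term c (2 * k%:R - 1) z tau)
        = cexp (Af tau * z) * csum (fun n => fn n tau * z ^+ n)].
Proof.
move=> /is_expansion_qexp F HQ fn; split=> [n|z tau h].
  exact: modular_form_poly (recP_size n HQ).
have D n := hasDM (hasDZ (pi%:C ^+ (2 * n)) (hasDX (n + k) (@hasD_xf R)))
                  (hasD_poly (Q n) (@hasD_uf R)).
apply: (generating_series_expansion _ F _ D) h => [|t h|n t h].
- by rewrite mulr_gt0// ltr0n.
- by rewrite muln0 expr0 mul1r add0n f_dehomogenize// HQ.1.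
have [_ /(_ n)] := HQ => /(congr1 (fun p => p.[uf t])).
rewrite !(hornerD, hornerN, hornerM, hornerZ, hornerX, hornerXn, horner0).
rewrite -uf_x// (_ : (2 * k%:R : R)%:C = 2 * k%:R); last by rewrite rmorphM !rmorph_nat.
have kS s : (n + k)%:R * xf t ^+ (n + k).-1 * (xf t * s) = (n%:R + k%:R) * xf t ^+ (n + k) * s.
  rewrite -natrD mulrA; congr (_ * _).
  by case: (n + k)%N => [|m]; rewrite ?mul0r// exprSr mulrA.
have pS : prev (fun n => pi%:C ^+ (2 * n) * xf t ^+ (n + k) * (Q n).[uf t]) n * (pi%:C ^+ 2 * xf t)
   = pi%:C ^+ (2 * n) * xf t ^+ (n + k) * (prev_poly Q n).[uf t].
  case: n {kS} => [|m] /=; first by rewrite horner0 !(mul0r, mulr0).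
  have -> : pi%:C ^+ (2 * m.+1) = pi%:C ^+ 2 * pi%:C ^+ (2 * m) :> C by rewrite mulnS exprD.
  rewrite addSn [xf t ^+ (_ + _).+1]exprS.
  by move: (xf t) (xf t ^+ (m + k)) (_.[_]) (pi%:C ^+ 2) (pi%:C ^+ (2 * m)) => *; ring.
have E1 : pi%:C ^+ (2 * n.+1) = pi%:C ^+ 2 * pi%:C ^+ (2 * n) :> C by rewrite mulnS exprD.
have E2 : xf t ^+ (n.+1 + k) = xf t * xf t ^+ (n + k) by rewrite addSn exprS.
rewrite kS E1 E2 (_ : pi%:C ^+ 4 * _ * _ = pi%:C ^+ 2 * xf t * uf t / 4 * (prev
  (fun n => pi%:C ^+ (2 * n) * xf t ^+ (n + k) * (Q n).[uf t]) n * (pi%:C ^+ 2 * xf t))); last first.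
  set pv := prev _ n; move: pv (xf t) (uf t) (pi%:C) => *; ring.
rewrite pS {kS pS E1 E2}.
move: ((prev_poly Q n).[_]) ((Q n.+1).[_]) ((Q n).[_]) ((Q n)^`().[_]).
move: (xf t) (uf t) (pf t) (pi%:C ^+ (2 * n)) (pi%:C ^+ 2) (n%:R) (n.+1%:R) (k%:R).
move=> x u p q r N N1 K g b a a'; move: (x ^+ (n + k)) => X E.
(* The terms in [p] cancel: [(2 n + 2 k) A] against the [4 (n + k) pi^2 p] from differentiating
   [x^(n+k)]. What remains is the polynomial recurrence at [u], times a common factor. *)
transitivity (r * q * x * X *
  (N1 * (N + 2 * K) * b + (u * u - u) * a' - (N + K) * (u * a) + 4^-1 * (u * g))).
  by ring.
by rewrite E mulr0.
Qed.

End HomogeneousPolynomial.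

(** * Products of powers of theta functions *)

Section ThetaProduct.
Variable R : realType.
Local Notation C := R[i].
Implicit Types (tau : C).
Variables (a : nat) (b c : rat).
Hypotheses (b4 : 4 * b \is a Num.nat) (c4 : 4 * c \is a Num.nat).
Let w : rat := 2 * (a%:R + b + c).
Hypothesis w_gt0 : 0 < w.
Let F tau := yf tau ^+ a * powNx b tau * powyBx c tau.

Lemma qexp_theta_product : exists c, qexp F c.
Proof.
have [e3 Q3 _] := qexp_theta R; have [e4 Q4 _] := qexp_theta4 R.
have [ey Qy] := qexp_yf R.
have [d1 D1] := qexpX a Qy; have [d2 D2] := qexpX (Num.truncn (4 * b)) Q4.
have [d3 D3] := qexpX (Num.truncn (4 * c)) Q3.
by eexists; exact: qexpM (qexpM D1 D2) D3.
Qed.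

Let B : C := ratr b.
Let W : C := ratr w.

Lemma ratr_rat4 (q : rat) : 4 * q \is a Num.nat ->
  (Num.truncn (4 * q))%:R = 4 * ratr q :> C.
Proof. by move=> /truncnK E; rewrite -(ratr_nat C) E rmorphM /= ratr_nat. Qed.

(** The logarithmic derivatives [a (4 p - x)], [4 b (p - y / 4)] and [4 c p] add up. The coefficient
    [2 w] of [p] is what [w A] compensates, and [a x + b y = x (a + b u)] gives the linear factor of
    the recurrence. *)
Lemma hasD_F : hasD F (fun t => F t * (2 * W * pf t - a%:R * xf t - B * yf t)).
Proof.
have Ds (f f' : C -> C) n : hasD f (fun t => f t * f' t) ->
    hasD (fun t => f t ^+ n) (fun t => f t ^+ n * (n%:R * f' t)).
  move=> H; apply: hasD_eq (hasDX n H) => // t h; case: n => [|n]; first by rewrite !mul0r mulr0.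
  by rewrite exprSr; ring.
have D1 := Ds _ _ a (@hasD_yf R).
have D2 : hasD (@powNx R b) (fun t => powNx b t * (4 * B * (pf t - yf t / 4))).
  rewrite -ratr_rat4//; apply: (Ds _ (fun t => pf t - yf t / 4)).
  by apply: hasD_eq (@hasD_theta4 R) => // t h; rewrite Dtheta4_pf.
have D3 : hasD (@powyBx R c) (fun t => powyBx c t * (4 * ratr c * pf t)).
  rewrite -ratr_rat4//; apply: (Ds _ (@pf R)).
  by apply: hasD_eq (@hasD_theta R) => // t h; rewrite Dtheta_pf.
apply: hasD_eq (hasDM (hasDM D1 D2) D3) => // t h.
rewrite /F /W /w /B !rmorphM !rmorphD /= !ratr_nat.
move: (powNx b t) (powyBx c t) (yf t ^+ a) (yf t) (xf t) (pf t) => *.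
by field.
Qed.

Let kap (n : nat) : rat := n.+1%:R * (n%:R + w).

Let kap_neq0 n : kap n != 0.
Proof. by rewrite /kap mulf_neq0 ?pnatr_eq0// gt_eqF// ltr_wpDl. Qed.

Let recphi (phi : nat -> {poly rat}) (n : nat) :=
  (n.+1%:R * (n%:R + w)) *: phi n.+1 + ('X^2 - 'X) * deriv (phi n)
  - (a%:R%:P + (n%:R + b) *: 'X) * phi n + 4^-1 *: ('X * prev_poly phi n) = 0.

Lemma recphi_exists : exists phi : nat -> {poly rat}, phi 0%N = 1 /\ forall n, recphi phi n.
Proof.
have [phi [p0 pS]] := poly_rec_exists (fun n p q => - ((kap n)^-1 *:
   (('X^2 - 'X) * deriv p - (a%:R%:P + (n%:R + b) *: 'X) * p + 4^-1 *: ('X * q)))) 1.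
exists phi; split=> // n; rewrite /recphi -!addrA.
by apply/(solve_scale _ _ (kap_neq0 n)); rewrite pS !addrA.
Qed.

Lemma theta_product_expansion cF phi : is_expansion F cF -> phi 0%N = 1 ->
  (forall n, recphi phi n) ->
  let Fn := fun (n : nat) (tau : C) => F tau * pi%:C ^+ (2 * n) * xf tau ^+ n
    * (map_poly ratr (phi n)).[uf tau] in
  forall z tau, inH tau ->
    [/\ cvgn (series (g_term cF (ratr w - 1) z tau)),
        cvgn (series (fun n => Fn n tau * z ^+ n))
      & csum (g_term cF (ratr w - 1) z tau)
        = cexp (Af tau * z) * csum (fun n => Fn n tau * z ^+ n)].
Proof.
move=> /is_expansion_qexp QF phi0 phiS Fn z tau h.
pose Q n := map_poly (ratr : rat -> C) (phi n).
have D n : hasD (Fn n) _ := hasDM (hasDM (hasDM hasD_F (hasD_cst (pi%:C ^+ (2 * n))))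
  (hasDX n (@hasD_xf R))) (hasD_poly (Q n) (@hasD_uf R)).
apply: (generating_series_expansion _ QF _ D) h => [|t h|n t h].
- by rewrite ltr0q.
- by rewrite /Fn phi0 rmorph1 hornerC muln0 !expr0 !mulr1.
have Uf := uf_x h.
have E : n.+1%:R * (n%:R + W) * (Q n.+1).[uf t] + (uf t ^+ 2 - uf t) * (Q n)^`().[uf t]
    - (a%:R + (n%:R + B) * uf t) * (Q n).[uf t]
    + 4^-1 * (uf t * (map_poly ratr (prev_poly phi n)).[uf t]) = 0.
  have R1 : ratr (n.+1%:R * (n%:R + w)) = n.+1%:R * (n%:R + W) :> C.
    by rewrite rmorphM rmorphD /= !ratr_nat.
  have R2 : ratr (n%:R + b) = n%:R + B :> C by rewrite rmorphD /= ratr_nat.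
  rewrite -R1 -R2 -(ratr_nat C a).
  exact: (recurrence_map (ratr : {rmorphism rat -> C}) (uf t) (phiS n)).
rewrite (_ : (ratr w : R)%:C = W); last by rewrite /W; exact: (fmorph_rat (real_complex R)).
have kS s : n%:R * xf t ^+ n.-1 * (xf t * s) = n%:R * xf t ^+ n * s.
  rewrite mulrA; congr (_ * _).
  by case: (n)%N => [|m]; rewrite ?mul0r// exprSr mulrA.
have pS : prev (fun n => Fn n t) n * (pi%:C ^+ 2 * xf t)
   = F t * pi%:C ^+ (2 * n) * xf t ^+ n * (map_poly ratr (prev_poly phi n)).[uf t].
  case: n {kS E} => [|m]; first by rewrite /= rmorph0 horner0 !(mul0r, mulr0).
  have -> : pi%:C ^+ (2 * m.+1) = pi%:C ^+ 2 * pi%:C ^+ (2 * m) :> C by rewrite mulnS exprD.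
  change (Fn m t * (pi%:C ^+ 2 * xf t) = F t * (pi%:C ^+ 2 * pi%:C ^+ (2 * m)) *
    xf t ^+ m.+1 * (map_poly ratr (phi m)).[uf t]).
  rewrite /Fn [xf t ^+ m.+1]exprS.
  by move: (xf t) (xf t ^+ m) (_.[_]) (pi%:C ^+ 2) (pi%:C ^+ (2 * m)) (F t) => *; ring.
have E1 : pi%:C ^+ (2 * n.+1) = pi%:C ^+ 2 * pi%:C ^+ (2 * n) :> C by rewrite mulnS exprD.
have E2 : Fn n.+1 t = F t * (pi%:C ^+ 2 * pi%:C ^+ (2 * n)) * (xf t * xf t ^+ n) * (Q n.+1).[uf t].
  by rewrite /Fn E1 [xf t ^+ n.+1]exprS.
have E3 : Fn n t = F t * pi%:C ^+ (2 * n) * xf t ^+ n * (Q n).[uf t] by [].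
rewrite kS E2 E3 -Uf (_ : pi%:C ^+ 4 * _ * _ = pi%:C ^+ 2 * xf t * uf t / 4 * (prev
  (fun n => Fn n t) n * (pi%:C ^+ 2 * xf t))); last first.
  set pv := prev _ n; move: pv (xf t) (uf t) (pi%:C) => *; ring.
move: E; rewrite pS {kS pS E1 E2 E3 Uf}.
move: ((map_poly _ (prev_poly _ n)).[_]) ((Q n.+1).[_]) ((Q n).[_]) ((Q n)^`().[_]).
move: (xf t) (uf t) (pf t) (pi%:C ^+ (2 * n)) (pi%:C ^+ 2) (F t) (n%:R) (n.+1%:R) (a%:R) W B.
move=> x u p q r f N N1 A W' B' g b1 a1 a1'; move: (x ^+ n) => X E.
(* Again [p] drops out: [(2 n + w) A] cancels the [4 n + 2 w] coming from [x^n] and [F]. *)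
transitivity (f * r * q * x * X * (N1 * (N + W') * b1 + (u ^+ 2 - u) * a1' -
  (A + (N + B') * u) * a1 + 4^-1 * (u * g))).
  by ring.
by rewrite E mulr0.
Qed.

End ThetaProduct.

Theorem theorem3 (R : realType) :
  (forall (k : nat) (P : mpoly 2 R[i]),
     (1 <= k)%N -> P \is ishomog1 k mdeg ->
     let f := fun tau : R[i] => meval (tnth [tuple xf tau; yf tau]) P in
     let recP := fun Pn : nat -> {poly R[i]} =>
       Pn 0%N = mmap (@polyC R[i]) (tnth [tuple 1; 'X]) P /\
       forall n : nat,
         (n.+1%:R * (n%:R + 2 * k%:R)) *: Pn n.+1
         + ('X^2 - 'X) * deriv (Pn n)
         - (n%:R + k%:R) *: ('X * Pn n)
         + 4^-1 *: ('X * prev_poly Pn n) = 0 in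
     (exists c : nat -> R[i], is_expansion f c) /\
     (exists! Pn : nat -> {poly R[i]}, recP Pn) /\
     forall (c : nat -> R[i]) (Pn : nat -> {poly R[i]}),
       is_expansion f c -> recP Pn ->
       let fn := fun (n : nat) (tau : R[i]) =>
         pi%:C ^+ (2 * n) * xf tau ^+ (n + k) * (Pn n).[uf tau] in
       (forall n : nat, modular_form_Gamma2 (2 * (n + k)) (fn n)) /\
       forall z tau : R[i], inH tau ->
         [/\ cvgn (series (g_term c (2 * k%:R - 1) z tau)),
             cvgn (series (fun n => fn n tau * z ^+ n))
           & csum (g_term c (2 * k%:R - 1) z tau)
             = cexp (Af tau * z) * csum (fun n => fn n tau * z ^+ n)])
  /\
  (forall (a : nat) (b c : rat),
     0 <= b -> 0 <= c -> 4 * b \is a Num.nat -> 4 * c \is a Num.nat ->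
     let w : rat := 2 * (a%:R + b + c) in
     0 < w ->
     let F := fun tau : R[i] =>
       yf tau ^+ a * powNx b tau * powyBx c tau in
     (exists cF : nat -> R[i], is_expansion F cF) /\
     exists phi : nat -> {poly rat},
       [/\ phi 0%N = 1,
           forall n : nat,
             (n.+1%:R * (n%:R + w)) *: phi n.+1
             + ('X^2 - 'X) * deriv (phi n)
             - (a%:R%:P + (n%:R + b) *: 'X) * phi n
             + 4^-1 *: ('X * prev_poly phi n) = 0
         & forall cF : nat -> R[i], is_expansion F cF ->
           let Fn := fun (n : nat) (tau : R[i]) =>
             F tau * pi%:C ^+ (2 * n) * xf tau ^+ n
             * (map_poly ratr (phi n)).[uf tau] in
           forall z tau : R[i], inH tau ->
             [/\ cvgn (series (g_term cF (ratr w - 1) z tau)),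
                 cvgn (series (fun n => Fn n tau * z ^+ n))
               & csum (g_term cF (ratr w - 1) z tau)
                 = cexp (Af tau * z) * csum (fun n => Fn n tau * z ^+ n)]]).
Proof.
split=> [k P k1 homP f recP|a b c b0 c0 b4 c4 w w0 F].
  split; first by have [c Q] := qexp_homogeneous P; exists c; exact: qexp_is_expansion Q.
  by split=> [|c Pn]; [exact: recP_unique|exact: homogeneous_expansion].
split; first by have [d Q] := qexp_theta_product R a b c; exists d; exact: qexp_is_expansion Q.
have [phi [phi0 phiS]] := recphi_exists w0.
by exists phi; split=> // cF QF; exact: (theta_product_expansion b4 c4 w0 QF phi0 phiS).
Qed.
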